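(* Let $d\ge1$, $\lambda_1,\dots,\lambda_d\in\mathbb{R}$, $k_1,\dots,k_d\in\mathbb{R}$, let $\alpha>0$ and let $C=(c_{ij})_{1\le i,j\le d}$ be a symmetric positive definite matrix. Let $\Gamma=(\Gamma_1,\dots,\Gamma_d)$ be a $d$-variate gamma random vector (in the sense of Krishnamoorthy and Parthasarathy) with degree of freedom $2\alpha$ and covariance matrix $C$, and let $$F=\sum_{i=1}^d\lambda_i(\Gamma_i-\alpha k_i).$$ Put $\kappa=\sum_{j=1}^d\lambda_jk_j$, $r_j=\sum_{S\subset\{1,\dots,d\},\,\#S=j}|C|_S\prod_{s\in S}\lambda_s$ for $1\le j\le d$, and $r_{d+1}=0$. Let $Y$ be a real valued random variable such that $\mathbb{E}[|Y|]<+\infty$. Then $Y$ has the same law as $F$ if and only if $$\mathbb{E}\left[(Y+\alpha(\kappa-r_1))f(Y)+\sum_{j=1}^d(-1)^j\big(r_j(Y+\alpha\kappa)-\alpha(j+1)r_{j+1}\big)f^{(j)}(Y)\right]=0$$ for all $f\in\mathcal{S}(\mathbb{R})$.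
   Context: A random vector $\Gamma=(\Gamma_1,\dots,\Gamma_d)$ has a $d$-variate gamma distribution in the sense of Krishnamoorthy and Parthasarathy with degree of freedom $\nu=2\alpha$ and covariance matrix $C$ if its characteristic function is $\phi_\Gamma(t_1,\dots,t_d)=|I_d-iCT|^{-\alpha}$ for $t_j\ge0$, $j=1,\dots,d$, where $|\cdot|$ is the determinant, $I_d$ the $d\times d$ identity matrix, $\alpha>0$, $T=\mathrm{diag}(t_1,\dots,t_d)$, and $C$ is a symmetric positive definite $d\times d$ matrix (the power being the continuous branch equal to $1$ at $t=0$). It is assumed throughout that $C$ and $\alpha$ are such that this is a bona fide characteristic function. $|C|_S$ denotes the determinant of the submatrix $(c_{ij})_{i,j\in S}$. $\mathcal{S}(\mathbb{R})$ is the Schwartz space of smooth rapidly decreasing functions on $\mathbb{R}$. *)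

(* Defs.v *)
From HB Require Import structures.
From mathcomp Require Import all_boot all_order all_algebra.
From mathcomp Require Import complex.
From mathcomp Require Import all_classical all_reals all_analysis.
From mathcomp Require Import measurable_realfun.
Set Implicit Arguments.
Unset Strict Implicit.
Unset Printing Implicit Defensive.
Import Order.TTheory GRing.Theory Num.Theory.
Import numFieldNormedType.Exports.
Local Open Scope classical_set_scope.
Local Open Scope ring_scope.
Local Open Scope complex_scope.

Definition symposdef (R : realType) (d : nat) (C : 'M[R]_d) : Prop :=
  C^T = C /\ forall x : 'rV[R]_d, x != 0 -> 0 < (x *m C *m x^T) ord0 ord0.

Definition cexp (R : realType) (z : R[i]) : R[i] :=
  (expR (complex.Re z) * cos (complex.Im z))
  +i* (expR (complex.Re z) * sin (complex.Im z)).

Definition orthant (R : realType) (d : nat) : set 'rV[R]_d :=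
  [set t | forall j, 0 <= t ord0 j].

(* E[exp(i<t,X>)] by real and imaginary parts; both integrands are bounded, so
   fine loses nothing. *)
Definition charfn d0 (T : measurableType d0) (R : realType)
    (P : probability T R) (d : nat) (X : 'I_d -> {RV P >-> R})
    (t : 'rV[R]_d) : R[i] :=
  fine ('E_P[fun w => cos (\sum_(j < d) t ord0 j * X j w)])
  +i* fine ('E_P[fun w => sin (\sum_(j < d) t ord0 j * X j w)]).

Definition gamma_det (R : realType) (d : nat) (C : 'M[R]_d) (t : 'rV[R]_d) :
    R[i] :=
  \det (1%:M - (0 +i* 1) *: map_mx (fun x : R => x%:C) (C *m diag_mx t)).

(* The continuous branch on the orthant of the logarithm of |I - iCT| that
   vanishes at t = 0; it is unique on the orthant, which is connected.
   Continuity into R[i] is stated on real and imaginary parts. *)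
Definition log_branch (R : realType) (d : nat) (C : 'M[R]_d)
    (L : 'rV[R]_d -> R[i]) : Prop :=
  [/\ L 0 = 0,
      {within @orthant R d, continuous (fun t => complex.Re (L t))},
      {within @orthant R d, continuous (fun t => complex.Im (L t))} &
      forall t, orthant t -> cexp (L t) = gamma_det C t].

(* |I - iCT|^(-alpha) is exp (-alpha L), with L the above logarithm. *)
Definition kp_gamma d0 (T : measurableType d0) (R : realType)
    (P : probability T R) (d : nat) (X : 'I_d -> {RV P >-> R})
    (alpha : R) (C : 'M[R]_d) : Prop :=
  exists2 L : 'rV[R]_d -> R[i], log_branch C L &
    forall t, orthant t -> charfn X t = cexp (- (alpha%:C * L t)).

Definition gamma_comb d0 (T : measurableType d0) (R : realType)
    (P : probability T R) (d : nat) (X : 'I_d -> {RV P >-> R})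
    (alpha : R) (lambda k : 'I_d -> R) : T -> R :=
  fun w => \sum_(i < d) lambda i * (X i w - alpha * k i).

Lemma measurable_gamma_comb d0 (T : measurableType d0) (R : realType)
    (P : probability T R) (d : nat) (X : 'I_d -> {RV P >-> R})
    (alpha : R) (lambda k : 'I_d -> R) :
  measurable_fun setT (gamma_comb X alpha lambda k).
Proof.
apply: measurable_sum => i.
by apply: measurable_funM => //; apply: measurable_funB.
Qed.

HB.instance Definition _ d0 (T : measurableType d0) (R : realType)
    (P : probability T R) (d : nat) (X : 'I_d -> {RV P >-> R})
    (alpha : R) (lambda k : 'I_d -> R) :=
  isMeasurableFun.Build _ _ _ _ (gamma_comb X alpha lambda k)
    (measurable_gamma_comb X alpha lambda k).

(* Only measurable sets matter: measures of the library are functions on all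
   sets, with no meaning off the sigma-algebra. *)
Definition same_law d1 (T1 : measurableType d1) d2 (T2 : measurableType d2)
    (R : realType) (P1 : probability T1 R) (P2 : probability T2 R)
    (X1 : {RV P1 >-> R}) (X2 : {RV P2 >-> R}) : Prop :=
  forall A : set R, measurable A -> distribution P1 X1 A = distribution P2 X2 A.

Definition principal_minor (R : realType) (d : nat) (C : 'M[R]_d)
    (S : {set 'I_d}) : R :=
  \det (\matrix_(i < #|S|, j < #|S|) C (enum_val i) (enum_val j)).

Definition rcoef (R : realType) (d : nat) (C : 'M[R]_d) (lambda : 'I_d -> R)
    (j : nat) : R :=
  \sum_(S : {set 'I_d} | #|S| == j)
    principal_minor C S * \prod_(s in S) lambda s.

(* In particular r_(d+1) = 0, the sum being empty. *)
Lemma rcoef_gt (R : realType) (d : nat) (C : 'M[R]_d) (lambda : 'I_d -> R)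
    (j : nat) : (d < j)%N -> rcoef C lambda j = 0.
Proof.
move=> dj; apply: big_pred0 => S; apply/eqP => Sj.
by move: (max_card (mem S)); rewrite Sj card_ord leqNgt dj.
Qed.

Definition schwartz (R : realType) (f : R -> R) : Prop :=
  (forall (n : nat) (x : R), derivable (f^`(n)%classic) x 1) /\
  (forall m n : nat, exists M : R, forall x : R, `|x ^+ m * (f^`(n)%classic) x| <= M).

(* Main.v *)
(* Let p(s) = |I - isCΛ| = \sum_j r_j (-is)^j. For the gamma vector, G = \sum_j
   λ_j Γ_j and X = \sum_j Γ_j, the hypothesis gives E e^{i(sG + bX)} only while
   all sλ_j + b are nonnegative; there, differentiating |I - iCT|^{-α} along
   t_j = sλ_j + b shows that the determinant times i E[G e^{i(sG + bX)}] plus α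
   times its s-derivative times E e^{i(sG + bX)} vanishes. The marginals
   have exponential moments, so the left-hand side is analytic in b with a
   radius of convergence bounded below, and vanishes at b = 0 as well,
   whatever the signs of the λ_j. Hence F solves the ordinary differential equation
      p(t) E[F e^{itF}] + α (κ p(t) - i p'(t)) E e^{itF} = 0.
   Since p has no real zero, this equation has at most one solution equal to 1
   at 0, so it characterizes the law of F among integrable variables.
   It is also the Stein identity for f(x) = e^{itx}: the identity for Schwartz
   functions yields it through f(x) = e^{itx} e^{-ε²x²} as ε tends to 0, and
   is recovered from it by Fourier inversion. *)
Require Import Defs.
From HB Require Import structures.
From mathcomp Require Import all_boot all_order all_algebra all_fingroup.
From mathcomp Require Import complex.
From mathcomp Require Import all_classical all_reals all_analysis.
From mathcomp Require Import measurable_realfun ring lra.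
Import Order.TTheory GRing.Theory Num.Theory.
Import numFieldNormedType.Exports.
Local Open Scope classical_set_scope.
Local Open Scope ring_scope.
Set Implicit Arguments.
Unset Strict Implicit.
Unset Printing Implicit Defensive.

(** * Integrals of real functions *)

(** The power |I - iCT|^(-alpha) enters only through its logarithmic derivative: with z the
    determinant and w = z^(-alpha), the relation z w' + alpha z' w = 0 mentions no branch, and z is
    polynomial. This is what can be continued out of the orthant. The direction (1, ..., 1) is
    chosen because s lambda + b (1, ..., 1) lies in the open orthant for every large b, whatever s.
    The moments behind the analyticity in b come from cosines: E cos(t Gamma_j) is even in t, hence
    known on the whole line from t >= 0, and equals the real part of (1 - ict)^(-alpha) with c =
    c_jj. Its n-th derivative is at most |c|^n alpha (alpha + 1) ... (alpha + n - 1); iterated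
    second differences and Fatou's lemma turn this into bounds on the even moments. Their factorial
    growth gives one radius of convergence valid at every b, so continuation by steps of fixed
    length reaches b = 0. Fourier inversion is done by Abel summation: the weight e^(-et) on t >= 0
    has the Poisson kernel as cosine transform, so no decay of the transform of f has to be
    established. *)

Section real_integrals.
Context d (T : measurableType d) (R : realType) (mu : {measure set T -> \bar R}).
Implicit Types f g : T -> R.

Definition L1 f := mu.-integrable setT (EFin \o f).

Lemma L1_measurable f : L1 f -> measurable_fun setT f.
Proof. by move=> /integrableP[/measurable_EFinP]. Qed.

Lemma L1_le f g : measurable_fun setT f -> (forall x, `|f x| <= g x) ->
  L1 g -> L1 f.
Proof.
move=> mf fg; apply: le_integrable => //; first exact/measurable_EFinP.
by move=> x _ /=; rewrite lee_fin (le_trans (fg x))// ler_norm.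
Qed.

Lemma L1D f g : L1 f -> L1 g -> L1 (fun x => f x + g x).
Proof. exact: integrableD. Qed.

Lemma L1N f : L1 f -> L1 (fun x => - f x).
Proof. exact: integrableN. Qed.

Lemma L1B f g : L1 f -> L1 g -> L1 (fun x => f x - g x).
Proof. by move=> If Ig; apply: L1D => //; exact: L1N. Qed.

Lemma L1Zl k f : L1 f -> L1 (fun x => k * f x).
Proof. exact: integrableZl. Qed.

Lemma L1_norm f : L1 f -> L1 (fun x => `|f x|).
Proof. exact: integrable_norm. Qed.

Lemma L1_sum (I : Type) (s : seq I) (P : pred I) (f : I -> T -> R) :
  (forall i, P i -> L1 (f i)) -> L1 (fun x => \sum_(i <- s | P i) f i x).
Proof.
move=> If; rewrite /L1 (_ : _ \o _ = fun x => \sum_(i <- s | P i) (f i x)%:E)%E.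
  by apply: integrable_sum => // i Pi; exact: If.
by apply/funext => x /=; rewrite sumEFin.
Qed.

Lemma L1_bM f g M : L1 f -> measurable_fun setT g -> (forall x, `|g x| <= M) ->
  L1 (fun x => f x * g x).
Proof.
move=> If mg gM; apply: (@L1_le _ (fun x => M * `|f x|)).
- by apply: measurable_funM => //; exact: L1_measurable.
- by move=> x; rewrite normrM mulrC ler_wpM2r.
- by apply: L1Zl; exact: L1_norm.
Qed.

Lemma Rint_sum (I : Type) (s : seq I) (P : pred I) (f : I -> T -> R) :
  (forall i, P i -> L1 (f i)) ->
  \int[mu]_x (\sum_(i <- s | P i) f i x) = \sum_(i <- s | P i) \int[mu]_x (f i x).
Proof.
move=> If; elim: s => [|i s IH].
  by under eq_Rintegral do rewrite big_nil; rewrite big_nil Rintegral_cst// mul0r.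
under eq_Rintegral do rewrite big_cons; rewrite big_cons.
case: ifPn => // Pi; rewrite RintegralD ?IH//; first exact: If.
exact: L1_sum.
Qed.

Lemma Rint_dct (f_ : nat -> T -> R) f g :
  (forall n, measurable_fun setT (f_ n)) ->
  (forall x, f_ n x @[n --> \oo] --> f x) ->
  L1 g -> (forall n x, `|f_ n x| <= g x) ->
  L1 f /\ \int[mu]_x f_ n x @[n --> \oo] --> \int[mu]_x f x.
Proof.
move=> mf_ cvf Ig fg.
have mf : measurable_fun setT f.
  by apply: measurable_fun_cvg => [m|x _]; [exact: mf_|exact: cvf].
have [||||? _ ci] := @dominated_convergence _ _ _ mu setT measurableT
  (fun n x => (f_ n x)%:E) (EFin \o f) (EFin \o g) _ _ _ Ig _.
- by move=> n; exact/measurable_EFinP.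
- exact/measurable_EFinP.
- by apply: aeW => x _ /=; apply/cvg_EFin; [exact: nearW|exact: cvf].
- by apply: aeW => x n _ /=; rewrite lee_fin.
split => //; rewrite /Rintegral; apply: fine_cvg => /=.
rewrite fineK; first exact: ci.
exact: integrable_fin_num.
Qed.

Lemma Rint_norm_le f : L1 f -> `|\int[mu]_x f x| <= \int[mu]_x `|f x|.
Proof. by move=> If; exact: le_normr_Rintegral. Qed.

End real_integrals.
Arguments L1 {d T R} mu f.

(** The product majorant makes every section integrable, not merely almost every one. The inner
    integrals are then finite everywhere, and their real values agree with the extended ones. *)
Lemma L1_fubini d1 d2 (T1 : measurableType d1) (T2 : measurableType d2)
  (R : realType) (m1 : {sigma_finite_measure set T1 -> \bar R})
  (m2 : {sigma_finite_measure set T2 -> \bar R}) (f : T1 * T2 -> R)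
  (g1 : T1 -> R) (g2 : T2 -> R) :
  measurable_fun setT f -> (forall x, `|f x| <= g1 x.1 * g2 x.2) ->
  L1 m1 g1 -> L1 m2 g2 ->
  [/\ (m1 \x m2)%E.-integrable setT (EFin \o f),
      forall x, L1 m2 (fun y => f (x, y)) &
      L1 m1 (fun x => \int[m2]_y f (x, y))].
Proof.
move=> mf fg I1 I2.
have mf1 x : measurable_fun setT (fun y => f (x, y)).
  by apply: measurableT_comp => //; exact: measurable_pair1.
have If1 x : L1 m2 (fun y => f (x, y)).
  apply: (@L1_le _ _ _ m2 _ (fun y => g1 x * g2 y)) => [//||].
    by move=> y; exact: fg (x, y).
  exact: (@L1Zl _ _ _ m2 (g1 x) g2 I2).
have If : (m1 \x m2)%E.-integrable setT (EFin \o f).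
  apply/integrable12ltyP; first exact/measurable_EFinP.
  have I12 : L1 m1 (fun x => (\int[m2]_y `|g2 y|) * `|g1 x|).
    by apply: L1Zl; exact: L1_norm.
  apply: le_lt_trans (integrable_lty measurableT I12).
  apply: ge0_le_integral => //.
  - by move=> x _; exact: integral_ge0.
  - apply: (@measurable_fun_fubini_tonelli_F _ _ _ _ _ m2
      (fun z => `|(f z)%:E|)%E).
    + by apply: measurableT_comp => //; exact/measurable_EFinP.
    + by [].
  - by apply/measurable_EFinP; exact: (L1_measurable I12).
  - move=> x _ /=.
    rewrite EFinM muleC; rewrite [X in (_ * X)%E](_ : _ = \int[m2]_y `|g2 y|%:E)%E.
      rewrite -ge0_integralZl//; last first.
        by apply/measurable_EFinP; exact: (L1_measurable (L1_norm I2)).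
      apply: ge0_le_integral => //.
      + by apply/measurable_EFinP; exact: measurableT_comp.
      + apply/measurable_EFinP; apply: measurable_funM => //.
        exact: (L1_measurable (L1_norm I2)).
      + move=> y _; rewrite lee_fin -normrM (le_trans (fg _))//=.
        exact: ler_norm.
    rewrite /Rintegral fineK//; apply: integrable_fin_num => //.
    exact: (L1_norm I2).
have E1 x : (\int[m2]_y (f (x, y))%:E = (\int[m2]_y f (x, y))%:E)%E.
  by rewrite /Rintegral fineK//; apply: integrable_fin_num => //; exact: If1.
split=> //; apply: eq_integrable (integrable_fubini_F If) => // x _.
by rewrite /= /fubini_F /= E1.
Qed.

Lemma Rfubini d1 d2 (T1 : measurableType d1) (T2 : measurableType d2)
  (R : realType) (m1 : {sigma_finite_measure set T1 -> \bar R})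
  (m2 : {sigma_finite_measure set T2 -> \bar R}) (f : T1 * T2 -> R)
  (g1 : T1 -> R) (g2 : T2 -> R) :
  measurable_fun setT f -> (forall x, `|f x| <= g1 x.1 * g2 x.2) ->
  L1 m1 g1 -> L1 m2 g2 ->
  [/\ \int[m1]_x \int[m2]_y f (x, y) = \int[m2]_y \int[m1]_x f (x, y),
      L1 m1 (fun x => \int[m2]_y f (x, y)) &
      L1 m2 (fun y => \int[m1]_x f (x, y))].
Proof.
move=> mf fg I1 I2.
have [If If1 IF] := L1_fubini mf fg I1 I2.
have msf : measurable_fun setT (fun z : T2 * T1 => f (z.2, z.1)).
  apply: measurableT_comp => //.
  by apply/measurable_fun_pairP; split; [exact: measurable_snd|exact: measurable_fst].
have sfg x : `|f (x.2, x.1)| <= g2 x.1 * g1 x.2.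
  by rewrite mulrC; exact: fg.
have [_ If2 IG] := L1_fubini msf sfg I2 I1.
have E1 x : (\int[m2]_y (f (x, y))%:E = (\int[m2]_y f (x, y))%:E)%E.
  by rewrite /Rintegral fineK//; apply: integrable_fin_num => //; exact: If1.
have E2 y : (\int[m1]_x (f (x, y))%:E = (\int[m1]_x f (x, y))%:E)%E.
  by rewrite /Rintegral fineK//; apply: integrable_fin_num => //; exact: If2.
split => //; have := Fubini If.
move=> /=; under eq_integral do rewrite E1.
by under [in X in _ = X -> _]eq_integral do rewrite E2; move=> FE; rewrite /Rintegral FE.
Qed.

Section trigonometric_integrals.
Context (R : realType).

Lemma is_derive_Rint d (T : measurableType d) (mu : {measure set T -> \bar R})
    (F F' : R -> T -> R) (G : T -> R) (t : R) :
  (forall s, L1 mu (F s)) -> (forall (s : R) x, is_derive s 1 (F^~ x) (F' s x)) ->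
  (forall s x, `|F' s x| <= G x) -> L1 mu G ->
  is_derive t 1 (fun s => \int[mu]_x F s x) (\int[mu]_x F' t x).
Proof.
move=> IF dF FG IG.
have tI : `]t - 1, t + 1[%classic t.
  by rewrite /= in_itv/= ltrBlDr ltrDl ltr01.
have dE s x : partial1of2 F s x = F' s x.
  by rewrite partial1of2E; apply: derive_val.
have dF' (s : R) x : derivable (F^~ x) s 1 by have := dF s x => -[].
have G0 x : 0 <= G x by exact: le_trans (FG t x).
have FG' s x : `|partial1of2 F s x| <= G x by rewrite dE.
split.
  exact: (derivable_under_integral measurableT tI (fun s _ => IF s)
    (fun s x _ _ => dF' s x) G0 IG (fun s x _ _ => FG' s x)).
rewrite -derive1E (differentiation_under_integral measurableT tI (fun s _ => IF s)
    (fun s x _ _ => dF' s x) G0 IG (fun s x _ _ => FG' s x)).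
by apply: eq_Rintegral => x _; exact: dE.
Qed.

Lemma measurable_cos : measurable_fun setT (@cos R).
Proof. by apply: continuous_measurable_fun; exact: continuous_cos. Qed.

Lemma measurable_sin : measurable_fun setT (@sin R).
Proof. by apply: continuous_measurable_fun; exact: continuous_sin. Qed.

Lemma normr_cos_le1 (x : R) : `|cos x| <= 1.
Proof. by rewrite ler_norml cos_geN1 cos_le1. Qed.

Lemma normr_sin_le1 (x : R) : `|sin x| <= 1.
Proof. by rewrite ler_norml sin_geN1 sin_le1. Qed.

Context d (T : measurableType d) (mu : {measure set T -> \bar R}).
Implicit Types W A B : T -> R.

(** Real and imaginary parts of the integral of [W] e^(i[A]). The weight makes the family stable
    under differentiation in a parameter of the phase, since each derivative brings down a
    factor. *)
Definition Icos W A := \int[mu]_x (W x * cos (A x)).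
Definition Isin W A := \int[mu]_x (W x * sin (A x)).

Lemma L1_cos W A : L1 mu W -> measurable_fun setT A ->
  L1 mu (fun x => W x * cos (A x)).
Proof.
move=> IW mA; apply: (@L1_bM _ _ _ _ _ _ 1) => // [|x]; last exact: normr_cos_le1.
by apply: measurableT_comp mA; exact: measurable_cos.
Qed.

Lemma L1_sin W A : L1 mu W -> measurable_fun setT A ->
  L1 mu (fun x => W x * sin (A x)).
Proof.
move=> IW mA; apply: (@L1_bM _ _ _ _ _ _ 1) => // [|x]; last exact: normr_sin_le1.
by apply: measurableT_comp mA; exact: measurable_sin.
Qed.

Lemma is_derive_Icos W A B (t : R) : L1 mu W -> L1 mu (fun x => W x * A x) ->
  measurable_fun setT A -> measurable_fun setT B ->
  is_derive t 1 (fun s => Icos W (fun x => s * A x + B x))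
    (- Isin (fun x => W x * A x) (fun x => t * A x + B x)).
Proof.
move=> IW IWA mA mB.
have mAB s : measurable_fun setT (fun x => s * A x + B x).
  by apply: measurable_funD => //; exact: measurable_funM.
have -> : - Isin (fun x => W x * A x) (fun x => t * A x + B x) =
    \int[mu]_x (- (W x * A x * sin (t * A x + B x))).
  rewrite /Isin -mulN1r -RintegralZl//; last exact: L1_sin.
  by apply: eq_Rintegral => x _; rewrite mulN1r.
apply: (@is_derive_Rint _ _ _ (fun s x => W x * cos (s * A x + B x))
    (fun s x => - (W x * A x * sin (s * A x + B x))) (fun x => `|W x * A x|)).
- by move=> s; exact: L1_cos.
- move=> s x.
  have : is_derive s (1:R) (fun s => s * A x + B x) (A x).
    by apply: is_derive_eq; rewrite /GRing.scale/= !(mulr0, add0r, addr0, mulr1).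
  by move=> h; apply: is_derive_eq; rewrite /GRing.scale/= mulNr mulrN mulrA mulrAC.
- by move=> s x; rewrite normrN normrM ler_piMr// normr_sin_le1.
- exact: L1_norm.
Qed.

Lemma is_derive_Isin W A B (t : R) : L1 mu W -> L1 mu (fun x => W x * A x) ->
  measurable_fun setT A -> measurable_fun setT B ->
  is_derive t 1 (fun s => Isin W (fun x => s * A x + B x))
    (Icos (fun x => W x * A x) (fun x => t * A x + B x)).
Proof.
move=> IW IWA mA mB.
have mAB s : measurable_fun setT (fun x => s * A x + B x).
  by apply: measurable_funD => //; exact: measurable_funM.
apply: (@is_derive_Rint _ _ _ (fun s x => W x * sin (s * A x + B x))
    (fun s x => W x * A x * cos (s * A x + B x)) (fun x => `|W x * A x|)).
- by move=> s; exact: L1_sin.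
- move=> s x.
  have : is_derive s (1:R) (fun s => s * A x + B x) (A x).
    by apply: is_derive_eq; rewrite /GRing.scale/= !(mulr0, add0r, addr0, mulr1).
  by move=> h; apply: is_derive_eq; rewrite /GRing.scale/= mulrA mulrAC.
- by move=> s x; rewrite normrM ler_piMr// normr_cos_le1.
- exact: L1_norm.
Qed.

End trigonometric_integrals.

(** * Fourier inversion with the Poisson kernel *)

Section poisson_kernel.
Context (R : realType).
Local Notation leb := (@lebesgue_measure R).
Implicit Types (e x y t : R) (f : R -> R).

(** The Poisson kernel of the half-plane without its factor 1/pi, so its total mass is [pi]. At e =
    1 it also serves below as the reference rate of decay 1/(1 + x^2). *)
Definition cauchy e u : R := e / (e ^+ 2 + u ^+ 2).

Lemma cauchy_den_gt0 e u : 0 < e -> 0 < e ^+ 2 + u ^+ 2.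
Proof. by move=> e0; rewrite ltr_wpDr ?sqr_ge0 ?exprn_gt0. Qed.

Lemma cauchy_ge0 e u : 0 < e -> 0 <= cauchy e u.
Proof. by move=> e0; rewrite divr_ge0 ?ltW// cauchy_den_gt0. Qed.

Lemma continuous_cauchy e y : 0 < e -> continuous (fun u => cauchy e (u - y)).
Proof.
move=> e0 u; apply: cvgM; first exact: cvg_cst.
apply: cvgV; first by rewrite gt_eqF// cauchy_den_gt0.
apply: cvgD; first exact: cvg_cst.
by apply: (@cvgM _ _ _ _ (fun x => x - y) (fun x => x - y));
  apply: cvgB; [exact: cvg_id|exact: cvg_cst|exact: cvg_id|exact: cvg_cst].
Qed.

(** The substitution v = (u - y)/e reduces this to the integral of 1/(1 + v^2), which is twice pi/2
    by symmetry. *)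
Lemma integral_cauchy e y : 0 < e ->
  (\int[leb]_u (cauchy e (u - y))%:E = pi%:E)%E.
Proof.
move=> e0; pose G (v : R) := (1 + v ^+ 2)^-1.
have G0 v : 0 <= G v by rewrite invr_ge0 addr_ge0// sqr_ge0.
have cG : continuous G by exact: continuous_oneDsqrV.
pose F u := (u - y) / e.
have dF (u : R) : is_derive u 1 F e^-1.
  rewrite /F; apply: is_derive_eq; rewrite /GRing.scale/=; ring.
have F'E : F^`()%classic = cst e^-1.
  by apply/funext => u; rewrite derive1E; have [_ ->] := dF u.
transitivity (\int[leb]_v (G v)%:E)%E; last first.
  rewrite ge0_symfun_integralT//; last by move=> v; rewrite /= /G sqrrN.
  rewrite -set_itvcy integral0y_oneDsqr// -EFinM; congr EFin.
  by rewrite mulrC -mulrA mulVf ?mulr1// pnatr_eq0.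
rewrite (@increasing_ge0_integration_by_substitutionT _ F G)//.
- apply: eq_integral => u _; congr EFin; rewrite F'E.
  transitivity (G (F u) * e^-1); last by [].
  rewrite /cauchy /G /F.
  have ne0 : e != 0 by rewrite gt_eqF.
  have dn0 : e ^+ 2 + (u - y) ^+ 2 != 0 by rewrite gt_eqF// cauchy_den_gt0.
  have -> : 1 + ((u - y) / e) ^+ 2 = (e ^+ 2 + (u - y) ^+ 2) / e ^+ 2.
    by field.
  by field; rewrite ne0 dn0.
- by move=> a b ab; rewrite /F ltr_pM2r ?invr_gt0// ltrD2r.
- by rewrite F'E => ?; exact: cvg_cst.
- by rewrite F'E; exact: is_cvg_cst.
- by rewrite F'E; exact: is_cvg_cst.
- apply: gt0_cvgMlNy; first by rewrite invr_gt0.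
  apply/cvgrNyPle => A; near=> x; rewrite lerBlDr; near: x.
  exact: nbhs_ninfty_le.
- apply: gt0_cvgMly; first by rewrite invr_gt0.
  exact: cvg_addrr.
Unshelve. all: by end_near. Qed.

Lemma L1_cauchy e y : 0 < e -> L1 leb (fun u => cauchy e (u - y)).
Proof.
move=> e0; apply/integrableP; split.
  by apply/measurable_EFinP; apply: continuous_measurable_fun; exact: continuous_cauchy.
rewrite (_ : (\int[_]_(x in _) _)%E = pi%:E) ?ltry//.
rewrite -(integral_cauchy y e0); apply: eq_integral => u _.
by rewrite /= ger0_norm// cauchy_ge0.
Qed.

Lemma Rintegral_cauchy e y : 0 < e -> \int[leb]_u cauchy e (u - y) = pi.
Proof. by move=> e0; rewrite /Rintegral integral_cauchy. Qed.

Lemma is_derive_continuous (f f' : R -> R) :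
  (forall x : R, is_derive x 1 f (f' x)) -> continuous f.
Proof.
move=> df x; apply: differentiable_continuous; apply/derivable1_diffP.
by have [] := df x.
Qed.

(** Nonnegativity of [g] turns the existence of a limit of its primitive into integrability. *)
Lemma Rint_FTC2y (g F : R -> R) (l : R) : (forall t, 0 <= t -> 0 <= g t) -> continuous g ->
  (forall t : R, is_derive t 1 F (g t)) -> F t @[t --> +oo] --> l ->
  L1 leb (g \_ `[0, +oo[) /\ \int[leb]_t (g \_ `[0, +oo[) t = l - F 0.
Proof.
move=> g0 cg dF Fl.
have cF := is_derive_continuous dF.
have E : (\int[leb]_(t in `[0%R, +oo[) (g t)%:E = l%:E - (F 0)%:E)%E.
  apply: ge0_continuous_FTC2y => //.
  - exact: continuous_subspaceT.
  - apply: cvg_at_right_filter; exact: cF.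
  - by move=> t _; rewrite derive1E; have [_ ->] := dF t.
split; last by rewrite -Rintegral_mkcond /Rintegral E.
rewrite /L1 -restrict_EFin.
have mI : measurable (`[0, +oo[%classic : set R) by exact: measurable_itv.
have [+ _] := @integrable_mkcond _ _ R leb _ (EFin \o g) mI; apply.
apply/integrableP; split.
  by apply/measurable_EFinP/measurable_funTS; exact: continuous_measurable_fun.
rewrite (_ : (\int[_]_(x in _) _)%E = (l - F 0)%:E) ?ltry// EFinB -E.
apply: eq_integral => t; rewrite inE/= in_itv/= andbT => t0.
by rewrite ger0_norm// g0.
Qed.

(** The Abel summation weight. It lives on the half-line because the cosine transform taken there is
    already the kernel [cauchy e]. *)
Definition wexp e t : R := ((fun t => expR (- (e * t))) \_ `[0, +oo[) t.

Lemma wexp_ge0 e t : 0 <= wexp e t.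
Proof. by rewrite /wexp /patch; case: ifP => // _; exact: expR_ge0. Qed.

Lemma cvg_expRN e : 0 < e -> expR (- (e * t)) @[t --> +oo] --> 0.
Proof.
move=> e0; have := @cvgr_expR R; apply: cvg_comp.
by apply: gt0_cvgMry => //; exact: cvg_id.
Qed.

Lemma L1_wexp e : 0 < e -> L1 leb (wexp e).
Proof.
move=> e0.
have [] := @Rint_FTC2y (fun t => expR (- (e * t))) (fun t => - e^-1 * expR (- (e * t))) 0.
- by move=> t _; exact: expR_ge0.
- by move=> t; apply: continuous_comp; [apply: cvgN; apply: cvgM; [exact: cvg_cst|exact: cvg_id]|exact: continuous_expR].
- move=> t; apply: is_derive_eq; rewrite /GRing.scale/=.
  by field; rewrite gt_eqF.
- by rewrite -[X in _ --> X](mulr0 (- e^-1)); apply: cvgM; [exact: cvg_cst|exact: cvg_expRN].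
- by [].
Qed.

Lemma Rint_wexp e : 0 < e -> \int[leb]_t wexp e t = e^-1.
Proof.
move=> e0.
have [] := @Rint_FTC2y (fun t => expR (- (e * t))) (fun t => - e^-1 * expR (- (e * t))) 0.
- by move=> t _; exact: expR_ge0.
- by move=> t; apply: continuous_comp; [apply: cvgN; apply: cvgM; [exact: cvg_cst|exact: cvg_id]|exact: continuous_expR].
- move=> t; apply: is_derive_eq; rewrite /GRing.scale/=.
  by field; rewrite gt_eqF.
- by rewrite -[X in _ --> X](mulr0 (- e^-1)); apply: cvgM; [exact: cvg_cst|exact: cvg_expRN].
- by move=> _ ->; rewrite mulr0 oppr0 expR0; ring.
Qed.

Lemma Rint_wexp_cos e x : 0 < e -> \int[leb]_t (wexp e t * cos (t * x)) = cauchy e x.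
Proof.
move=> e0.
have d0 := cauchy_den_gt0 x e0.
(* The integrand e^(-et) cos(tx) changes sign. Adding e^(-et) makes it nonnegative, and the known
   integral of that term is subtracted at the end. *)
pose g t : R := expR (- (e * t)) * (1 + cos (t * x)).
pose F t : R := expR (- (e * t)) * ((x * sin (t * x) - e * cos (t * x)) / (e ^+ 2 + x ^+ 2) - e^-1).
have dg (t : R) : is_derive t 1 F (g t).
  rewrite /F /g; apply: is_derive_eq; rewrite /GRing.scale/=.
  by field; rewrite !gt_eqF.
have [|||Ig Eg] := @Rint_FTC2y g F 0.
- by move=> t _; rewrite mulr_ge0 ?expR_ge0// -lerBlDl sub0r cos_geN1.
- move=> t; apply: cvgM.
    by apply: continuous_comp; [apply: cvgN; apply: cvgM; [exact: cvg_cst|exact: cvg_id]|exact: continuous_expR].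
  apply: cvgD; first exact: cvg_cst.
  by apply: continuous_comp; [apply: cvgM; [exact: cvg_id|exact: cvg_cst]|exact: continuous_cos].
- pose M := (`|x| + e) / (e ^+ 2 + x ^+ 2) + e^-1.
  apply: norm_cvg0.
  have : M * expR (- (e * t)) @[t --> +oo] --> 0.
    by rewrite -[X in _ --> X](mulr0 M); apply: cvgM; [exact: cvg_cst|exact: cvg_expRN].
  apply: squeeze_cvgr; last exact: cvg_cst.
  apply: nearW => t; rewrite normr_ge0/= /F normrM ger0_norm ?expR_ge0// mulrC.
  rewrite ler_wpM2r ?expR_ge0// (le_trans (ler_normB _ _))// /M.
  have nE (y : R) : 0 < y -> `|y^-1| = y^-1 by move=> y0; rewrite ger0_norm// invr_ge0 ltW.
  rewrite nE// lerD2r normrM nE// ler_wpM2r ?invr_ge0 ?(ltW d0)//.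
  rewrite (le_trans (ler_normB _ _))// !normrM (ger0_norm (ltW e0)).
  by rewrite lerD// ler_piMr ?normr_sin_le1 ?normr_cos_le1 ?(ltW e0).
have Ew := Rint_wexp e0; have Iw := L1_wexp e0.
transitivity (\int[leb]_t ((g \_ `[0, +oo[) t - wexp e t)).
  apply: eq_Rintegral => t _; rewrite /wexp /patch; case: ifP => _; last by rewrite mul0r subr0.
  by rewrite /g; ring.
rewrite RintegralB// Eg Ew /F mul0r sin0 cos0 !mulr0 oppr0 expR0 /cauchy.
by field; rewrite !gt_eqF.
Qed.

End poisson_kernel.

Section poisson_regularization.
Context (R : realType).
Local Notation leb := (@lebesgue_measure R).
Implicit Types (e x y t : R) (f : R -> R).

(** The regularity under which the mollification error has a majorant independent of the width of
    the kernel. *)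
Definition lipschitz_fun f := exists K, forall x y, `|f x - f y| <= K * `|x - y|.

Lemma lipschitz_fun_continuous f : lipschitz_fun f -> continuous f.
Proof.
move=> [K fK] x; apply/cvgrPdist_lt => eps eps0.
have K0 : 0 < `|K| + 1 by rewrite ltr_wpDl.
near=> y; rewrite (le_lt_trans (fK x y))//.
rewrite (@le_lt_trans _ _ ((`|K| + 1) * `|x - y|))//.
  by rewrite ler_wpM2r// (le_trans (ler_norm K))// lerDl.
rewrite mulrC -ltr_pdivlMr//; near: y.
by apply: (@cvgr_dist_lt _ _ _ (nbhs x) _ id x) => //; rewrite divr_gt0.
Unshelve. all: by end_near. Qed.

Let eps n : R := n.+1%:R^-1.

Let eps_gt0 n : 0 < eps n. Proof. by rewrite invr_gt0. Qed.

Let cvg_eps : eps n @[n --> \oo] --> 0.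
Proof. exact: cvg_harmonic. Qed.

(** After clearing denominators, we <= B|v|e, which is at most B(e^2 + v^2) because (e - |v|)^2 >=
    0, while w e v^2 <= B v^2 because e <= 1. The majorant no longer depends on e. *)
Lemma cauchy_dominated e v (w B : R) : 0 < e -> e <= 1 -> 0 <= B -> 0 <= w ->
  w <= B * `|v| -> w <= B -> w * cauchy e v <= 2 * B * cauchy 1 v.
Proof.
move=> e0 e1 B0 w0 w1 w2.
rewrite /cauchy !mulrA ler_pdivlMr ?cauchy_den_gt0// mulrAC ler_pdivrMr ?cauchy_den_gt0//.
rewrite expr1n mulr1 -(real_normK (num_real v)).
have nv0 : 0 <= `|v| by [].
move: (`|v|) w1 nv0 => z w1 z0.
have h1 : w * e <= B * z * e by rewrite ler_wpM2r// ltW.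
have h2 : w * (e * z ^+ 2) <= B * (z ^+ 2).
  rewrite ler_pM ?mulr_ge0 ?exprn_ge0 ?(ltW e0)//.
  by rewrite ler_piMl// exprn_ge0.
have h3 : 0 <= B * (e - z) ^+ 2 by rewrite mulr_ge0// sqr_ge0.
have h4 : 0 <= B * e ^+ 2 by rewrite mulr_ge0// sqr_ge0.
have h5 : 0 <= B * z ^+ 2 by rewrite mulr_ge0// sqr_ge0.
nra.
Qed.

(** Since the kernel has mass [pi], it suffices that the integral of (f u - f y) against it tends to
    0. The constant B = |K| + 2M covers the Lipschitz bound near y and the uniform bound far
    away. *)
Lemma cauchy_approx f (M : R) y : lipschitz_fun f -> (forall x, `|f x| <= M) ->
  \int[leb]_u (f u * cauchy (eps n) (u - y)) @[n --> \oo] --> pi * f y.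
Proof.
move=> fL fM.
have mf : measurable_fun setT f.
  by apply: continuous_measurable_fun; exact: lipschitz_fun_continuous.
have [K fK] := fL.
pose h n u := (f u - f y) * cauchy (eps n) (u - y).
pose B := `|K| + 2 * M.
have M0 : 0 <= M by exact: le_trans (fM 0).
have B0 : 0 <= B by rewrite addr_ge0// mulr_ge0.
have I1 n : L1 leb (fun u => f u * cauchy (eps n) (u - y)).
  rewrite (_ : (fun u => _) = fun u => cauchy (eps n) (u - y) * f u); last first.
    by apply/funext => u; rewrite mulrC.
  by apply: (L1_bM (L1_cauchy y (eps_gt0 n)) mf fM).
have I2 n : L1 leb (fun u => f y * cauchy (eps n) (u - y)).
  by apply: L1Zl; exact: L1_cauchy.
have mh n : measurable_fun setT (h n).
  rewrite (_ : h n = fun u => f u * cauchy (eps n) (u - y) - f y * cauchy (eps n) (u - y)).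
    exact: L1_measurable (L1B (I1 n) (I2 n)).
  by apply/funext => u; rewrite /h mulrBl.
have hB n u : `|h n u| <= 2 * B * cauchy 1 (u - y).
  rewrite /h normrM (ger0_norm (cauchy_ge0 _ (eps_gt0 n))).
  apply: cauchy_dominated => //.
  - by rewrite invf_le1// ler1n.
  - by rewrite (le_trans (fK _ _))// ler_wpM2r// (le_trans (ler_norm K))// lerDl mulr_ge0.
  - rewrite (le_trans (ler_normB _ _))// /B -[leLHS]add0r lerD//.
    by rewrite mulr_natl mulr2n lerD.
have hc u : h n u @[n --> \oo] --> 0.
  (* At u = y the kernel blows up, but the difference that it multiplies is zero. *)
  have [->|uy] := eqVneq u y.
    rewrite (_ : (fun n => _) = cst 0); first exact: cvg_cst.
    by apply/funext => n; rewrite /h subrr mul0r.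
  have v0 : (u - y) ^+ 2 != 0 by rewrite sqrf_eq0 subr_eq0.
  rewrite -(mulr0 (f u - f y)); apply: cvgM; first exact: cvg_cst.
  rewrite -(mul0r (0 ^+ 2 + (u - y) ^+ 2)^-1) /cauchy; apply: cvgM; first exact: cvg_eps.
  apply: cvgV; first by rewrite expr2 mulr0 add0r.
  apply: cvgD; last exact: cvg_cst.
  by rewrite !expr2; apply: cvgM; exact: cvg_eps.
have [_] := @Rint_dct _ _ _ leb _ _ _ mh hc (L1Zl (2 * B) (L1_cauchy y ltr01)) hB.
rewrite Rintegral_cst// mul0r => ch.
rewrite (_ : (fun n => _) = fun n => \int[leb]_u h n u + pi * f y).
  rewrite -[X in _ --> X]add0r; apply: cvgD => //; exact: cvg_cst.
apply/funext => n; rewrite -(Rintegral_cauchy y (eps_gt0 n)) mulrC.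
rewrite -RintegralZl//; last exact: L1_cauchy.
rewrite -RintegralD//; first by apply: eq_Rintegral => u _; rewrite /h; ring.
rewrite /L1 (_ : _ \o _ = EFin \o fun u => f u * cauchy (eps n) (u - y) - f y * cauchy (eps n) (u - y)).
  exact: L1B.
  by apply/funext => u /=; rewrite /h mulrBl.
exact: I2.
Qed.

Context d (T : measurableType d) (P : {finite_measure set T -> \bar R}).
Implicit Types (W V : T -> R).

Definition fcos f t := \int[leb]_u (f u * cos (t * u)).
Definition fsin f t := \int[leb]_u (f u * sin (t * u)).

(** The kernel is replaced by the cosine transform of [wexp]; Fubini and the addition formula for
    cos(tu - ty) then produce the two transforms of f. *)
Lemma poisson_mollify f n y : L1 leb f ->
  \int[leb]_u (f u * cauchy (eps n) (u - y)) =
  \int[leb]_t (wexp (eps n) t * (fcos f t * cos (t * y) + fsin f t * sin (t * y))).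
Proof.
move=> If; have e0 := eps_gt0 n; have Iw := L1_wexp e0.
have [] := @Rfubini _ _ _ _ R leb leb
  (fun z => f z.1 * (wexp (eps n) z.2 * cos (z.2 * (z.1 - y))))
  (fun u => `|f u|) (wexp (eps n)).
- apply: measurable_funM.
    by apply: measurableT_comp => //; exact: L1_measurable If.
  apply: measurable_funM.
    by apply: measurableT_comp => //; exact: L1_measurable Iw.
  apply: measurableT_comp; first exact: measurable_cos.
  by apply: measurable_funM => //; exact: measurable_funB.
- move=> [u t] /=; rewrite normrM ler_wpM2l// normrM (ger0_norm (wexp_ge0 _ _)).
  by rewrite ler_piMr ?wexp_ge0 ?normr_cos_le1.
- exact: L1_norm.
- exact: Iw.
move=> /= E _ _; transitivity (\int[leb]_u \int[leb]_t
   (f u * (wexp (eps n) t * cos (t * (u - y))))).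
  apply: eq_Rintegral => u _; rewrite -Rint_wexp_cos// RintegralZl//.
  apply: L1_cos => //; exact: measurable_funM.
rewrite E; apply: eq_Rintegral => t _.
have mt : measurable_fun setT (fun u => t * u) by exact: measurable_funM.
rewrite mulrDr !mulrA -!/(fcos _ _) -!/(fsin _ _).
rewrite /fcos /fsin [in RHS](mulrAC _ _ (cos _)) [in RHS](mulrAC _ _ (sin _)).
rewrite -!RintegralZl//; [|exact: L1_sin|exact: L1_cos].
rewrite -RintegralD//; [|by apply: L1Zl; exact: L1_cos|by apply: L1Zl; exact: L1_sin].
by apply: eq_Rintegral => u _; rewrite mulrBr cosB; ring.
Qed.

(** The pair (W, V) enters the left-hand side only through [Icos] and [Isin], so these determine
    E[W f(V)]. Mollification holds pointwise; Fubini exchanges it with P, and the mollified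
    functions converge boundedly. *)
Theorem poisson_inversion W V f (M : R) : L1 P W -> measurable_fun setT V ->
  lipschitz_fun f -> (forall x, `|f x| <= M) -> L1 leb f ->
  (forall n, L1 leb (fun t => wexp n.+1%:R^-1 t *
    (fcos f t * Icos P W (fun w => t * V w) + fsin f t * Isin P W (fun w => t * V w)))) /\
  \int[leb]_t (wexp n.+1%:R^-1 t * (fcos f t * Icos P W (fun w => t * V w) +
                              fsin f t * Isin P W (fun w => t * V w)))
    @[n --> \oo] --> pi * \int[P]_w (W w * f (V w)).
Proof.
move=> IW mV fL fM If.
have mf : measurable_fun setT f.
  by apply: continuous_measurable_fun; exact: lipschitz_fun_continuous.
pose S n y := \int[leb]_u (f u * cauchy (eps n) (u - y)).
have M0 : 0 <= M by exact: le_trans (fM 0).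
pose N := \int[leb]_u `|f u|.
have fcosN t : `|fcos f t| <= N.
  have mt : measurable_fun setT (fun u => t * u) by exact: measurable_funM.
  rewrite (le_trans (Rint_norm_le (L1_cos If mt)))//.
  apply: le_Rintegral => //; [exact: L1_norm (L1_cos If mt)|exact: L1_norm|].
  by move=> u _; rewrite normrM ler_piMr// normr_cos_le1.
have fsinN t : `|fsin f t| <= N.
  have mt : measurable_fun setT (fun u => t * u) by exact: measurable_funM.
  rewrite (le_trans (Rint_norm_le (L1_sin If mt)))//.
  apply: le_Rintegral => //; [exact: L1_norm (L1_sin If mt)|exact: L1_norm|].
  by move=> u _; rewrite normrM ler_piMr// normr_sin_le1.
have mcs (g : R -> R) : measurable_fun setT g ->
    measurable_fun setT (fun z : R * R => f z.2 * g (z.1 * z.2)).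
  move=> mg; apply: measurable_funM; first exact: measurableT_comp.
  by apply: measurableT_comp => //; exact: measurable_funM.
have mw n := L1_measurable (L1_wexp (eps_gt0 n)).
(* the Fourier coefficients are measurable as inner integrals of Fubini *)
have mF n (g : R -> R) : measurable_fun setT g -> (forall x, `|g x| <= 1) ->
    measurable_fun setT (fun t => wexp (eps n) t * \int[leb]_u (f u * g (t * u))).
  move=> mg g1.
  have [] := @Rfubini _ _ _ _ R leb leb (fun z => wexp (eps n) z.1 * (f z.2 * g (z.1 * z.2)))
    (wexp (eps n)) (fun u => `|f u|).
  - apply: measurable_funM; first by apply: measurableT_comp.
    exact: mcs.
  - move=> [t u] /=; rewrite normrM (ger0_norm (wexp_ge0 _ _)) ler_wpM2l ?wexp_ge0//.
    by rewrite normrM ler_piMr.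
  - exact: L1_wexp.
  - exact: L1_norm.
  move=> _ I _; have := L1_measurable I; congr measurable_fun; apply/funext => t.
  rewrite /= RintegralZl//; apply: (L1_bM If _ (fun u => g1 (t * u))).
  by apply: measurableT_comp => //; exact: measurable_funM.
pose G n t := wexp (eps n) t *
  (fcos f t * Icos P W (fun w => t * V w) + fsin f t * Isin P W (fun w => t * V w)).
have step n : [/\ \int[P]_w (W w * S n (V w)) = \int[leb]_t G n t,
    L1 P (fun w => W w * S n (V w)) & L1 leb (G n)].
  have [] := @Rfubini _ _ _ _ R P leb
    (fun z => W z.1 * (wexp (eps n) z.2 * fcos f z.2 * cos (z.2 * V z.1) +
       wexp (eps n) z.2 * fsin f z.2 * sin (z.2 * V z.1)))
    (fun w => `|W w|) (fun t => (2 * N) * wexp (eps n) t : R).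
  - apply: measurable_funM.
      by apply: measurableT_comp => //; exact: L1_measurable IW.
    have m2V : measurable_fun setT (fun z : T * R => z.2 * V z.1).
      by apply: measurable_funM => //; exact: measurableT_comp.
    apply: measurable_funD; apply: measurable_funM.
    + apply: (measurableT_comp (mF n cos _ _)) => //; [exact: measurable_cos|exact: normr_cos_le1].
    + by apply: measurableT_comp m2V; exact: measurable_cos.
    + apply: (measurableT_comp (mF n sin _ _)) => //; [exact: measurable_sin|exact: normr_sin_le1].
    + by apply: measurableT_comp m2V; exact: measurable_sin.
  - move=> [x t] /=; rewrite normrM ler_wpM2l// -!mulrA -mulrDr normrM.
    rewrite (ger0_norm (wexp_ge0 _ _)) mulrA mulrC ler_wpM2r ?wexp_ge0//.
    rewrite (le_trans (ler_normD _ _))// mulr_natl mulr2n lerD// normrM.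
      by rewrite (le_trans _ (fcosN t))// ler_piMr ?normr_cos_le1.
    by rewrite (le_trans _ (fsinN t))// ler_piMr ?normr_sin_le1.
  - exact: L1_norm.
  - by apply: L1Zl; exact: L1_wexp.
  move=> /= E IE IG; have SE w : W w * S n (V w) = \int[leb]_t
    (W w * (wexp (eps n) t * fcos f t * cos (t * V w) +
       wexp (eps n) t * fsin f t * sin (t * V w))).
    rewrite /S poisson_mollify// RintegralZl//.
      by congr (_ * _); apply: eq_Rintegral => t _; rewrite mulrDr !mulrA.
    have mtV : measurable_fun setT (fun t => t * V w) by exact: measurable_funM.
    apply: (@L1_le _ _ _ leb _ (fun t => (2 * N) * wexp (eps n) t : R)).
    + apply: measurable_funD; apply: measurable_funM.
      * by apply: (mF n cos) => //; [exact: measurable_cos|exact: normr_cos_le1].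
      * by apply: measurableT_comp mtV; exact: measurable_cos.
      * by apply: (mF n sin) => //; [exact: measurable_sin|exact: normr_sin_le1].
      * by apply: measurableT_comp mtV; exact: measurable_sin.
    + move=> t; rewrite -!mulrA -mulrDr normrM.
      rewrite (ger0_norm (wexp_ge0 _ _)) mulrA mulrC ler_wpM2r ?wexp_ge0//.
      rewrite (le_trans (ler_normD _ _))// mulr_natl mulr2n lerD// normrM.
        by rewrite (le_trans _ (fcosN t))// ler_piMr ?normr_cos_le1.
      by rewrite (le_trans _ (fsinN t))// ler_piMr ?normr_sin_le1.
    + by apply: L1Zl; exact: L1_wexp.
  have GE t : \int[P]_w (W w * (wexp (eps n) t * fcos f t * cos (t * V w) +
       wexp (eps n) t * fsin f t * sin (t * V w))) = G n t.
    have mtV : measurable_fun setT (fun w => t * V w) by exact: measurable_funM.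
    rewrite /G /Icos /Isin mulrDr !mulrA.
    move: (wexp _ t * fcos f t) (wexp _ t * fsin f t) => a b.
    rewrite -!RintegralZl//; [|exact: L1_sin|exact: L1_cos].
    rewrite -RintegralD//; [|by apply: L1Zl; exact: L1_cos|by apply: L1Zl; exact: L1_sin].
    by apply: eq_Rintegral => x _; ring.
  split.
  - under eq_Rintegral do rewrite SE.
    by rewrite E; apply: eq_Rintegral => t _; rewrite GE.
  - by move: IE; congr (L1 _ _); apply/funext => w; rewrite SE.
  - by move: IG; congr (L1 _ _); apply/funext => t; rewrite GE.
split; first by move=> n; have [] := step n.
rewrite (_ : (fun n => _) = fun n => \int[P]_w (W w * S n (V w))); last first.
  by apply/funext => n; have [->] := step n.
have IWf : L1 P (fun w => W w * f (V w)).
  apply: (@L1_bM _ _ _ _ _ _ M) => //; exact: measurableT_comp.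
rewrite -RintegralZl//.
(* Positivity and total mass [pi] of the kernel bound all mollified functions at once, which gives
   the majorant |W| pi M for dominated convergence. *)
have SM n y : `|S n y| <= pi * M.
  have I1 : L1 leb (fun u => f u * cauchy (eps n) (u - y)).
    rewrite (_ : (fun u => _) = fun u => cauchy (eps n) (u - y) * f u); last first.
      by apply/funext => u; rewrite mulrC.
    by apply: (L1_bM (L1_cauchy y (eps_gt0 n)) mf fM).
  rewrite (le_trans (Rint_norm_le I1))// -(Rintegral_cauchy y (eps_gt0 n)) mulrC.
  rewrite -RintegralZl//; last exact: L1_cauchy.
  apply: le_Rintegral => //; [exact: L1_norm|by apply: L1Zl; exact: L1_cauchy|].
  by move=> u _; rewrite normrM (ger0_norm (cauchy_ge0 _ (eps_gt0 n))) ler_wpM2r ?cauchy_ge0.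
have [] // := @Rint_dct _ _ _ P (fun n w => W w * S n (V w)) (fun w => pi * (W w * f (V w)))
  (fun w => `|W w| * (pi * M)).
- by move=> n; have [_ + _] := step n; exact: L1_measurable.
- move=> x; rewrite mulrCA; apply: cvgM; first exact: cvg_cst.
  exact: cauchy_approx.
- apply: (@L1_bM _ _ _ _ _ _ `|pi * M|) => //; exact: L1_norm.
- by move=> n x; rewrite normrM ler_wpM2l.
Qed.

End poisson_regularization.

(** * Characteristic functions determine laws *)

Section charfn_unique.
Context (R : realType).
Local Notation leb := (@lebesgue_measure R).

(** A Lipschitz approximation of the indicator of ]-oo, b]: slope n to the right of b, and a cut to
    the left of -n that makes it integrable, as inversion requires. *)
Definition ramp (b : R) (n : nat) (x : R) : R :=
  Num.max 0 (Num.min 1 (Num.min (1 + n%:R * (b - x)) (1 + n%:R + x))).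

Lemma ler_dist_min (a b a' b' K : R) : `|a - a'| <= K -> `|b - b'| <= K ->
  `|Num.min a b - Num.min a' b'| <= K.
Proof.
rewrite !ler_norml => /andP[? ?] /andP[? ?].
by have [?|?] := leP a b; have [?|?] := leP a' b'; apply/andP; split; lra.
Qed.

Lemma ler_dist_max (a b a' b' K : R) : `|a - a'| <= K -> `|b - b'| <= K ->
  `|Num.max a b - Num.max a' b'| <= K.
Proof.
rewrite !ler_norml => /andP[? ?] /andP[? ?].
by have [?|?] := leP a b; have [?|?] := leP a' b'; apply/andP; split; lra.
Qed.

Lemma lipschitz_ramp b n : lipschitz_fun (ramp b n).
Proof.
exists (n%:R + 1) => x y; have n0 : 0 <= n%:R :> R by [].
have K0 : 0 <= (n%:R + 1) * `|x - y| by rewrite mulr_ge0// addr_ge0.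
apply: ler_dist_max; first by rewrite subrr normr0.
apply: ler_dist_min; first by rewrite subrr normr0.
apply: ler_dist_min.
  rewrite (_ : _ - _ = n%:R * (y - x)); last by ring.
  by rewrite normrM (distrC y) ger0_norm// ler_wpM2r// lerDl.
rewrite (_ : _ - _ = x - y); last by ring.
by rewrite -[leLHS]mul1r ler_wpM2r// lerDr.
Qed.

Lemma ramp_ge0 b n x : 0 <= ramp b n x.
Proof. by rewrite /ramp le_max lexx. Qed.

Lemma ramp_le1 b n x : `|ramp b n x| <= 1.
Proof. by rewrite ger0_norm ?ramp_ge0// /ramp ge_max ler01/= ge_min lexx. Qed.

(** The support lies in [-(n + 1), b + 1]. For n = 0 nothing would cut the function off on the
    right. *)
Lemma L1_ramp b n : (0 < n)%N -> L1 leb (ramp b n).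
Proof.
move=> n0; have := integrable_indic_itv (- (1 + n%:R)) (b + 1) true false.
apply: L1_le.
  by apply: continuous_measurable_fun; exact: lipschitz_fun_continuous (lipschitz_ramp b n).
move=> x; rewrite indicE; have [_|] := boolP (x \in _); first exact: ramp_le1.
rewrite notin_setE/= in_itv/= => /negP; rewrite negb_and -!ltNge => h.
rewrite ger0_norm ?ramp_ge0// /ramp ge_max lexx/= !ge_min.
case/orP: h => h; first by apply/orP; right; apply/orP; right; lra.
apply/orP; right; apply/orP; left.
have : 1 <= n%:R :> R by rewrite ler1n.
by nra.
Qed.

Lemma cvg_ramp b x : ramp b n.+1 x @[n --> \oo] --> (((x <= b)%R : nat)%:R : R).
Proof.
apply: cvg_near_cst.
have [xb|bx] := leP x b.
  near=> n; apply/eqP; rewrite /ramp.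
  have h : 0 <= n.+1%:R * (b - x) by rewrite mulr_ge0// subr_ge0.
  have h' : - x <= n.+1%:R.
    rewrite (@le_trans _ _ n%:R)//; last by rewrite ler_nat.
    by near: n; exact: nbhs_infty_ger.
  rewrite (min_l (x := 1)); first by rewrite max_r.
  by rewrite le_min; apply/andP; split; lra.
near=> n; apply/eqP; rewrite /ramp max_l// !ge_min; apply/orP; right; apply/orP; left.
have xb : 0 < x - b by rewrite subr_gt0.
have : (x - b)^-1 <= n.+1%:R.
  rewrite (@le_trans _ _ n%:R)//; last by rewrite ler_nat.
  by near: n; exact: nbhs_infty_ger.
by rewrite -(ler_pM2r xb) mulVf ?gt_eqF// => h; lra.
Unshelve. all: by end_near. Qed.

Context d1 (T1 : measurableType d1) (P1 : probability T1 R).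
Context d2 (T2 : measurableType d2) (P2 : probability T2 R).

(** Inversion with weight 1 identifies the integrals of bounded, integrable Lipschitz functions.
    Ramps carry this over to the distribution functions, and the rays ]x, +oo[ form a generating
    system stable under intersection. *)
Theorem charfn_unique (V1 : {RV P1 >-> R}) (V2 : {RV P2 >-> R}) :
  (forall t, Icos P1 (cst 1) (fun w => t * V1 w) = Icos P2 (cst 1) (fun w => t * V2 w)) ->
  (forall t, Isin P1 (cst 1) (fun w => t * V1 w) = Isin P2 (cst 1) (fun w => t * V2 w)) ->
  same_law V1 V2.
Proof.
move=> ec es.
have I1 d (T : measurableType d) (P : probability T R) : L1 P (cst 1).
  exact: finite_measure_integrable_cst.
have E f : lipschitz_fun f -> (forall x, `|f x| <= 1) -> L1 leb f ->
    \int[P1]_w f (V1 w) = \int[P2]_w f (V2 w).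
  move=> fL f1 If.
  have [_ c1] := @poisson_inversion R _ T1 P1 _ _ f 1 (I1 _ _ P1) (measurable_funPT V1) fL f1 If.
  have [_ c2] := @poisson_inversion R _ T2 P2 _ _ f 1 (I1 _ _ P2) (measurable_funPT V2) fL f1 If.
  move: c1; under eq_fun do under eq_Rintegral do rewrite ec es.
  move=> c1.
  under eq_Rintegral do rewrite -(mul1r (f _)).
  under [in RHS]eq_Rintegral do rewrite -(mul1r (f _)).
  apply: (@mulfI _ pi); first by rewrite gt_eqF// pi_gt0.
  by have := cvg_unique _ c1 c2; apply.
have cdfE d (T : measurableType d) (P : probability T R) (V : {RV P >-> R}) b :
    \int[P]_w ramp b n.+1 (V w) @[n --> \oo] --> fine (cdf V b).
  have [||||_] := @Rint_dct _ _ _ P (fun n w => ramp b n.+1 (V w))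
    (fun w => ((V w <= b)%R : nat)%:R : R) (cst 1).
  - move=> n; apply: measurableT_comp => //; apply: continuous_measurable_fun.
    exact: lipschitz_fun_continuous (lipschitz_ramp b n.+1).
  - by move=> w; exact: cvg_ramp.
  - exact: I1.
  - by move=> n w; exact: ramp_le1.
  rewrite (_ : \int[P]_w _ = fine (cdf V b))//.
  rewrite /cdf /distribution /pushforward /Rintegral.
  rewrite -[in RHS](setIT (_ @^-1` _)) -integral_indic//.
    congr fine; apply: eq_integral => w _; rewrite indicE; congr (_%:R%:E).
    apply: congr1; apply/idP/idP; rewrite inE/= in_itv//=.
  by rewrite -[X in measurable X]setTI; exact: measurable_funPT.
have cdfEE b : cdf V1 b = cdf V2 b.
  rewrite -[LHS]fineK ?fin_num_measure// -[RHS]fineK ?fin_num_measure//; congr EFin.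
  have c1 := cdfE _ _ _ V1 b; have c2 := cdfE _ _ _ V2 b.
  have En : (fun n => \int[P1]_w ramp b n.+1 (V1 w)) = (fun n => \int[P2]_w ramp b n.+1 (V2 w)).
    apply/funext => n; apply: E; [exact: lipschitz_ramp|exact: ramp_le1|exact: L1_ramp].
  by rewrite En in c1; have := cvg_unique _ c1 c2; apply.
move=> A; have mE : (@measurable _ R) = <<s @RGenOInfty.G R >>.
  exact: RGenOInfty.measurableE.
apply: (@measure_unique _ R R (@RGenOInfty.G R)
   (fun n => `]- n%:R, +oo[%classic) mE) => //=.
- move=> _ _ [x ->] [y ->]; exists (Num.max x y); rewrite predeqE => z /=.
  rewrite !in_itv/= !andbT gt_max; split=> [[-> ->]//|/andP[]//].
- by move=> n; exists (- n%:R).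
- rewrite -subTset => x _; exists (Num.bound `|x|) => //=.
  rewrite in_itv/= andbT ltrNl (le_lt_trans (ler_norm _))// normrN.
  exact: archi_boundP.
- move=> _ [x ->].
  have E1 d (T : measurableType d) (P : probability T R) (V : {RV P >-> R}) :
      distribution P V `]x, +oo[%classic = (1 - cdf V x)%E.
    rewrite -setCitvl probability_setC//.
  by rewrite !E1 cdfEE.
- by move=> n; rewrite -ge0_fin_numE// fin_num_measure.
Qed.
End charfn_unique.

(** * Stein identities and characteristic functions *)

Section rapidly_decreasing.
Context (R : realType).
Local Notation leb := (@lebesgue_measure R).
Implicit Types f : R -> R.

(** Quadratic decay is all that is used of a Schwartz function: it gives boundedness, integrability
    and vanishing boundary terms. *)
Definition decays f := exists C, forall x, `|f x| <= C * cauchy 1 x.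

Lemma cauchy1_le1 (x : R) : cauchy 1 x <= 1.
Proof.
rewrite /cauchy expr1n ler_pdivrMr ?mul1r ?lerDl ?sqr_ge0//.
by rewrite ltr_wpDr// sqr_ge0.
Qed.

Lemma decays_const_ge0 f C : (forall x, `|f x| <= C * cauchy 1 x) -> 0 <= C.
Proof.
move=> /(_ 0) h; have : 0 <= C * cauchy 1 0 by exact: le_trans h.
by rewrite /cauchy expr1n expr2 mulr0 addr0 divr1 mulr1.
Qed.

Lemma decays_bounded f : decays f -> exists M, forall x, `|f x| <= M.
Proof.
move=> [C fC]; exists C => x; rewrite (le_trans (fC x))// ler_piMr ?cauchy1_le1//.
exact: decays_const_ge0 fC.
Qed.

Lemma L1_decays f : decays f -> continuous f -> L1 leb f.
Proof.
move=> [C fC] cf; apply: (@L1_le _ _ _ leb _ (fun x => C * cauchy 1 (x - 0))).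
- exact: continuous_measurable_fun.
- by move=> x; rewrite subr0.
- by apply: L1Zl; exact: L1_cauchy.
Qed.

Lemma decays_cvg f (u : nat -> R) : decays f -> (forall n, n.+1%:R <= `|u n|) ->
  f (u n) @[n --> \oo] --> 0.
Proof.
move=> [C fC] hu; have C0 := decays_const_ge0 fC.
apply: norm_cvg0; have : C * n.+1%:R^-1 @[n --> \oo] --> 0.
  by rewrite -[X in _ --> X](mulr0 C); apply: cvgM; [exact: cvg_cst|exact: cvg_harmonic].
apply: squeeze_cvgr; last exact: cvg_cst.
apply: nearW => n; rewrite normr_ge0/= (le_trans (fC _))// ler_wpM2l//.
rewrite /cauchy mul1r expr1n lef_pV2 ?posrE ?ltr_wpDr ?sqr_ge0//.
rewrite (le_trans (hu n))// -(real_normK (num_real (u n))).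
by have := sqr_ge0 (`|u n| - 1); nra.
Qed.

(** On [-(n + 1), n + 1] the integral is a difference of boundary values of [H], which vanish in the
    limit; dominated convergence removes the truncation. Applied to g(x) cos(tx) and g(x) sin(tx),
    this is integration by parts for the transforms. *)
Lemma Rint_derive (H h : R -> R) : decays H -> (forall x : R, is_derive x 1 H (h x)) ->
  continuous h -> L1 leb h -> \int[leb]_x h x = 0.
Proof.
move=> dH Hh ch Ih; have cH := is_derive_continuous Hh.
pose I n : set R := `[- n.+1%:R, n.+1%:R]%classic.
have mI n : measurable (I n) by exact: measurable_itv.
have E n : \int[leb]_x (h \_ (I n)) x = H n.+1%:R - H (- n.+1%:R).
  rewrite -Rintegral_mkcond /Rintegral (@continuous_FTC2 _ h H)//.
  - by rewrite (@lt_trans _ _ 0)// ?ltrN10// oppr_lt0.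
  - exact: continuous_subspaceT.
  - split; [by move=> x _; have [] := Hh x|apply: cvg_at_right_filter; exact: cH|apply: cvg_at_left_filter; exact: cH].
  - by move=> x _; rewrite derive1E; have [_ ->] := Hh x.
have [||||_ c] := @Rint_dct _ _ _ leb (fun n => h \_ (I n)) h (fun x => `|h x|).
- move=> n; apply: (@L1_measurable _ _ _ leb); rewrite /L1 -restrict_EFin.
  have [+ _] := @integrable_mkcond _ _ R leb _ (EFin \o h) (mI n); apply.
  exact: (@integrableS _ _ R leb setT (I n) (EFin \o h) measurableT (mI n) (@subsetT _ _) Ih).
- move=> x; apply: cvg_near_cst; near=> n; rewrite /patch mem_set// /I/= in_itv/=.
  rewrite -ler_norml (@le_trans _ _ n%:R)//; last by rewrite ler_nat.
  by near: n; exact: nbhs_infty_ger.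
- exact: L1_norm.
- by move=> n x; rewrite /patch; case: ifP => // _; rewrite normr0.
have c0 : \int[leb]_x (h \_ (I n)) x @[n --> \oo] --> 0.
  rewrite (_ : (fun n => _) = fun n => H n.+1%:R - H (- n.+1%:R)); last exact/funext.
  rewrite -[X in _ --> X](subr0 0); apply: cvgB; apply: (decays_cvg dH) => n.
    by rewrite ger0_norm.
  by rewrite normrN ger0_norm.
by have := cvg_unique _ c c0; apply.
Unshelve. all: by end_near. Qed.

Section fourier_derivative.
Variables (g g' : R -> R).
Hypotheses (dg : forall x : R, is_derive x 1 g (g' x)) (cg' : continuous g').
Hypotheses (gd : decays g) (g'd : decays g').

Let cg : continuous g. Proof. exact: is_derive_continuous dg. Qed.

Lemma fcos_derive t : fcos g' t = t * fsin g t.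
Proof.
have mt : measurable_fun setT (fun u : R => t * u) by exact: measurable_funM.
have Ig := L1_decays gd cg; have Ig' := L1_decays g'd cg'.
pose h x := g' x * cos (t * x) - t * (g x * sin (t * x)).
have cc : continuous (fun x : R => cos (t * x)).
  by move=> x; apply: continuous_comp; [apply: cvgM; [exact: cvg_cst|exact: cvg_id]|exact: continuous_cos].
have cs : continuous (fun x : R => sin (t * x)).
  by move=> x; apply: continuous_comp; [apply: cvgM; [exact: cvg_cst|exact: cvg_id]|exact: continuous_sin].
have I1 := L1_cos Ig' mt; have I2 := L1Zl t (L1_sin Ig mt).
have : \int[leb]_x h x = 0.
  apply: (@Rint_derive (fun x => g x * cos (t * x))).
  - have [C gC] := gd; exists C => x; rewrite normrM (le_trans _ (gC x))//.
    by rewrite ler_piMr// normr_cos_le1.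
  - move=> x; have := dg x => dgx; apply: is_derive_eq.
    by rewrite /h /GRing.scale/=; ring.
  - move=> x; apply: cvgB; first by apply: cvgM; [exact: cg'|exact: cc].
    by apply: cvgM; [exact: cvg_cst|apply: cvgM; [exact: cg|exact: cs]].
  - exact: L1B I1 I2.
rewrite RintegralB// => /eqP; rewrite subr_eq0 => /eqP.
by rewrite RintegralZl//; exact: L1_sin.
Qed.

Lemma fsin_derive t : fsin g' t = - (t * fcos g t).
Proof.
have mt : measurable_fun setT (fun u : R => t * u) by exact: measurable_funM.
have Ig := L1_decays gd cg; have Ig' := L1_decays g'd cg'.
pose h x := g' x * sin (t * x) + t * (g x * cos (t * x)).
have cc : continuous (fun x : R => cos (t * x)).
  by move=> x; apply: continuous_comp; [apply: cvgM; [exact: cvg_cst|exact: cvg_id]|exact: continuous_cos].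
have cs : continuous (fun x : R => sin (t * x)).
  by move=> x; apply: continuous_comp; [apply: cvgM; [exact: cvg_cst|exact: cvg_id]|exact: continuous_sin].
have I1 := L1_sin Ig' mt; have I2 := L1Zl t (L1_cos Ig mt).
have : \int[leb]_x h x = 0.
  apply: (@Rint_derive (fun x => g x * sin (t * x))).
  - have [C gC] := gd; exists C => x; rewrite normrM (le_trans _ (gC x))//.
    by rewrite ler_piMr// normr_sin_le1.
  - move=> x; have := dg x => dgx; apply: is_derive_eq.
    by rewrite /h /GRing.scale/=; ring.
  - move=> x; apply: cvgD; first by apply: cvgM; [exact: cg'|exact: cs].
    by apply: cvgM; [exact: cvg_cst|apply: cvgM; [exact: cg|exact: cc]].
  - exact: L1D I1 I2.
rewrite RintegralD// => /eqP; rewrite addr_eq0 => /eqP.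
by rewrite RintegralZl//; exact: L1_cos.
Qed.

Lemma decays_lipschitz : lipschitz_fun g.
Proof.
have [M gM] := decays_bounded g'd; exists M.
have H x y : x <= y -> `|g x - g y| <= M * `|x - y|.
  move=> xy; have [c _ h] := @MVT_segment _ g g' x y xy (fun x _ => dg x) (continuous_subspaceT cg).
  by rewrite distrC h normrM (distrC x) ler_wpM2r.
move=> x y; have [xy|/ltW yx] := leP x y; first exact: H.
by rewrite distrC (distrC x); exact: H.
Qed.

End fourier_derivative.

Lemma schwartz_decays f n : schwartz f -> decays (f^`(n)%classic).
Proof.
move=> [_ fM]; have [M0 h0] := fM 0%N n; have [M2 h2] := fM 2%N n.
exists (M0 + M2) => x; rewrite /cauchy mul1r ler_pdivlMr ?ltr_wpDr ?sqr_ge0 ?expr1n//.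
rewrite mulrDr mulr1 lerD//; first by have := h0 x; rewrite expr0 mul1r.
by have := h2 x; rewrite normrM (ger0_norm (sqr_ge0 x)) mulrC.
Qed.

Lemma schwartz_is_derive f n (x : R) : schwartz f ->
  is_derive x 1 (f^`(n)%classic) (f^`(n.+1)%classic x).
Proof.
move=> [fd _]; apply: DeriveDef; first exact: fd.
by rewrite derive1nS derive1E.
Qed.

Lemma schwartz_continuous f n : schwartz f -> continuous (f^`(n)%classic).
Proof.
by move=> fS; apply: (@is_derive_continuous _ _ (f^`(n.+1)%classic)) => x; exact: schwartz_is_derive.
Qed.

(** Each derivative multiplies the transform by t and turns the phase by a quarter circle, the real
    form of a factor it. The phase [th] is arbitrary because the induction shifts it. *)
Lemma schwartz_fourier f n t th : schwartz f ->
  fcos (f^`(n)%classic) t * cos th + fsin (f^`(n)%classic) t * sin th =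
  t ^+ n * (fcos f t * cos (th + n%:R * (pi / 2)) + fsin f t * sin (th + n%:R * (pi / 2))).
Proof.
move=> fS; elim: n th => [|n IH] th; first by rewrite mul0r addr0 expr0 mul1r.
have D := fun x => schwartz_is_derive n x fS.
have [C C1] := (@schwartz_continuous f n.+1 fS, schwartz_decays n.+1 fS).
rewrite (fcos_derive D)// ?(fsin_derive D)//; try exact: schwartz_decays.
have -> : t * fsin (f^`(n)%classic) t * cos th + - (t * fcos (f^`(n)%classic) t) * sin th =
  t * (fcos (f^`(n)%classic) t * cos (th + pi / 2) + fsin (f^`(n)%classic) t * sin (th + pi / 2)).
  by rewrite cosD sinD cos_pihalf sin_pihalf; ring.
have -> : th + n.+1%:R * (pi / 2) = (th + pi / 2) + n%:R * (pi / 2) :> R.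
  by rewrite -natr1; ring.
by rewrite IH exprS mulrA.
Qed.

End rapidly_decreasing.

Lemma cvg_sumr (R : realType) (I : Type) (s : seq I) (u : I -> nat -> R) (l : I -> R) :
  (forall i, u i n @[n --> \oo] --> l i) ->
  \sum_(i <- s) u i n @[n --> \oo] --> \sum_(i <- s) l i.
Proof.
move=> ul; elim: s => [|i s IH].
  rewrite big_nil (_ : (fun n => _) = cst 0); first exact: cvg_cst.
  by apply/funext => n; rewrite big_nil.
rewrite big_cons (_ : (fun n => _) = fun n => u i n + \sum_(j <- s) u j n).
  exact: cvgD.
by apply/funext => n; rewrite big_cons.
Qed.

Section stein_of_charfn.
Context (R : realType) d (T : measurableType d) (P : {finite_measure set T -> \bar R}).
Local Notation leb := (@lebesgue_measure R).

(** Adding this angle to x multiplies e^(ix) by i^n, so it records the n-th derivative of a cosine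
    without case distinction. *)
Definition quarter (n : nat) : R := n%:R * (pi / 2).

(** The hypotheses are the identity for cos(tx) and sin(tx). All terms are inverted together: the
    transform of f^(j) is that of f up to t^j and a rotation, which is moved onto the phase of
    [W j]. The integrands then cancel for each t, before the limit is taken. *)
Theorem stein_of_charfn (V : T -> R) (W : nat -> T -> R) m (f : R -> R) :
  measurable_fun setT V -> (forall j, L1 P (W j)) ->
  (forall t, \sum_(j < m) t ^+ j * Icos P (W j) (fun w => t * V w + quarter j) = 0) ->
  (forall t, \sum_(j < m) t ^+ j * Isin P (W j) (fun w => t * V w + quarter j) = 0) ->
  schwartz f ->
  \sum_(j < m) \int[P]_w (W j w * (f^`(j)%classic) (V w)) = 0.
Proof.
move=> mV IW hc hs fS.
have mt t (j : nat) : measurable_fun setT (fun w => t * V w + quarter j).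
  by apply: measurable_funD => //; exact: measurable_funM.
have mt0 t : measurable_fun setT (fun w => t * V w) by exact: measurable_funM.
apply: (@mulfI _ pi); first by rewrite gt_eqF// pi_gt0.
rewrite mulr0 mulr_sumr.
pose G n t j : R := wexp n.+1%:R^-1 t *
  (fcos (f^`(j)%classic) t * Icos P (W j) (fun w => t * V w) +
   fsin (f^`(j)%classic) t * Isin P (W j) (fun w => t * V w)).
have fL j : lipschitz_fun (f^`(j)%classic).
  apply: (@decays_lipschitz _ _ (f^`(j.+1)%classic)) => [x|]; [exact: schwartz_is_derive|exact: schwartz_decays].
have fI j : L1 leb (f^`(j)%classic).
  by apply: L1_decays; [exact: schwartz_decays|exact: schwartz_continuous].
have GP j : (forall n, L1 leb (fun t => G n t j)) /\
    \int[leb]_t G n t j @[n --> \oo] --> pi * \int[P]_w (W j w * (f^`(j)%classic) (V w)).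
  have [M fM] := decays_bounded (schwartz_decays j fS).
  exact: (poisson_inversion (IW j) mV (fL j) fM (fI j)).
have c : \sum_(j < m) \int[leb]_t G n t j @[n --> \oo] --> \sum_(j < m) pi * \int[P]_w (W j w * (f^`(j)%classic) (V w)).
  by apply: cvg_sumr => j; have [] := GP j.
have G0 n t : \sum_(j < m) G n t j = 0.
  rewrite /G -mulr_sumr (_ : \sum_(j < m) _ =
    fcos f t * (\sum_(j < m) t ^+ j * Icos P (W j) (fun w => t * V w + quarter j)) +
    fsin f t * (\sum_(j < m) t ^+ j * Isin P (W j) (fun w => t * V w + quarter j))).
    by rewrite hc hs !mulr0 addr0 mulr0.
  rewrite !mulr_sumr -big_split/=; apply: eq_bigr => j _.
  rewrite !(mulrCA _ (t ^+ j)) -mulrDr /Icos /Isin.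
  move: (fun th => schwartz_fourier j t th fS).
  move: (fcos (f^`(j)%classic) t) (fsin (f^`(j)%classic) t) (fcos f t) (fsin f t) => a b a' b' E.
  rewrite -!RintegralZl//; try by [exact: L1_cos|exact: L1_sin].
  rewrite -!RintegralD//; try by [apply: L1Zl; exact: L1_cos|apply: L1Zl; exact: L1_sin].
  rewrite -RintegralZl//; last first.
    by apply: L1D; [apply: L1Zl; exact: L1_cos|apply: L1Zl; exact: L1_sin].
  apply: eq_Rintegral => w _; rewrite !(mulrCA _ (W j w)) -!mulrDr mulrCA; congr (_ * _).
  exact: E.
have c0 : \sum_(j < m) \int[leb]_t G n t j @[n --> \oo] --> 0.
  rewrite (_ : (fun n => _) = cst 0); first exact: cvg_cst.
  apply/funext => n; rewrite -Rint_sum; last by move=> j _; have [+ _] := GP j; apply.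
  by under eq_Rintegral do rewrite G0; rewrite Rintegral_cst// mul0r.
by have := cvg_unique _ c c0; apply.
Qed.
End stein_of_charfn.

(** * Plane waves with a Gaussian cutoff *)

Section gaussian_cutoff.
Context (R : realType).

(** The factor of e^(-x^2) in its n-th derivative, that is (-1)^n times the n-th Hermite polynomial
    in the physicists' normalization. *)
Fixpoint hermite n : {poly R} :=
  if n is m.+1 then (hermite m)^`() - 2 *: ('X * hermite m) else 1.

Definition gaussd n (x : R) := (hermite n).[x] * expR (- x ^+ 2).

Lemma gaussd_derive n (x : R) : is_derive x 1 (gaussd n) (gaussd n.+1 x).
Proof.
rewrite /gaussd; have := is_derive_poly (hermite n) x => h.
have h2 : is_derive x 1 (fun x => expR (- x ^+ 2)) (- (2 * x) * expR (- x ^+ 2)).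
  by apply: is_derive_eq; rewrite /GRing.scale/= ?expr1; ring.
by apply: is_derive_eq; rewrite /GRing.scale/= hornerD hornerN hornerZ hornerM hornerX; ring.
Qed.

(** From e^(x^2) >= 1 + x^(2(n+1))/(n+1)!. The summand 1 of the bound takes care of |x| <= 1, the
    factorial of |x| > 1, where |x|^n <= x^(2(n+1)). *)
Lemma pow_gauss_bounded n : exists M, forall x : R, `|x| ^+ n * expR (- x ^+ 2) <= M.
Proof.
exists (1 + n.+1`!%:R) => x; rewrite expRN -ler_pdivlMr ?invr_gt0 ?expR_gt0// invrK.
have x2 : 0 <= x ^+ 2 by exact: sqr_ge0.
have := expR_ge1Dxn n x2.
have f0 : 0 < n.+1`!%:R :> R by rewrite ltr0n fact_gt0.
have f1 : 1 <= n.+1`!%:R :> R by rewrite ler1n fact_gt0.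
set E := expR _ => hE.
have h0 : 0 <= (x ^+ 2) ^+ n.+1 / n.+1`!%:R by apply: divr_ge0; [exact: exprn_ge0|exact: ltW].
have hn : (x ^+ 2) ^+ n.+1 <= E * n.+1`!%:R by rewrite -ler_pdivrMr//; lra.
have E1 : 1 <= E by lra.
rewrite mulrDl mul1r.
have [x1|x1] := leP `|x| 1.
  rewrite (@le_trans _ _ 1)// ?exprn_ile1//.
  by rewrite -[leLHS]addr0 lerD// mulr_ge0// ltW// (lt_le_trans _ E1).
rewrite (@le_trans _ _ ((x ^+ 2) ^+ n.+1))//.
  rewrite -[in leRHS](real_normK (num_real x)) -exprM ler_eXn2l//.
  by rewrite mul2n -addnn (leq_trans (leqnSn n))// leq_addr.
by rewrite (le_trans hn)// mulrC lerDr (le_trans _ E1).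
Qed.

Lemma poly_gauss_bounded (q : {poly R}) :
  exists M, forall x : R, `|q.[x] * expR (- x ^+ 2)| <= M.
Proof.
have [M hM] := choice pow_gauss_bounded.
exists (\sum_(i < size q) `|q`_i| * M i) => x.
rewrite horner_coef mulr_suml (le_trans (ler_norm_sum _ _ _))//.
apply: ler_sum => i _; rewrite !normrM -mulrA ler_wpM2l//.
by rewrite normrX (ger0_norm (expR_ge0 _)).
Qed.

Lemma gaussd_bounded m n : exists M, forall x : R, `|x ^+ m * gaussd n x| <= M.
Proof.
have [M hM] := poly_gauss_bounded ('X^m * hermite n); exists M => x.
by have := hM x; rewrite hornerM hornerXn -mulrA.
Qed.

Variables (t c : R).

(** The k-th derivative of cos(tx + c). The free phase [c] yields the sine as well, at c = -pi/2. *)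
Definition wave k x := t ^+ k * cos (t * x + c + quarter R k).

Lemma wave_derive k (x : R) : is_derive x 1 (wave k) (wave k.+1 x).
Proof.
rewrite /wave; have h : is_derive x (1:R) (fun x => t * x + c + quarter R k) t.
  by apply: is_derive_eq; rewrite /GRing.scale/=; ring.
have h2 := @is_derive1_comp _ cos _ x _ _ (is_derive_cos _) h.
apply: is_derive_eq; rewrite /GRing.scale/= exprSr.
have -> : quarter R k.+1 = quarter R k + pi / 2 by rewrite /quarter -natr1; ring.
by rewrite !addrA [in RHS]cosD cos_pihalf sin_pihalf; ring.
Qed.

Lemma wave_bounded k x : `|wave k x| <= `|t| ^+ k.
Proof. by rewrite normrM normrX ler_piMr ?exprn_ge0// normr_cos_le1. Qed.

Definition wave_packet e i k x := e ^+ i * gaussd i (e * x) * wave k x.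

(* [wave_sum e n i k] is the n-th derivative of [wave_packet e i k]; unfolding
   the product rule this way avoids binomial coefficients. *)
Fixpoint wave_sum e n i k x :=
  if n is m.+1 then wave_sum e m i.+1 k x + wave_sum e m i k.+1 x
  else wave_packet e i k x.

Lemma wave_sum_derive e n i k (x : R) :
  is_derive x 1 (wave_sum e n i k) (wave_sum e n.+1 i k x).
Proof.
elim: n i k => [|n IH] i k /=.
  rewrite /wave_packet; have hw := wave_derive k x.
  have he : is_derive x (1:R) (fun x => e * x) e.
    by apply: is_derive_eq; rewrite /GRing.scale/=; ring.
  have hg := @is_derive1_comp _ _ _ x _ _ (gaussd_derive i (e * x)) he.
  by apply: is_derive_eq; rewrite /GRing.scale/= exprS /=; ring.
exact: is_deriveD.
Qed.

Lemma wave_sum_derive1n e n i k : (wave_sum e 0 i k)^`(n)%classic = wave_sum e n i k.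
Proof.
elim: n => [//|n IH]; rewrite derive1nS IH; apply/funext => x.
by rewrite derive1E; have [_ ->] := wave_sum_derive e n i k x.
Qed.

Lemma wave_sum_decays e m n i k : 0 < e ->
  exists M, forall x, `|x ^+ m * wave_sum e n i k x| <= M.
Proof.
move=> e0; elim: n i k => [|n IH] i k /=.
  have [M hM] := gaussd_bounded m i; exists (e ^+ i * (e ^- m * M) * `|t| ^+ k) => x.
  rewrite /wave_packet mulrA normrM; apply: ler_pM => //; last exact: wave_bounded.
  rewrite mulrCA normrM normrX (ger0_norm (ltW e0)) ler_wpM2l ?exprn_ge0 ?(ltW e0)//.
  rewrite -[leLHS]mul1r -[1](@mulVf _ (e ^+ m)) ?expf_neq0 ?gt_eqF// -mulrA.
  rewrite ler_wpM2l ?invr_ge0 ?exprn_ge0 ?(ltW e0)// (le_trans _ (hM (e * x)))//.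
  by rewrite exprMn -[in leRHS]mulrA [in leRHS]normrM (ger0_norm (exprn_ge0 _ (ltW e0))).
have [M1 h1] := IH i.+1 k; have [M2 h2] := IH i k.+1; exists (M1 + M2) => x.
by rewrite mulrDr (le_trans (ler_normD _ _))// lerD.
Qed.

Lemma wave_sum_schwartz e : 0 < e -> schwartz (wave_sum e 0 0 0).
Proof.
move=> e0; split=> [n x|m n].
  by rewrite wave_sum_derive1n; have [] := wave_sum_derive e n 0 0 x.
by rewrite wave_sum_derive1n; exact: wave_sum_decays.
Qed.

(** Provides the majorant, uniform in the width of the cutoff, for letting e tend to 0. Derivatives
    of the cutoff carry powers of e, harmless for e <= 1. *)
Lemma wave_sum_bounded n i k :
  exists M, forall e x, 0 < e -> e <= 1 -> `|wave_sum e n i k x| <= M.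
Proof.
elim: n i k => [|n IH] i k /=.
  have [M hM] := gaussd_bounded 0 i; exists (M * `|t| ^+ k) => e x e0 e1.
  rewrite /wave_packet normrM; apply: ler_pM => //; last exact: wave_bounded.
  rewrite normrM -[leRHS]mul1r; apply: ler_pM => //.
    by rewrite normrX (ger0_norm (ltW e0)) exprn_ile1// ltW.
  by have := hM (e * x); rewrite expr0 mul1r.
have [M1 h1] := IH i.+1 k; have [M2 h2] := IH i k.+1; exists (M1 + M2) => e x e0 e1.
by rewrite (le_trans (ler_normD _ _))// lerD// ?h1 ?h2.
Qed.

(** Every derivative that falls on the cutoff costs a factor e, so in the limit only the term with
    all derivatives on the wave survives, and it is present only for i = 0. *)
Lemma wave_sum_cvg n i k x :
  wave_sum m.+1%:R^-1 n i k x @[m --> \oo] --> (i == 0%N)%:R * wave (k + n) x.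
Proof.
elim: n i k => [|n IH] i k; last first.
  rewrite (_ : _ * _ = (i.+1 == 0%N)%:R * wave (k + n) x + (i == 0%N)%:R * wave (k.+1 + n) x).
    exact: (cvgD (IH i.+1 k) (IH i k.+1)).
  by rewrite mul0r add0r addSnnS.
rewrite addn0 /= /wave_packet; apply: cvgM; last exact: cvg_cst.
have ce : m.+1%:R^-1 @[m --> \oo] --> (0 : R) by exact: cvg_harmonic.
case: i => [|i]; last first.
  have -> : (i.+1 == 0%N)%:R = 0 :> R by [].
  have [M hM] := gaussd_bounded 0 i.+1.
  have cM : m.+1%:R^-1 * M @[m --> \oo] --> (0 : R).
    by rewrite -[X in _ --> X](mul0r M); apply: cvgM => //; exact: cvg_cst.
  apply: norm_cvg0; move: cM; apply: squeeze_cvgr; last exact: cvg_cst.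
  apply: nearW => m; rewrite normr_ge0/= normrM.
  have e0 : 0 < m.+1%:R^-1 :> R by rewrite invr_gt0.
  apply: ler_pM => //; last by have := hM (m.+1%:R^-1 * x); rewrite expr0 mul1r.
  rewrite normrX (ger0_norm (ltW e0)) exprS ler_piMr ?(ltW e0)// exprn_ile1 ?(ltW e0)//.
  by rewrite invf_le1// ler1n.
have -> : (0%N == 0%N)%:R = 1 :> R by [].
rewrite /gaussd.
rewrite (_ : (fun n => _) = fun m => expR (- ((m.+1%:R^-1 * x) * (m.+1%:R^-1 * x)))).
  have := @continuous_expR R 0; rewrite /continuous_at expR0.
  apply: cvg_comp.
  have cx : m.+1%:R^-1 * x @[m --> \oo] --> (0 : R).
    by rewrite -[X in _ --> X](mul0r x); apply: cvgM => //; exact: cvg_cst.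
  have := cvgN (cvgM cx cx).
  by rewrite mulr0 oppr0; apply.
by apply/funext => m; rewrite expr0 mul1r hornerC mul1r expr2.
Qed.

End gaussian_cutoff.

Theorem charfn_of_stein (R : realType) d (T : measurableType d)
    (P : {finite_measure set T -> \bar R}) (V : T -> R) (W : nat -> T -> R) m :
  measurable_fun setT V -> (forall j, L1 P (W j)) ->
  (forall f, schwartz f -> \sum_(j < m) \int[P]_w (W j w * (f^`(j)%classic) (V w)) = 0) ->
  forall t c, \sum_(j < m) t ^+ j * \int[P]_w (W j w * cos (t * V w + c + quarter R j)) = 0.
Proof.
move=> mV IW H t c.
pose e n : R := n.+1%:R^-1.
have e0 n : 0 < e n by rewrite invr_gt0.
have e1 n : e n <= 1 by rewrite invf_le1// ler1n.
have cj (j : nat) : \int[P]_w (W j w * wave_sum t c (e n) j 0 0 (V w)) @[n --> \oo] -->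
    \int[P]_w (W j w * wave t c j (V w)).
  have [M hM] := wave_sum_bounded t c j 0 0.
  have [||||_ //] := @Rint_dct _ _ _ P (fun n w => W j w * wave_sum t c (e n) j 0 0 (V w))
    (fun w => W j w * wave t c j (V w)) (fun w => M * `|W j w|).
  - move=> n; apply: measurable_funM; first exact: L1_measurable (IW j).
    apply: measurableT_comp mV; apply: continuous_measurable_fun.
    by apply: is_derive_continuous => x; exact: wave_sum_derive.
  - move=> w; apply: cvgM; first exact: cvg_cst.
    by have := @wave_sum_cvg _ t c j 0 0 (V w); rewrite eqxx mul1r.
  - by apply: L1Zl; exact: L1_norm.
  - by move=> n w; rewrite normrM mulrC ler_wpM2r// hM.
have c1 := @cvg_sumr R _ (index_enum 'I_m) _ _ (fun j : 'I_m => cj j).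
have c0 : \sum_(j < m) \int[P]_w (W j w * wave_sum t c (e n) j 0 0 (V w)) @[n --> \oo] --> (0 : R).
  rewrite (_ : (fun n => _) = cst 0); first exact: cvg_cst.
  apply/funext => n; rewrite -[RHS](H _ (wave_sum_schwartz t c (e0 n))).
  by apply: eq_bigr => j _; rewrite wave_sum_derive1n.
rewrite -[RHS](cvg_unique (@norm_hausdorff _ R^o) c1 c0).
apply: eq_bigr => j _; rewrite -RintegralZl//.
  by apply: eq_Rintegral => w _; rewrite /wave mulrCA.
apply: L1_cos => //.
by apply: measurable_funD => //; apply: measurable_funD => //; exact: measurable_funM.
Qed.

(** * The determinant |I - iCT| *)

Section principal_minors.
Context (K : comNzRingType).

(** A bijection forces equal dimensions; reindexing then permutes rows and columns by the same
    permutation and the two signs cancel. *)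
Lemma det_mxsub_bij n m (g : 'I_m -> 'I_n) (M : 'M[K]_n) :
  bijective g -> \det (mxsub g g M) = \det M.
Proof.
move=> bg; have mn : m = n by rewrite -(card_ord m) -(card_ord n); exact: bij_eq_card bg.
subst m; have ig := bij_inj bg; pose s := perm ig.
have -> : mxsub g g M = row_perm s (col_perm s M).
  by apply/matrixP => i j; rewrite !mxE !permE.
rewrite row_permE col_permE !det_mulmx !det_perm mulrC -mulrA -signr_addb odd_permV.
by rewrite addbb mulr1.
Qed.

(** Listing the indices of S first makes the matrix block upper triangular, with the minor in the
    upper left corner and an identity block in the lower right one. *)
Lemma det_rows_id n (S : {set 'I_n}) (A : 'M[K]_n) :
  \det (\matrix_(i, j) (if i \in S then A i j else (i == j)%:R)) =
  \det (\matrix_(i < #|S|, j < #|S|) A (enum_val i) (enum_val j)).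
Proof.
set M := (X in \det X = _).
pose g (i : 'I_(#|S| + #|~: S|)) : 'I_n :=
  match fintype.split i with inl a => enum_val a | inr b => enum_val b end.
have ig : injective g.
  move=> i j; rewrite /g; have Ei := splitK i; have Ej := splitK j; move: Ei Ej.
  case: (fintype.split i) => a; case: (fintype.split j) => b <- <-.
  - by move=> /enum_val_inj ->.
  - move=> E; have := enum_valP a; have := enum_valP b.
    by rewrite -E inE => /negbTE ->.
  - move=> E; have := enum_valP a; have := enum_valP b.
    by rewrite -E inE => ->.
  - by move=> /enum_val_inj ->.
have bg : bijective g.
  by apply: inj_card_bij => //; rewrite !card_ord -[leqLHS]card_ord cardsC card_ord.
rewrite -(det_mxsub_bij M bg).
rewrite -(submxK (mxsub g g M)) (_ : dlsubmx _ = 0); last first.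
  apply/matrixP => i j; rewrite !mxE /g; case: fintype.splitP => [a /= E|b _].
    by have := ltn_ord a; rewrite -E /= ltnNge leq_addr.
  case: fintype.splitP => [a _|a /= E]; last by have := ltn_ord j; rewrite E ltnNge leq_addr.
  have := enum_valP b; rewrite inE => /negbTE ->.
  by case: eqP => // E; have := enum_valP a; rewrite -E; have := enum_valP b; rewrite inE => /negbTE ->.
rewrite (_ : drsubmx _ = 1%:M); last first.
  apply/matrixP => i j; rewrite !mxE /g; case: fintype.splitP => [a /= E|b /= Eb].
    by have := ltn_ord a; rewrite -E /= ltnNge leq_addr.
  case: fintype.splitP => [a /= E|a /= Ea].
    by have := ltn_ord a; rewrite -E /= ltnNge leq_addr.
  have := enum_valP b; rewrite inE => /negbTE ->.
  have -> : i = b by apply: val_inj; move/addnI: Eb.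
  have -> : j = a by apply: val_inj; move/addnI: Ea.
  by rewrite (inj_eq enum_val_inj).
rewrite det_ublock det1 mulr1; congr (\det _); apply/matrixP => i j.
rewrite !mxE /g; case: fintype.splitP => [a /= Ea|b /= E]; last first.
  by have := ltn_ord i; rewrite E ltnNge leq_addr.
case: fintype.splitP => [b /= Eb|b /= E]; last by have := ltn_ord j; rewrite E ltnNge leq_addr.
have -> : i = a by exact: val_inj.
have -> : j = b by exact: val_inj.
by rewrite enum_valP.
Qed.

(** In the Leibniz formula each factor is a sum of an entry of [A] and one of the identity.
    Distributing the product selects the set S of rows where [A] is taken. *)
Lemma det_1D n (A : 'M[K]_n) :
  \det (1%:M + A) = \sum_(S : {set 'I_n})
    \det (\matrix_(i < #|S|, j < #|S|) A (enum_val i) (enum_val j)).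
Proof.
under [RHS]eq_bigr do rewrite -det_rows_id.
rewrite /determinant exchange_big /=; apply: eq_bigr => s _.
rewrite -mulr_sumr; congr (_ * _).
under eq_bigr do rewrite !mxE addrC.
rewrite bigA_distr; apply: eq_bigr => S _; apply: eq_bigr => i _.
by rewrite mxE.
Qed.

Lemma det_scale_cols n (B : 'M[K]_n) (l : 'I_n -> K) (a : K) :
  \det (\matrix_(i, j) (a * (B i j * l j))) = a ^+ n * \det B * \prod_j l j.
Proof.
rewrite (_ : \matrix_(i, j) _ = a *: (B *m diag_mx (\row_j l j))); last first.
  apply/matrixP => i j; rewrite !mxE; congr (_ * _).
  by rewrite (bigD1 j)//= !mxE eqxx mulr1n big1 ?addr0// => k kj; rewrite !mxE (negbTE kj) mulr0n mulr0.
rewrite detZ det_mulmx det_diag mulrA; congr (_ * _).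
by apply: eq_bigr => i _; rewrite mxE.
Qed.

Lemma det_1D_scaled n (A : 'M[K]_n) (l : 'I_n -> K) (a : K) :
  \det (\matrix_(i, j) ((i == j)%:R + a * (A i j * l j))) =
  \sum_(j < n.+1) a ^+ j * \sum_(S : {set 'I_n} | #|S| == j)
     (\det (\matrix_(i < #|S|, j < #|S|) A (enum_val i) (enum_val j)) * \prod_(s in S) l s).
Proof.
rewrite (_ : \matrix_(i, j) _ = 1%:M + \matrix_(i, j) (a * (A i j * l j))); last first.
  by apply/matrixP => i j; rewrite !mxE.
rewrite det_1D (partition_big (fun S : {set 'I_n} => inord #|S| : 'I_n.+1) xpredT)//=.
apply: eq_bigr => j _; rewrite mulr_sumr; apply: eq_big => S.
  have cS : (#|S| < n.+1)%N by rewrite ltnS -[leqRHS]card_ord max_card.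
  by rewrite -val_eqE/= inordK.
have cS : (#|S| < n.+1)%N by rewrite ltnS -[leqRHS]card_ord max_card.
rewrite -val_eqE/= inordK// => /eqP <-; rewrite mulrA.
rewrite (_ : \matrix_(i, j) _ = \matrix_(i < #|S|, j < #|S|) (a *
  ((\matrix_(i < #|S|, j < #|S|) A (enum_val i) (enum_val j)) i j * l (enum_val j)))); last first.
  by apply/matrixP => i k; rewrite !mxE.
rewrite (det_scale_cols _ (fun k : 'I_#|S| => l (enum_val k))); congr (_ * _).
by rewrite [in RHS]big_enum_val.
Qed.
End principal_minors.

Section complex_polynomials.
Context (R : realType).
Local Notation Re := (@complex.Re R).
Local Notation Im := (@complex.Im R).
Local Open Scope complex_scope.
Implicit Types (z : R[i]) (a s b : R).

Lemma ReM z1 z2 : Re (z1 * z2) = Re z1 * Re z2 - Im z1 * Im z2.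
Proof. by case: z1 z2 => [? ?] [? ?]. Qed.

Lemma ImM z1 z2 : Im (z1 * z2) = Re z1 * Im z2 + Im z1 * Re z2.
Proof. by case: z1 z2 => [? ?] [? ?]. Qed.

Lemma complexP z1 z2 : Re z1 = Re z2 -> Im z1 = Im z2 -> z1 = z2.
Proof. by case: z1 z2 => [? ?] [? ?] /= -> ->. Qed.

Lemma Re_sum (I : Type) (r : seq I) (F : I -> R[i]) :
  Re (\sum_(i <- r) F i) = \sum_(i <- r) Re (F i).
Proof. by elim: r => [|i r IH]; rewrite ?big_nil// !big_cons raddfD/= IH. Qed.

Lemma Im_sum (I : Type) (r : seq I) (F : I -> R[i]) :
  Im (\sum_(i <- r) F i) = \sum_(i <- r) Im (F i).
Proof. by elim: r => [|i r IH]; rewrite ?big_nil// !big_cons raddfD/= IH. Qed.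

Lemma horner_Re (q : {poly R[i]}) s : Re q.[s%:C] = (map_poly Re q).[s].
Proof.
rewrite (horner_coef_wide _ (size_poly _ _)) horner_coef Re_sum.
apply: eq_bigr => i _; rewrite coef_map -rmorphXn ReM /= mulr0 subr0//.
Qed.

Lemma horner_Im (q : {poly R[i]}) s : Im q.[s%:C] = (map_poly Im q).[s].
Proof.
rewrite (horner_coef_wide _ (size_poly _ _)) horner_coef Im_sum.
apply: eq_bigr => i _; rewrite coef_map -rmorphXn ImM /= mulr0 add0r//.
Qed.

Lemma deriv_map_Re (q : {poly R[i]}) : (map_poly Re q)^`() = map_poly Re q^`().
Proof. by apply/polyP => i; rewrite !(coef_map, coef_deriv) raddfMn. Qed.

Lemma deriv_map_Im (q : {poly R[i]}) : (map_poly Im q)^`() = map_poly Im q^`().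
Proof. by apply/polyP => i; rewrite !(coef_map, coef_deriv) raddfMn. Qed.

Lemma is_derive_horner_Re (q : {poly R[i]}) (s : R) :
  is_derive s 1 (fun s => Re q.[s%:C]) (Re q^`().[s%:C]).
Proof.
rewrite horner_Re -deriv_map_Re; under eq_fun do rewrite horner_Re.
exact: is_derive_poly.
Qed.

Lemma is_derive_horner_Im (q : {poly R[i]}) (s : R) :
  is_derive s 1 (fun s => Im q.[s%:C]) (Im q^`().[s%:C]).
Proof.
rewrite horner_Im -deriv_map_Im; under eq_fun do rewrite horner_Im.
exact: is_derive_poly.
Qed.

End complex_polynomials.

(** * The determinant along the lines s lambda + b *)

Section gamma_determinant.
Context (R : realType) (d : nat).
Local Notation Re := (@complex.Re R).
Local Notation Im := (@complex.Im R).
Local Open Scope complex_scope.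
Variables (C : 'M[R]_d).
Local Notation II := (0 +i* 1 : R[i]).

Lemma gamma_detE (t : 'rV[R]_d) : gamma_det C t =
  \det (\matrix_(i, j) ((i == j)%:R - II * (C i j * t ord0 j)%:C)).
Proof.
rewrite /gamma_det; congr (\det _); apply/matrixP => i j.
by rewrite mul_mx_diag !mxE.
Qed.

(** For a left null vector x + iy and A = CT, one gets y = xA and x = -yA. Hence yCy^T = yACx^T =
    -xCx^T, and positive definiteness forces x = y = 0, whatever the signs in [t]. *)
Lemma gamma_det_neq0 (t : 'rV[R]_d) : symposdef C -> gamma_det C t != 0.
Proof.
move=> [CT Cpos]; apply/negP => /det0P[v v0].
set A := C *m diag_mx t; rewrite mulmxBr mulmx1 -scalemxAr => /eqP.
rewrite subr_eq0 => /eqP vE.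
pose x := map_mx Re v; pose y := map_mx Im v.
have EA j : v ord0 j = II * \sum_k v ord0 k * (A k j)%:C.
  have := congr1 (fun w : 'rV_d => w ord0 j) vE; rewrite !mxE => {1}->.
  by congr (_ * _); apply: eq_bigr => k _; rewrite !mxE.
have xE : x = - (y *m A).
  apply/rowP => j; rewrite !mxE EA ReM mul0r sub0r mul1r Im_sum; congr (- _).
  by apply: eq_bigr => k _; rewrite !mxE ImM mulr0 add0r.
have yE : y = x *m A.
  apply/rowP => j; rewrite !mxE EA ImM mul0r add0r mul1r Re_sum.
  by apply: eq_bigr => k _; rewrite !mxE ReM mulr0 subr0.
have pos (u : 'rV[R]_d) : 0 <= (u *m C *m u^T) ord0 ord0.
  have [->|u0] := eqVneq u 0; first by rewrite !mul0mx mxE.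
  exact/ltW/Cpos.
have E : (x *m C *m x^T) ord0 ord0 + (y *m C *m y^T) ord0 ord0 = 0.
  have -> : (y *m C *m y^T) ord0 ord0 = ((y *m C *m y^T)^T) ord0 ord0 by rewrite [RHS]mxE.
  have -> : (y *m C *m y^T)^T = y *m A *m C *m x^T.
    by rewrite !trmx_mul trmxK CT {2}yE /A !trmx_mul CT tr_diag_mx !mulmxA.
  by rewrite {1}xE !mulNmx [X in X + _]mxE addNr.
have nz (u : 'rV[R]_d) : (u *m C *m u^T) ord0 ord0 = 0 -> u = 0.
  by move=> u0; apply/eqP; apply: contraTT isT => /Cpos; rewrite u0 ltxx.
have px := pos x; have py := pos y.
have x0 : x = 0 by apply: nz; lra.
have y0 : y = 0 by apply: nz; lra.
move: v0; apply/negP; rewrite negbK; apply/eqP/rowP => j; rewrite !mxE.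
apply: complexP => /=.
  by have := congr1 (fun w : 'rV_d => w ord0 j) x0; rewrite !mxE.
by have := congr1 (fun w : 'rV_d => w ord0 j) y0; rewrite !mxE.
Qed.

Variable lambda : 'I_d -> R.

(* det (I - i C (X Lambda + Y I)), where X is the outer indeterminate and Y the
   inner one *)
Definition det2 : {poly {poly R[i]}} :=
  \det (\matrix_(i, j < d) (((i == j)%:R - (II * (C i j)%:C) *: 'X)%:P
     - (II * (C i j * lambda j)%:C)%:P *: 'X)).

(** The differential equation differentiates in s at fixed b, whereas continuation needs a
    polynomial in b at fixed s. Both are read off from [det2], evaluated in either order. *)
Definition det_at (b : R) : {poly R[i]} := map_poly (horner_eval b%:C) det2.

Lemma det_at_horner b (z : R[i]) : (det_at b).[z] = det2.[z%:P].[b%:C].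
Proof. by rewrite /det_at -[z in LHS](hornerC z b%:C) horner_map. Qed.

Lemma deriv_det_at_horner b (z : R[i]) : (det_at b)^`().[z] = det2^`().[z%:P].[b%:C].
Proof. by rewrite /det_at deriv_map -[z in LHS](hornerC z b%:C) horner_map. Qed.

Lemma det_atE s b : (det_at b).[s%:C] = gamma_det C (\row_j (s * lambda j + b)).
Proof.
rewrite det_at_horner gamma_detE /det2.
have -> (q : {poly {poly R[i]}}) : q.[(s%:C)%:P].[b%:C] = horner_eval b%:C (horner_eval (s%:C)%:P q) by [].
rewrite -!det_map_mx; congr (\det _); apply/matrixP => i j; rewrite !mxE.
change (((((i == j)%:R - (II * (C i j)%:C) *: 'X)%:P
     - (II * (C i j * lambda j)%:C)%:P *: 'X).[(s%:C)%:P]).[b%:C]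
  = (i == j)%:R - II * (C i j * (s * lambda j + b))%:C).
rewrite !(hornerD, hornerN, hornerZ, hornerC, hornerX, hornerM, hornerMn).
rewrite !rmorphM !rmorphD /= !rmorphM /=; ring.
Qed.


Lemma det_at0 : det_at 0 = \poly_(j < d.+1) ((- II) ^+ j * (rcoef C lambda j)%:C).
Proof.
rewrite /det_at /det2 -det_map_mx poly_def.
rewrite (_ : map_mx _ _ = \matrix_(i, j) ((i == j)%:R + (- II *: 'X) *
    ((map_mx (fun x => x%:C%:P) C) i j * (lambda j)%:C%:P))).
  rewrite det_1D_scaled; apply: eq_bigr => j _.
  rewrite exprZn -scalerAl -[RHS]scalerA; congr (_ *: _).
  rewrite mulrC -mul_polyC; congr (_ * _); rewrite /rcoef !rmorph_sum.
  apply: eq_bigr => S _; rewrite !rmorphM !rmorph_prod; congr (_ * _).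
  rewrite /principal_minor -!det_map_mx; congr (\det _).
  by apply/matrixP => i k; rewrite !mxE.
apply/matrixP => i j; rewrite !mxE.
transitivity (map_poly (horner_eval (0%:C : R[i])) ((((i == j)%:R - (II * (C i j)%:C) *: 'X)%:P
     - (II * (C i j * lambda j)%:C)%:P *: 'X))) => //.
rewrite rmorphB /= map_polyC -[_%:P *: 'X]mul_polyC rmorphM /= map_polyC map_polyX /=.
rewrite /horner_eval !(hornerD, hornerN, hornerZ, hornerC, hornerX, hornerM, hornerMn).
rewrite mulr0 subr0 rmorph_nat -[- II *: 'X]mul_polyC; congr (_ + _).
by rewrite polyCN !polyCM [(_ * lambda j)%:C]rmorphM /= polyCM; ring.
Qed.

Lemma det_at0_horner (z : R[i]) :
  (det_at 0).[z] = \sum_(j < d.+1) ((- II) ^+ j * (rcoef C lambda j)%:C) * z ^+ j.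
Proof. by rewrite det_at0 horner_poly. Qed.

(** The index j = d is kept, although its coefficient contains r_(d+1) = 0, so that this sum can be
    combined term by term with the one for the polynomial itself. *)
Lemma deriv_det_at0_horner (z : R[i]) : (det_at 0)^`().[z] =
  \sum_(j < d.+1) ((- II) ^+ j.+1 * (rcoef C lambda j.+1)%:C *+ j.+1) * z ^+ j.
Proof.
transitivity ((\poly_(j < d.+1) ((- II) ^+ j.+1 * (rcoef C lambda j.+1)%:C *+ j.+1)).[z]);
  last by rewrite horner_poly.
congr _.[z]; apply/polyP => j.
rewrite coef_deriv det_at0 !coef_poly !ltnS [(j <= d)%N]leq_eqVlt.
have [//|dj] := ltnP j d; first by rewrite orbT.
by rewrite orbF mul0rn; case: eqP => // jd; rewrite rcoef_gt ?jd// mulr0 mul0rn.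
Qed.

End gamma_determinant.

(** * Moments of the gamma distribution *)

Section even_moments.
Context (R : realType).
Implicit Types (f : R -> R) (h t : R).

Lemma is_derive_cvg f (x a : R) : is_derive x 1 f a ->
  k^-1 * (f (k + x) - f x) @[k --> 0^'] --> a.
Proof.
move=> [/cvg_ex[/= l fl] <-].
have -> : 'D_1 f x = l by exact/cvg_lim.
by move: fl; under eq_fun do rewrite scaler1.
Qed.

(** Cosines t -> cos(tx) are eigenfunctions with eigenvalue -2(1 - cos(hx)), close to -(hx)^2.
    Iterating it on a characteristic function therefore approximates even moments. *)
Definition second_diff h f t := f (t + h) + f (t - h) - 2 * f t.

Lemma is_derive_shift f f' a : (forall x : R, is_derive x 1 f (f' x)) ->
  forall x : R, is_derive x 1 (fun x => f (x + a)) (f' (x + a)).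
Proof.
move=> df x; have h : is_derive x (1:R) (fun x => x + a) 1.
  by apply: is_derive_eq; rewrite addr0.
by have := @is_derive1_comp _ f _ x _ _ (df _) h; rewrite mulr1.
Qed.

Lemma norm_le_of_derive f f' (K : R) h : 0 <= h -> f 0 = 0 ->
  (forall x : R, is_derive x 1 f (f' x)) -> (forall x, 0 <= x -> x <= h -> `|f' x| <= K) ->
  `|f h| <= K * h.
Proof.
move=> h0 f0 df fK.
have cf := is_derive_continuous df.
have [c /[!in_itv]/= /andP[c0 ch] E] := @MVT_segment _ f f' 0 h h0 (fun x _ => df x) (continuous_subspaceT cf).
by move: E; rewrite f0 !subr0 => ->; rewrite normrM (ger0_norm h0) ler_wpM2r// fK.
Qed.

(** As a function of h the difference vanishes with its first derivative at 0, and its second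
    derivative is at most 2K. Two uses of the mean value theorem give 2Kh^2; the lost factor 2 only
    changes a geometric rate later. *)
Lemma second_diff_le f f' f'' (K : R) h t : 0 <= h ->
  (forall x : R, is_derive x 1 f (f' x)) -> (forall x : R, is_derive x 1 f' (f'' x)) ->
  (forall x, `|f'' x| <= K) -> `|second_diff h f t| <= 2 * h ^+ 2 * K.
Proof.
move=> h0 df df' fK.
pose F s := f (t + s) + f (t - s) - 2 * f t.
pose F' s := f' (t + s) - f' (t - s).
pose F'' s := f'' (t + s) + f'' (t - s).
have dp (g g' : R -> R) : (forall x : R, is_derive x 1 g (g' x)) ->
    forall s : R, is_derive s 1 (fun s => g (t + s)) (g' (t + s)).
  move=> dg s; have := @is_derive_shift g g' t dg s; rewrite addrC.
  by under eq_fun do rewrite addrC.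
have dm (g g' : R -> R) : (forall x : R, is_derive x 1 g (g' x)) ->
    forall s : R, is_derive s 1 (fun s => g (t - s)) (- g' (t - s)).
  move=> dg s; have h1 : is_derive s (1:R) (fun s => t - s) (-1).
    by apply: is_derive_eq; ring.
  by have := @is_derive1_comp _ g _ s _ _ (dg _) h1; rewrite mulrN1.
have dF (s : R) : is_derive s 1 F (F' s).
  have := dp _ _ df s; have := dm _ _ df s => ? ?.
  by rewrite /F; apply: is_derive_eq; rewrite /F' /GRing.scale/=; ring.
have dF' (s : R) : is_derive s 1 F' (F'' s).
  have := dp _ _ df' s; have := dm _ _ df' s => ? ?.
  by rewrite /F'; apply: is_derive_eq; rewrite /F'' /GRing.scale/=; ring.
have K0 : 0 <= K by exact: le_trans (fK 0).
have h1 s : 0 <= s -> s <= h -> `|F' s| <= 2 * K * h.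
  move=> s0 sh; rewrite (@le_trans _ _ (2 * K * s))// ?ler_wpM2l// ?mulr_ge0//.
  apply: (@norm_le_of_derive F' F'') => //; first by rewrite /F' addr0 subr0 subrr.
  by move=> x _ _; rewrite (le_trans (ler_normD _ _))// mulr_natl mulr2n lerD.
rewrite /second_diff -/(F h) (_ : 2 * h ^+ 2 * K = 2 * K * h * h); last by ring.
apply: (@norm_le_of_derive F F') => //.
by rewrite /F addr0 subr0; ring.
Qed.

Lemma iter_second_diff_le (g : nat -> R -> R) (B : nat -> R) h n k t : 0 <= h ->
  (forall k (x : R), is_derive x 1 (g k) (g k.+1 x)) -> (forall k x, `|g k x| <= B k) ->
  `|iter n (second_diff h) (g k) t| <= (2 * h ^+ 2) ^+ n * B (k + n.*2)%N.
Proof.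
move=> h0 dg gB; have dG m j (x : R) : is_derive x 1 (iter m (second_diff h) (g j)) (iter m (second_diff h) (g j.+1) x).
  elim: m j x => [|m IH] j x //=; rewrite {1}/second_diff.
  have := @is_derive_shift _ _ h (IH j) x; have := @is_derive_shift _ _ (- h) (IH j) x; have := IH j x => ? ? ?.
  by apply: is_derive_eq; rewrite /second_diff /GRing.scale/=; ring.
elim: n k t => [|n IH] k t; first by rewrite expr0 mul1r double0 addn0; exact: gB.
rewrite iterS exprS -mulrA; apply: (@second_diff_le _ _ _ _ h t h0 (dG n k) (dG n k.+1)).
by move=> x; have := IH k.+2 x; rewrite doubleS !addSnnS.
Qed.

Lemma iter_second_diff_cos h n x t :
  iter n (second_diff h) (fun t => cos (t * x)) t = (- (2 * (1 - cos (h * x)))) ^+ n * cos (t * x).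
Proof.
elim: n t => [|n IH] t; first by rewrite expr0 mul1r.
rewrite iterS /second_diff !IH (mulrDl t h x) (mulrBl x t h) cosD cosB exprS; ring.
Qed.

Context d (T : measurableType d) (P : probability T R).

Lemma iter_second_diff_Rint (X : T -> R) h n t : measurable_fun setT X ->
  L1 P (fun w => iter n (second_diff h) (fun t => cos (t * X w)) t) /\
  iter n (second_diff h) (fun t => \int[P]_w cos (t * X w)) t =
  \int[P]_w (iter n (second_diff h) (fun t => cos (t * X w)) t).
Proof.
move=> mX; elim: n t => [|n IH] t.
  split => //=; rewrite (_ : (fun w => _) = fun w => cst 1 w * cos (t * X w)).
    by apply: L1_cos; [exact: finite_measure_integrable_cst|exact: measurable_funM].
  by apply/funext => w; rewrite mul1r.
have [I1 E1] := IH (t + h); have [I2 E2] := IH (t - h); have [I3 E3] := IH t.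
have I4 := L1Zl 2 I3.
split; first exact: (L1B (L1D I1 I2) I4).
rewrite iterS {1}/second_diff E1 E2 E3 -RintegralZl// -RintegralD// -RintegralB//.
exact: L1D I1 I2.
Qed.

(* Fatou's lemma along h = 1/(m+1), applied to (2 (1 - cos (h X)) / h^2)^n -> X^(2n) *)
Lemma even_moment_le (X : T -> R) (g : nat -> R -> R) (B : nat -> R) n :
  measurable_fun setT X ->
  (forall k (x : R), is_derive x 1 (g k) (g k.+1 x)) -> (forall k x, `|g k x| <= B k) ->
  (forall t, \int[P]_w cos (t * X w) = g 0%N t) ->
  L1 P (fun w => X w ^+ n.*2) /\ \int[P]_w (X w ^+ n.*2) <= 2 ^+ n * B n.*2.
Proof.
move=> mX dg gB gX.
pose h m : R := m.+1%:R^-1.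
have h0 m : 0 < h m by rewrite invr_gt0.
pose F m w := (2 * (1 - cos (h m * X w)) / h m ^+ 2) ^+ n.
have F0 m w : 0 <= F m w.
  rewrite exprn_ge0// divr_ge0 ?sqr_ge0// mulr_ge0// subr_ge0 cos_le1//.
have IF m : L1 P (F m) /\ \int[P]_w F m w <= 2 ^+ n * B n.*2.
  have [I E] := @iter_second_diff_Rint X (h m) n 0 mX.
  (* The sign (-1)^n undoes that of the eigenvalue -2(1 - cos(hX)); at t = 0 the remaining cosine is
     1. *)
  have EF : F m = fun w => (-1) ^+ n * h m ^- n.*2 * iter n (second_diff (h m)) (fun t => cos (t * X w)) 0.
    apply/funext => w; rewrite iter_second_diff_cos mul0r cos0 mulr1.
    rewrite -[in RHS](mulN1r (2 * _)) [in RHS]exprMn mulrACA -exprMn mulN1r opprK expr1n mul1r.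
    by rewrite /F exprMn exprVn -exprM mul2n mulrC.
  split; first by rewrite EF; exact: L1Zl.
  rewrite EF RintegralZl// -E (_ : (fun t => \int[P]_w cos (t * X w)) = g 0%N); last exact/funext.
  have := @iter_second_diff_le g B (h m) n 0 0 (ltW (h0 m)) dg gB; rewrite add0n => hle.
  rewrite (le_trans (ler_norm _))// normrM normrM normrX normrN1 expr1n mul1r.
  rewrite ger0_norm ?invr_ge0 ?exprn_ge0 ?(ltW (h0 m))// mulrC ler_pdivrMr ?exprn_gt0//.
  by rewrite (le_trans hle)// exprMn -exprM mul2n mulrAC.
have cF w : F m w @[m --> \oo] --> X w ^+ n.*2.
  (* By the half-angle formula 2(1 - cos(hX)) = (2 sin(hX/2))^2, so the limit reduces to the
     derivative at 0 of 2 sin(sX/2), which is X. *)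
  have FE m : F m w = (2 * sin (h m * (X w / 2)) / h m) ^+ n.*2.
    rewrite /F -mul2n exprM; congr (_ ^+ n).
    have -> : h m * X w = h m * (X w / 2) + h m * (X w / 2) by field.
    rewrite cosD expr_div_n exprMn; congr (_ / _).
    by have := cos2Dsin2 (h m * (X w / 2)); rewrite !expr2 => E; lra.
  rewrite (_ : (fun m => F m w) = fun m => (2 * sin (h m * (X w / 2)) / h m) ^+ n.*2); last exact/funext.
  have ds : is_derive (0 : R) 1 (fun s => 2 * sin (s * (X w / 2))) (X w).
    have h1 : is_derive (0 : R) (1:R) (fun s => s * (X w / 2)) (X w / 2).
      by apply: is_derive_eq; rewrite /GRing.scale/=; ring.
    have h2 := @is_derive1_comp _ sin _ 0 _ _ (is_derive_sin _) h1.
    by apply: is_derive_eq; rewrite /GRing.scale/= mul0r cos0; field.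
  have c1 := is_derive_cvg ds.
  have c2 : 2 * sin (h m * (X w / 2)) / h m @[m --> \oo] --> X w.
    have /cvgr_dnbhsP/(_ h) := c1.
    have [hn0 hc] : (forall m, h m != 0) /\ h m @[m --> \oo] --> 0.
      by split=> [m|]; [rewrite gt_eqF|exact: cvg_harmonic].
    move=> c2; rewrite (_ : (fun m => _) = (fun m => (h m)^-1 *
      (2 * sin ((h m + 0) * (X w / 2)) - 2 * sin (0 * (X w / 2))))); first exact: c2.
    by apply/funext => m; rewrite addr0 mul0r sin0 mulr0 subr0 mulrC.
  exact: (continuous_cvg _ (@exprn_continuous R n.*2 (X w)) c2).
have mX2 : measurable_fun setT (fun w => X w ^+ n.*2) by exact: measurable_funX.
have bound : (\int[P]_w (X w ^+ n.*2)%:E <= (2 ^+ n * B n.*2)%:E)%E.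
  have := @fatou _ _ _ P setT measurableT (fun m w => (F m w)%:E).
  rewrite (_ : (\int[P]_x limn_einf _)%E = (\int[P]_w (X w ^+ n.*2)%:E)%E); last first.
    apply: eq_integral => w _.
    have cE : (F m w)%:E @[m --> \oo] --> (X w ^+ n.*2)%:E.
      by apply/cvg_EFin; [exact: nearW|exact: cF].
    by rewrite (cvg_limn_einf_sup cE).
  move=> le; apply: le_trans (le _ _) _.
  - by move=> m; apply/measurable_EFinP; have [I _] := IF m; exact: L1_measurable I.
  - by move=> m w _; rewrite lee_fin.
  rewrite limn_einf_lim; apply: lime_le; first exact: is_cvg_einfs.
  apply: nearW => m; apply: (@le_trans _ _ (\int[P]_w (F m w)%:E)%E).
    by apply: ereal_inf_lbound; exists m => /=.
  have [I le1] := IF m.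
  have -> : (\int[P]_w (F m w)%:E = (\int[P]_w F m w)%:E)%E.
    by rewrite /Rintegral fineK//; exact: integrable_fin_num.
  by rewrite lee_fin.
have IX : L1 P (fun w => X w ^+ n.*2).
  apply/integrableP; split; first exact/measurable_EFinP.
  rewrite (_ : (\int[P]_x _)%E = (\int[P]_w (X w ^+ n.*2)%:E)%E).
    by rewrite (le_lt_trans bound)// ltry.
  by apply: eq_integral => w _ /=; rewrite ger0_norm// exprn_even_ge0// odd_double.
split=> //; rewrite /Rintegral -lee_fin fineK//; exact: integrable_fin_num.
Qed.

End even_moments.

(** * Moments of a univariate gamma law *)

Section gamma_charfn.
Context (R : realType) (alpha c : R).
Hypothesis alpha0 : 0 < alpha.

Definition rising n : R := \prod_(j < n) (alpha + j%:R).

Lemma rising_ge0 n : 0 <= rising n.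
Proof. by apply: prodr_ge0 => j _; rewrite addr_ge0// ltW. Qed.

(** Factor by factor, alpha + j <= (alpha + 1)(j + 1). A geometric rate times n! is the growth that
    yields a positive radius of convergence. *)
Lemma rising_le n : rising n <= (alpha + 1) ^+ n * n`!%:R.
Proof.
elim: n => [|n IH]; first by rewrite /rising big_ord0 expr0 mul1r.
have -> : (alpha + 1) ^+ n.+1 * (n.+1)`!%:R =
    ((alpha + 1) ^+ n * n`!%:R) * ((alpha + 1) * n.+1%:R).
  by rewrite exprSr factS natrM; ring.
rewrite {1}/rising big_ord_recr /=; apply: ler_pM => //; first exact: rising_ge0.
  by rewrite addr_ge0// ltW.
rewrite -natr1; have n0 : 0 <= n%:R :> R by [].
by have a0 := alpha0; nra.
Qed.

(* the n-th derivative of the real part of (1 - i c t)^(- alpha), up to the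
   constant c^n alpha (alpha + 1) ... (alpha + n - 1) *)
Definition gamma_wave n t :=
  expR ((alpha + n%:R) * ln (cos (atan (c * t)))) *
  cos ((alpha + n%:R) * atan (c * t) + quarter R n).

Lemma cos_atan_gt0 (x : R) : 0 < cos (atan x).
Proof. by apply: cos_gt0_pihalf; rewrite atan_gtNpi2 atan_ltpi2. Qed.

(** With th = atan(ct), (1 - ict)^(-a) is cos(th)^a e^(i a th), and th' = c cos(th)^2. One factor
    cos(th) raises the exponent; the other enters the addition formula that advances the phase by
    th, and the sign becomes a quarter turn. *)
Lemma gamma_wave_derive n (t : R) :
  is_derive t 1 (gamma_wave n) ((alpha + n%:R) * c * gamma_wave n.+1 t).
Proof.
have h0 : is_derive t (1:R) (fun t => c * t) c.
  by apply: is_derive_eq; rewrite /GRing.scale/=; ring.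
have h1 := @is_derive1_comp _ _ _ t _ _ (is_derive1_atan (c * t)) h0.
have C0 := cos_atan_gt0 (c * t).
have h2 := @is_derive1_comp _ cos _ t _ _ (is_derive_cos _) h1.
have h3 := @is_derive1_comp _ _ _ t _ _ (is_derive1_ln C0) h2.
have h4 := @is_derive1_comp _ expR _ t _ _ (is_derive_expR _) (is_deriveZ (alpha + n%:R) h3).
have h5 : is_derive t (1:R) (fun t => (alpha + n%:R) * atan (c * t) + quarter R n)
    ((alpha + n%:R) * ((1 + (c * t) ^+ 2)^-1 * c)).
  by apply: is_derive_eq; rewrite /GRing.scale/= addr0.
have h6 := @is_derive1_comp _ cos _ t _ _ (is_derive_cos _) h5.
apply: (is_derive_eq (is_deriveM h4 h6)).
have -> : (1 + (c * t) ^+ 2)^-1 = cos (atan (c * t)) ^+ 2.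
  by rewrite cos_atan exprVn sqr_sqrtr// addr_ge0// sqr_ge0.
rewrite /gamma_wave /GRing.scale/=.
set th := atan (c * t) in C0 *; rewrite -natr1.
have -> : quarter R n.+1 = quarter R n + pi / 2 by rewrite /quarter -natr1; ring.
have -> : (alpha + (n%:R + 1)) * th + (quarter R n + pi / 2) =
  ((alpha + n%:R) * th + quarter R n) + th + pi / 2 by ring.
rewrite [in RHS]cosD cos_pihalf sin_pihalf [in RHS]sinD.
have -> : (alpha + (n%:R + 1)) * ln (cos th) = (alpha + n%:R) * ln (cos th) + ln (cos th) by ring.
rewrite expRD lnK ?posrE//.
by field; rewrite gt_eqF.
Qed.

Lemma gamma_wave_le1 n t : `|gamma_wave n t| <= 1.
Proof.
rewrite normrM -[1]mulr1; apply: ler_pM => //; last exact: normr_cos_le1.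
rewrite ger0_norm ?expR_ge0// -expR0 ler_expR.
by rewrite mulr_ge0_le0 ?addr_ge0 ?(ltW alpha0)// ln_le0// cos_le1.
Qed.

Definition gamma_re n t := c ^+ n * rising n * gamma_wave n t.

Lemma gamma_re_derive n (t : R) : is_derive t 1 (gamma_re n) (gamma_re n.+1 t).
Proof.
apply: (is_derive_eq (is_deriveZ _ (gamma_wave_derive n t))).
by rewrite /gamma_re /rising big_ord_recr/= exprSr /GRing.scale/=; ring.
Qed.

Lemma gamma_even_moment d (T : measurableType d) (P : probability T R) (X : T -> R) n :
  measurable_fun setT X -> (forall t, \int[P]_w cos (t * X w) = gamma_re 0 t) ->
  L1 P (fun w => X w ^+ n.*2) /\
  \int[P]_w (X w ^+ n.*2) <= (2 * `|c| * (alpha + 1)) ^+ n.*2 * n.*2`!%:R.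
Proof.
move=> mX EX.
have gB k x : `|gamma_re k x| <= `|c| ^+ k * rising k.
  rewrite /gamma_re normrM normrM normrX (ger0_norm (rising_ge0 k)).
  by rewrite ler_piMr ?gamma_wave_le1// mulr_ge0 ?rising_ge0.
have [I le1] := even_moment_le n mX gamma_re_derive gB EX.
split=> //; rewrite (le_trans le1)// !exprMn -!mulrA.
apply: ler_pM => //; first by rewrite mulr_ge0 ?rising_ge0.
  by rewrite ler_eXn2l ?ltr1n// -addnn leq_addr.
by rewrite ler_wpM2l// rising_le.
Qed.
End gamma_charfn.

Section moment_growth.
Context (R : realType) d (T : measurableType d) (P : probability T R).

(** For nonnegative [S] this amounts to a finite exponential moment. The moment form is kept because
    it bounds Taylor coefficients and remainders directly. *)
Definition moment_growth (S : T -> R) := exists K D : R, [/\ 0 <= K, 0 < D &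
  forall n, L1 P (fun w => S w ^+ n) /\ \int[P]_w (S w ^+ n) <= K * D ^+ n * n`!%:R].

Lemma expr_sum_norm_le m (x : 'I_m -> R) n (i0 : 'I_m) :
  (\sum_j `|x j|) ^+ n <= m%:R ^+ n * \sum_j `|x j| ^+ n.
Proof.
have [i _ imax] := arg_maxP (fun j => `|x j|) (isT : xpredT i0).
rewrite (@le_trans _ _ ((m%:R * `|x i|) ^+ n))//.
  apply: lerXn2r; rewrite ?nnegrE ?sumr_ge0 ?mulr_ge0//.
  rewrite mulr_natl -[X in _ *+ X]card_ord -sumr_const.
  by apply: ler_sum => j _; exact: imax.
rewrite exprMn ler_wpM2l ?exprn_ge0// (bigD1 i)//= lerDl.
by apply: sumr_ge0 => j _; exact: exprn_ge0.
Qed.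

Lemma moment_growth_sum m (X : 'I_m -> T -> R) (A : R) (i0 : 'I_m) : 1 <= A ->
  (forall j, measurable_fun setT (X j)) ->
  (forall j n, L1 P (fun w => X j w ^+ n.*2) /\
     \int[P]_w (X j w ^+ n.*2) <= A ^+ n.*2 * n.*2`!%:R) ->
  moment_growth (fun w => \sum_j `|X j w|).
Proof.
move=> A1 mX XA; have A0 : 0 < A by exact: lt_le_trans A1.
pose S w := \sum_j `|X j w|.
have m0 : (0 < m)%N by case: (m) (i0) => // -[].
have m1 : 1 <= m%:R :> R by rewrite ler1n.
pose D := m%:R * A.
have D1 : 1 <= D by rewrite -[1]mulr1; apply: ler_pM.
have D0 : 0 < D by exact: lt_le_trans D1.
have S0 w : 0 <= S w by exact: sumr_ge0.
have mS : measurable_fun setT S.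
  by apply: measurable_sum => j; exact: measurableT_comp.
have even n : L1 P (fun w => S w ^+ n.*2) /\ \int[P]_w (S w ^+ n.*2) <= m%:R * D ^+ n.*2 * n.*2`!%:R.
  have nX j w : `|X j w| ^+ n.*2 = X j w ^+ n.*2.
    by rewrite -normrX ger0_norm// exprn_even_ge0// odd_double.
  have Sle w : S w ^+ n.*2 <= m%:R ^+ n.*2 * \sum_j X j w ^+ n.*2.
    rewrite (le_trans (expr_sum_norm_le _ _ i0))//.
    by under eq_bigr do rewrite nX.
  have IX : L1 P (fun w => m%:R ^+ n.*2 * \sum_j X j w ^+ n.*2).
    by apply: L1Zl; apply: L1_sum => j _; have [] := XA j n.
  have IS : L1 P (fun w => S w ^+ n.*2).
    apply: L1_le IX; first exact: measurable_funX.
    by move=> w; rewrite ger0_norm ?exprn_ge0.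
  split => //; apply: (@le_trans _ _ (\int[P]_w (m%:R ^+ n.*2 * \sum_j X j w ^+ n.*2))).
    by apply: le_Rintegral => // w _.
  rewrite RintegralZl//; last by apply: L1_sum => j _; have [] := XA j n.
  rewrite Rint_sum; last by move=> j _; have [] := XA j n.
  rewrite exprMn mulrCA -!mulrA ler_wpM2l ?exprn_ge0//.
  rewrite mulr_natl -[X in _ *+ X]card_ord -sumr_const.
  by apply: ler_sum => j _; have [] := XA j n.
(* In the odd case the extra factor 2k + 2 is at most 2^(2k+1), hence the rate 2D. The prefactor 4mD
   absorbs the rest: 4mD (2D)^(2k+1) contains 8mD^2, against 1 + D^2 (2k + 2)(2k + 1). *)
clearbody D; exists (4 * m%:R * D), (2 * D); split; first by rewrite !mulr_ge0// ltW.
  by rewrite mulr_gt0.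
move=> n; rewrite -(odd_double_half n); set k := n./2.
have [I1 le1] := even k; have [I2 le2] := even k.+1.
case: (odd n) => /=.
  rewrite add1n.
  (* Odd powers lie below the sum of the neighbouring even ones, since x <= 1 + x^2. *)
  have Sle w : `|S w ^+ k.*2.+1| <= S w ^+ k.*2 + S w ^+ k.+1.*2.
    rewrite ger0_norm ?exprn_ge0// doubleS !exprSr.
    have : 0 <= S w ^+ k.*2 by exact: exprn_ge0.
    have := S0 w; move: (S w) (S w ^+ k.*2) => x y x0 y0.
    have := mulr_ge0 y0 (sqr_ge0 (x - 1)); nra.
  have I12 := L1D I1 I2.
  have IS : L1 P (fun w => S w ^+ k.*2.+1).
    by apply: L1_le Sle I12; exact: measurable_funX.
  split => //; apply: (@le_trans _ _ (\int[P]_w (S w ^+ k.*2 + S w ^+ k.+1.*2))).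
    by apply: le_Rintegral => // w _; exact: le_trans (ler_norm _) (Sle w).
  rewrite RintegralD//; apply: (le_trans (lerD le1 le2)).
  rewrite doubleS !factS !natrM !exprS exprMn.
  have x0 : 0 <= D ^+ k.*2 by rewrite exprn_ge0// ltW.
  have f0 : 0 <= k.*2`!%:R :> R by [].
  have k2 : k.*2.+2%:R <= 2 * 2 ^+ k.*2 :> R.
    by rewrite -exprS -natrX ler_nat -doubleS -mul2n expnS leq_mul2l (leq_trans (ltn_expl k (ltnSn 1)))// leq_exp2l// -addnn leq_addr.
  have y1 : 1 <= 2 ^+ k.*2 :> R by rewrite exprn_ege1// ler1n.
  have z1 : 1 <= k.*2.+1%:R :> R by rewrite ler1n.
  have m0' : 0 <= m%:R :> R by [].
  move: (D ^+ k.*2) (k.*2`!%:R : R) (k.*2.+2%:R : R) (2 ^+ k.*2 : R) (k.*2.+1%:R : R) (m%:R : R) x0 f0 k2 y1 z1 m0'.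
  move=> x f p y z mm x0 f0 k2 y1 z1 m0'.
  have D2 : 1 <= D * D by rewrite -[1]mulr1; apply: ler_pM.
  have e1 : 1 + (D * D) * (p * z) <= 8 * ((D * D) * (y * z)).
    have yz : 1 <= y * z by rewrite -[1]mulr1; apply: ler_pM.
    have yzD : 1 <= (D * D) * (y * z) by rewrite -[1]mulr1; apply: ler_pM.
    have : (D * D) * (p * z) <= (D * D) * ((2 * y) * z).
      by rewrite ler_wpM2l ?ler_wpM2r// (le_trans ler01).
    by lra.
  have : mm * x * f * (1 + (D * D) * (p * z)) <= mm * x * f * (8 * ((D * D) * (y * z))).
    by rewrite ler_wpM2l// !mulr_ge0.
  by lra.
rewrite add0n; split => //; rewrite (le_trans le1)//.
rewrite ler_wpM2r// exprMn; apply: ler_pM => //; rewrite ?mulr_ge0 ?exprn_ge0 ?(ltW D0)//.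
  have : 0 <= m%:R * (D - 1) by rewrite mulr_ge0// subr_ge0.
  by nra.
by rewrite ler_peMl ?exprn_ge0 ?(ltW D0)// exprn_ege1// ler1n.
Qed.

End moment_growth.

(** * Analyticity in a parameter *)

Section taylor_cos.
Context (R : realType).
Implicit Types (f : R -> R) (x th : R).

Lemma is_derive_pow n (x : R) : is_derive x 1 (fun x => x ^+ n) (n%:R * x ^+ n.-1).
Proof.
have := is_derive_poly 'X^n x; rewrite derivXn hornerMn hornerXn mulr_natl.
rewrite (_ : horner _ = fun x => x ^+ n)//.
by apply/funext => y; rewrite hornerXn.
Qed.

(** For x >= 0 the difference x^(n+1)/(n+1)! - g(x) vanishes at 0 and has nonnegative derivative.
    The lower bound follows by passing to -g, negative x by reflection. *)
Lemma norm_le_pow_of_derive f f' n :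
  f 0 = 0 -> (forall x : R, is_derive x 1 f (f' x)) ->
  (forall x, `|f' x| <= `|x| ^+ n / n`!%:R) ->
  forall x, `|f x| <= `|x| ^+ n.+1 / n.+1`!%:R.
Proof.
have pos (g g' : R -> R) : g 0 = 0 -> (forall x : R, is_derive x 1 g (g' x)) ->
    (forall x, `|g' x| <= `|x| ^+ n / n`!%:R) ->
    forall x, 0 <= x -> g x <= x ^+ n.+1 / n.+1`!%:R.
  move=> g0 dg gb x x0.
  pose k x := n.+1`!%:R^-1 * x ^+ n.+1 - g x.
  have f0 : n.+1`!%:R != 0 :> R by rewrite pnatr_eq0 -lt0n fact_gt0.
  have f0' : n`!%:R != 0 :> R by rewrite pnatr_eq0 -lt0n fact_gt0.
  have dk (y : R) : is_derive y 1 k (y ^+ n / n`!%:R - g' y).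
    apply: is_derive_eq (is_deriveB (is_deriveZ _ (is_derive_pow n.+1 y)) (dg y)) _.
    rewrite /GRing.scale/=; congr (_ - _); rewrite factS natrM.
    by rewrite invfM mulrACA mulVf ?pnatr_eq0// mul1r mulrC.
  have ck := is_derive_continuous dk.
  have [c /[!in_itv]/= /andP[c0 cx] E] :=
    @MVT_segment _ k _ 0 x x0 (fun y _ => dk y) (continuous_subspaceT ck).
  rewrite -subr_ge0 mulrC -/(k x).
  have k0 : k 0 = 0 by rewrite /k expr0n/= mulr0 g0 subrr.
  have -> : k x = (c ^+ n / n`!%:R - g' c) * (x - 0) by rewrite -E k0 subr0.
  rewrite subr0 mulr_ge0// subr_ge0 (le_trans (ler_norm _))// (le_trans (gb c))//.
  by rewrite ger0_norm.
move=> f0 df fb.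
have half (g g' : R -> R) : g 0 = 0 -> (forall x : R, is_derive x 1 g (g' x)) ->
    (forall x, `|g' x| <= `|x| ^+ n / n`!%:R) ->
    forall x, 0 <= x -> `|g x| <= x ^+ n.+1 / n.+1`!%:R.
  move=> g0 dg gb x x0; rewrite ler_norml (pos g g')// andbT lerNl.
  apply: (pos (fun x => - g x) (fun x => - g' x)) => //; first by rewrite g0 oppr0.
  by move=> y; rewrite normrN.
move=> x; have [x0|/ltW x0] := leP 0 x.
  by rewrite [in leRHS]ger0_norm//; exact: (half f f').
rewrite [in leRHS]ler0_norm// -[x in `|f x|]opprK.
apply: (half (fun x => f (- x)) (fun x => - f' (- x))); last by rewrite oppr_ge0.
- by rewrite oppr0.
- move=> y; have h1 : is_derive y (1:R) (fun y => - y) (-1) by exact: is_deriveNid.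
  by have := @is_derive1_comp _ f _ y _ _ (df _) h1; rewrite mulrN1.
- by move=> y; rewrite normrN -(normrN y).
Qed.

(** The derivative of the remainder of order n + 1 at phase [th] is the remainder of order n at
    phase th + pi/2; hence the induction over all phases. *)
Lemma taylor_cos n th x :
  `|cos (th + x) - \sum_(k < n) x ^+ k / k`!%:R * cos (th + quarter R k)| <=
  `|x| ^+ n / n`!%:R.
Proof.
elim: n th x => [|n IH] th x.
  by rewrite big_ord0 subr0 expr0 fact0 divr1 normr_cos_le1.
pose f x := cos (th + x) - \sum_(k < n.+1) x ^+ k / k`!%:R * cos (th + quarter R k).
pose f' x := cos (th + pi / 2 + x) - \sum_(k < n) x ^+ k / k`!%:R * cos (th + pi / 2 + quarter R k).
apply: (@norm_le_pow_of_derive f f' n).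
- rewrite /f addr0 big_ord_recl expr0 fact0 divr1 mul1r /quarter mul0r addr0 big1 ?addr0 ?subrr//.
  by move=> k _; rewrite expr0n/= mul0r mul0r.
- move=> y.
  have h (k : 'I_n) : is_derive y (1:R) (fun y => y ^+ k.+1 / k.+1`!%:R * cos (th + quarter R k.+1))
     (y ^+ k / k`!%:R * cos (th + pi / 2 + quarter R k)).
    have f0 : k`!%:R != 0 :> R by rewrite pnatr_eq0 -lt0n fact_gt0.
    have hp := is_derive_pow k.+1 y.
    apply: is_derive_eq; rewrite /GRing.scale/=.
    have -> : th + quarter R k.+1 = th + pi / 2 + quarter R k.
      by rewrite /quarter -natr1; ring.
    have : k.+1%:R != 0 :> R by rewrite pnatr_eq0.
    rewrite factS natrM; move: (k.+1%:R : R) => N N0.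
    by field; rewrite N0 f0.
  have hs := is_derive_sum h.
  have h2 := @is_derive_shift _ cos _ th (@is_derive_cos R) y.
  have -> : f = (fun y => cos (y + th)) - (cst (cos th) +
      \sum_(k < n) (fun y : R => y ^+ k.+1 / k.+1`!%:R * cos (th + quarter R k.+1))).
    apply/funext => z; rewrite /f big_ord_recl expr0 fact0 divr1 mul1r {1}/quarter mul0r addr0.
    by rewrite [th + z]addrC !fctE; congr (_ - (_ + _)); rewrite fct_sumE.
  apply: (is_derive_eq (is_deriveB h2 (is_deriveD (is_derive_cst _ _ _) hs))).
  rewrite /f' add0r; congr (_ - _).
  by rewrite addrAC cosD cos_pihalf sin_pihalf mulr0 mulr1 sub0r (addrC th).
- by move=> y; exact: IH.
Qed.

End taylor_cos.

(** * Power series with one radius at every point *)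

Section uniformly_analytic.
Context (R : realType) (rho : R).
Hypothesis rho0 : 0 < rho.
Implicit Types (h : R -> R).

(** [rho] is the same at every b, which allows continuation by steps of fixed length. The bound [K],
    which may depend on b, controls the tails of the series by a geometric one. *)
Definition uanalytic h := forall b, exists c : nat -> R, exists K : R,
  (forall n, `|c n| * rho ^+ n <= K) /\
  forall e, `|e| < rho -> \sum_(k < n) c k * e ^+ k @[n --> \oo] --> h (b + e).

Lemma uanalyticD h1 h2 : uanalytic h1 -> uanalytic h2 -> uanalytic (fun b => h1 b + h2 b).
Proof.
move=> a1 a2 b; have [c1 [K1 [H1 E1]]] := a1 b; have [c2 [K2 [H2 E2]]] := a2 b.
exists (fun n => c1 n + c2 n), (K1 + K2); split=> [n|e er].
  rewrite (le_trans _ (lerD (H1 n) (H2 n)))// -mulrDl ler_wpM2r ?exprn_ge0 ?(ltW rho0)//.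
  exact: ler_normD.
rewrite (_ : (fun n => _) = fun n => \sum_(k < n) c1 k * e ^+ k + \sum_(k < n) c2 k * e ^+ k).
  exact: cvgD (E1 e er) (E2 e er).
by apply/funext => n; rewrite -big_split; apply: eq_bigr => k _; rewrite mulrDl.
Qed.

Lemma uanalyticZ a h : uanalytic h -> uanalytic (fun b => a * h b).
Proof.
move=> a1 b; have [c1 [K1 [H1 E1]]] := a1 b.
exists (fun n => a * c1 n), (`|a| * K1); split=> [n|e er].
  by rewrite normrM -mulrA ler_wpM2l.
rewrite (_ : (fun n => _) = fun n => a * \sum_(k < n) c1 k * e ^+ k).
  by apply: cvgM; [exact: cvg_cst|exact: E1].
by apply/funext => n; rewrite mulr_sumr; apply: eq_bigr => k _; rewrite mulrA.
Qed.

Lemma uanalytic_mulid h : uanalytic h -> uanalytic (fun b => b * h b).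
Proof.
move=> a1 b; have [c [K [H E]]] := a1 b.
(* Multiplying the series by b + e gives the coefficients b c_n + c_(n-1); [c'] is the shifted
   sequence. *)
pose c' n := if n is m.+1 then c m else 0.
have ext (u v : nat -> R) : u =1 v -> u = v by move=> uv; exact/funext.
have H' n : `|c' n| * rho ^+ n <= rho * K.
  case: n => [|n] /=; last by rewrite exprS mulrCA ler_wpM2l// ltW.
  by rewrite normr0 mul0r mulr_ge0 ?(ltW rho0)// (le_trans _ (H 0%N))// mulr_ge0 ?exprn_ge0 ?(ltW rho0).
exists (fun n => b * c n + c' n), (`|b| * K + rho * K); split=> [n|e er].
  rewrite (@le_trans _ _ (`|b| * (`|c n| * rho ^+ n) + `|c' n| * rho ^+ n))//.
    rewrite mulrA -normrM -mulrDl ler_wpM2r ?exprn_ge0 ?(ltW rho0)//; exact: ler_normD.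
  by rewrite lerD// ler_wpM2l.
rewrite mulrDl; rewrite (_ : (fun n => _) = fun n => b * (\sum_(k < n) c k * e ^+ k) +
    \sum_(k < n) c' k * e ^+ k); last first.
  apply: ext => n; rewrite mulr_sumr -big_split; apply: eq_bigr => k _ /=.
  by rewrite mulrDl mulrA.
apply: cvgD; first by apply: cvgM; [exact: cvg_cst|exact: E].
rewrite -(cvg_shiftS (fun n => \sum_(k < n) c' k * e ^+ k)) /=.
rewrite (_ : (fun n => _) = fun n => e * \sum_(k < n) c k * e ^+ k).
  by apply: cvgM; [exact: cvg_cst|exact: E].
apply: ext => n; rewrite big_ord_recl /= mul0r add0r mulr_sumr.
by apply: eq_bigr => k _; rewrite exprS mulrCA.
Qed.

Lemma uanalytic_poly (q : {poly R}) h : uanalytic h -> uanalytic (fun b => q.[b] * h b).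
Proof.
move=> ha; elim/poly_ind: q => [|q a IH].
  rewrite (_ : (fun b => _) = fun b => 0 * h b); first exact: uanalyticZ.
  by apply/funext => b; rewrite horner0.
rewrite (_ : (fun b => _) = fun b => b * (q.[b] * h b) + a * h b).
  by apply: uanalyticD; [exact: uanalytic_mulid|exact: uanalyticZ].
by apply/funext => b; rewrite hornerMXaddC; ring.
Qed.

(* Vanishing on a half-line propagates: all Taylor coefficients at its endpoint
   are zero, so the function vanishes on a further interval of length rho. *)
Lemma uanalytic_eq0 h b0 : uanalytic h -> (forall b, b0 <= b -> h b = 0) ->
  forall b, h b = 0.
Proof.
move=> ha h0.
have step b1 : (forall b, b1 <= b -> h b = 0) -> forall b, b1 - rho / 2 <= b -> h b = 0.
  move=> hb1 b bb; have [c [K [H E]]] := ha b1.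
  have K0 : 0 <= K by rewrite (le_trans _ (H 0%N))// mulr_ge0 ?exprn_ge0 ?(ltW rho0).
  (* If the earlier coefficients vanish, then 0 = h(b1 + e) = c_n e^n + O(e^(n+1)) for small e > 0,
     so |c_n| is O(e) and must be 0. *)
  have c0 n : c n = 0.
    elim/ltn_ind: n => n IH.
    have bnd e : 0 < e -> e <= rho / 2 -> `|c n| <= 2 * K / rho ^+ n.+1 * e.
      move=> e0 er.
      have er' : `|e| < rho by rewrite gtr0_norm//; lra.
      have := E e er'; rewrite hb1; last by rewrite lerDl ltW.
      move=> cv.
      pose t := e / rho.
      have t0 : 0 < t by rewrite divr_gt0.
      have t2 : t <= 2^-1 by rewrite ler_pdivrMr// mulrC; lra.
      have tail m : `|\sum_(k < n.+1 + m) c k * e ^+ k - c n * e ^+ n| <= 2 * K * t ^+ n.+1.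
        rewrite big_split_ord /= big_ord_recr /= big1; last by move=> k _; rewrite IH// mul0r.
        rewrite add0r addrAC subrr add0r.
        (* With e <= rho/2 the tail is dominated by a geometric series of ratio 1/2. Its exact
           partial sums 2 - 2 (1/2)^m make the induction go through. *)
        have : `|\sum_(i < m) c (n.+1 + i)%N * e ^+ (n.+1 + i)| <= K * t ^+ n.+1 * (2 - 2 * 2^-1 ^+ m).
          elim: m => [|m IHm]; first by rewrite big_ord0 normr0 expr0 mulr1 subrr mulr0.
          rewrite big_ord_recr /= (le_trans (ler_normD _ _))//.
          have -> : K * t ^+ n.+1 * (2 - 2 * 2^-1 ^+ m.+1) =
             K * t ^+ n.+1 * (2 - 2 * 2^-1 ^+ m) + K * t ^+ n.+1 * 2^-1 ^+ m.
            by rewrite [2^-1 ^+ _]exprS; move: (t ^+ n.+1) (2^-1 ^+ m : R) => u v; field.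
          apply: lerD => //.
          rewrite normrM normrX (gtr0_norm e0).
          have -> : e = rho * t by rewrite /t mulrCA divff ?mulr1// gt_eqF.
          rewrite exprMn mulrA -[leRHS]mulrA; apply: ler_pM => //.
          - by rewrite mulr_ge0// exprn_ge0// ltW.
          - by rewrite exprn_ge0// ltW.
          - rewrite exprD ler_wpM2l ?exprn_ge0 ?(ltW t0)//.
            by rewrite lerXn2r ?nnegrE ?invr_ge0// ltW.
        move=> hh; rewrite (le_trans hh)// -mulrA mulrC -mulrA.
        have h2 : 0 <= K * t ^+ n.+1 by rewrite mulr_ge0// exprn_ge0// ltW.
        have h3 : 0 <= (2^-1 : R) ^+ m by rewrite exprn_ge0.
        by nra.
      have lim : `|0 - c n * e ^+ n| <= 2 * K * t ^+ n.+1.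
        have cv' : `|\sum_(k < n.+1 + m) c k * e ^+ k - c n * e ^+ n| @[m --> \oo] --> `|0 - c n * e ^+ n|.
          apply: cvg_norm; apply: cvgB; last exact: cvg_cst.
          have := cv; rewrite -(cvg_shiftn n.+1 (fun N => \sum_(k < N) c k * e ^+ k)).
          by under eq_fun do rewrite addnC.
        have : limn (fun m => `|\sum_(k < n.+1 + m) c k * e ^+ k - c n * e ^+ n|) <= 2 * K * t ^+ n.+1.
          by apply: limr_le; [apply/cvg_ex; eexists; exact: cv'|exact: nearW].
        by rewrite (cvg_lim _ cv').
      move: lim; rewrite sub0r normrN normrM normrX (gtr0_norm e0) /t expr_div_n => lim.
      rewrite -(ler_pM2r (exprn_gt0 n e0)) (le_trans lim)// le_eqVlt; apply/orP; left; apply/eqP.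
      by rewrite [e ^+ n.+1]exprS; move: (rho ^+ n.+1)^-1 => r; ring.
    apply/eqP; rewrite -normr_le0; apply/ler_addgt0Pl => ep ep0; rewrite addr0.
    pose A := 2 * K / rho ^+ n.+1.
    have A0 : 0 <= A by rewrite divr_ge0 ?exprn_ge0 ?mulr_ge0// ltW.
    pose e := Num.min (rho / 2) (ep / (A + 1)).
    have A1 : 0 < A + 1 by rewrite ltr_wpDl.
    have e0 : 0 < e by rewrite lt_min !divr_gt0.
    have e1 : e <= rho / 2 by rewrite ge_min lexx.
    rewrite (le_trans (bnd e e0 e1))// -/A.
    have e2 : e <= ep / (A + 1) by rewrite ge_min lexx orbT.
    rewrite (@le_trans _ _ (A * (ep / (A + 1))))// ?ler_wpM2l//.
    by rewrite mulrA ler_pdivrMr// mulrC ler_wpM2l ?(ltW ep0)// lerDl.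
  have [bge|blt] := leP b1 b; first exact: hb1.
  have er : `|b - b1| < rho.
    by rewrite ltr0_norm ?subr_lt0//; have := rho0; lra.
  have := E _ er; rewrite (addrC b1) subrK => cv.
  apply: (cvg_unique (@norm_hausdorff _ R^o) cv).
  rewrite (_ : (fun n => _) = cst 0); first exact: cvg_cst.
  by apply/funext => n; rewrite big1// => k _; rewrite c0 mul0r.
have iterstep n : forall b, b0 - n%:R * (rho / 2) <= b -> h b = 0.
  elim: n => [|n IH] b; first by rewrite mul0r subr0; exact: h0.
  move=> bb; apply: (step _ IH); rewrite (le_trans _ bb)//.
  by rewrite -natr1 le_eqVlt; apply/orP; left; apply/eqP; ring.
move=> b; apply: (iterstep (Num.bound ((b0 - b) / (rho / 2)))).
rewrite lerBlDr -lerBlDl -ler_pdivrMr ?divr_gt0//.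
by rewrite ltW// unstable.ltr_bound.
Qed.

End uniformly_analytic.

Section analytic_integrals.
Context (R : realType) d (T : measurableType d) (P : probability T R).
Variables (S : T -> R) (K D : R).
Hypotheses (mS : measurable_fun setT S) (S0 : forall w, 0 <= S w) (K0 : 0 <= K) (D0 : 0 < D).
Hypothesis SP : forall n, L1 P (fun w => S w ^+ n) /\ \int[P]_w (S w ^+ n) <= K * D ^+ n * n`!%:R.

(** This is (1 + S) S^n, the majorant of Z X^n up to the factor a when |X| <= S and |Z| <= a(1 +
    S). *)
Let SS n := fun w => S w ^+ n + S w ^+ n.+1.

Lemma L1_pow_pair n : L1 P (SS n).
Proof. by apply: L1D; [exact: (SP n).1|exact: (SP n.+1).1]. Qed.

(** The factor n + 1 of (n + 1)! is absorbed by 2^n. This is the origin of the radius (2D)^-1. *)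
Lemma Rint_pow_pair n : \int[P]_w SS n w <= (K * (1 + D)) * (2 * D) ^+ n * n`!%:R.
Proof.
have [I1 l1] := SP n; have [I2 l2] := SP n.+1.
rewrite RintegralD//; apply: (le_trans (lerD l1 l2)).
rewrite factS natrM exprMn [D ^+ n.+1]exprS.
have d0 : 0 <= D ^+ n by rewrite exprn_ge0// ltW.
have f0 : 0 <= n`!%:R :> R by [].
have n1 : n.+1%:R <= 2 ^+ n :> R by rewrite -natrX ler_nat ltn_expl.
have y1 : 1 <= 2 ^+ n :> R by rewrite exprn_ege1// ler1n.
move: (D ^+ n) (n`!%:R : R) (n.+1%:R : R) (2 ^+ n : R) d0 f0 n1 y1 => x f m y d0 f0 n1 y1.
have h : 1 + D * m <= (1 + D) * y.
  by rewrite mulrDl mul1r lerD// ler_wpM2l// ltW.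
have : K * x * f * (1 + D * m) <= K * x * f * ((1 + D) * y).
  by rewrite ler_wpM2l// !mulr_ge0.
by lra.
Qed.

(** Taylor's formula for the cosine is integrated at finite order: the remainder is at most K'
    (2D|e|)^n, with K' independent of b, so no infinite sum is exchanged with the integral. *)
Lemma uanalytic_Icos (X Y Z : T -> R) (a : R) : measurable_fun setT X ->
  measurable_fun setT Y -> measurable_fun setT Z ->
  (forall w, `|X w| <= S w) -> (forall w, `|Z w| <= a * (1 + S w)) -> 0 <= a ->
  uanalytic (2 * D)^-1 (fun b => Icos P Z (fun w => b * X w + Y w)).
Proof.
move=> mX mY mZ XS ZS a0 b.
have ZXle n w : `|Z w * X w ^+ n| <= a * SS n w.
  rewrite normrM normrX.
  apply: (le_trans (ler_pM _ _ (ZS w) (lerXn2r n _ _ (XS w)))); rewrite ?nnegrE ?exprn_ge0//.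
  by rewrite /SS exprS -mulrA mulrDl mul1r.
have mZX n : measurable_fun setT (fun w => Z w * X w ^+ n).
  by apply: measurable_funM => //; exact: measurable_funX.
have IaS n : L1 P (fun w => a * SS n w) by apply: L1Zl; exact: L1_pow_pair.
have IZX n : L1 P (fun w => Z w * X w ^+ n) by exact: L1_le (mZX n) (ZXle n) (IaS n).
have mb c t : measurable_fun setT (fun w => t * X w + Y w + c).
  by apply: measurable_funD => //; apply: measurable_funD => //; exact: measurable_funM.
pose K' := a * (K * (1 + D)).
have K'0 : 0 <= K' by rewrite !mulr_ge0// addr_ge0// ltW.
have aSle n : \int[P]_w (a * SS n w) <= K' * (2 * D) ^+ n * n`!%:R.
  rewrite RintegralZl//; last exact: L1_pow_pair.
  by rewrite /K' -!mulrA ler_wpM2l// !mulrA Rint_pow_pair.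
have D20 : 0 < 2 * D by rewrite mulr_gt0.
pose c k := k`!%:R^-1 * Icos P (fun w => Z w * X w ^+ k) (fun w => b * X w + Y w + quarter R k).
exists c, K'; split=> [n|e er].
  have fn0 : 0 < n`!%:R :> R by rewrite ltr0n fact_gt0.
  rewrite /c normrM (ger0_norm (_ : 0 <= _^-1)) ?invr_ge0 ?(ltW fn0)//.
  have Ic := L1_cos (IZX n) (mb (quarter R n) b).
  have le1 : `|Icos P (fun w => Z w * X w ^+ n) (fun w => b * X w + Y w + quarter R n)| <= K' * (2 * D) ^+ n * n`!%:R.
    rewrite (le_trans _ (aSle n))// (le_trans (Rint_norm_le Ic))//.
    apply: le_Rintegral => //; [exact: L1_norm|exact: IaS|].
    move=> w _; rewrite normrM (le_trans _ (ZXle n w))//.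
    by rewrite ler_piMr// normr_cos_le1.
  rewrite exprVn -mulrA mulrCA.
  rewrite (le_trans (ler_wpM2r _ le1))//; first by rewrite mulr_ge0 ?invr_ge0 ?exprn_ge0 ?(ltW fn0) ?(ltW D20).
  rewrite le_eqVlt; apply/orP; left; apply/eqP.
  have x0 : (2 * D) ^+ n != 0 by rewrite expf_neq0// gt_eqF.
  have f0 : n`!%:R != 0 :> R by rewrite gt_eqF.
  by move: ((2 * D) ^+ n) (n`!%:R : R) x0 f0 => x f x0 f0; field; rewrite x0 f0.
have partial n : \sum_(k < n) c k * e ^+ k =
    \int[P]_w (Z w * \sum_(k < n) (e * X w) ^+ k / k`!%:R * cos (b * X w + Y w + quarter R k)).
  transitivity (\sum_(k < n) \int[P]_w (e ^+ k / k`!%:R * (Z w * X w ^+ k * cos (b * X w + Y w + quarter R k)))).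
    apply: eq_bigr => k _; rewrite RintegralZl//; last exact: L1_cos.
    by rewrite /c /Icos; ring.
  rewrite -Rint_sum; last by move=> k _; apply: L1Zl; exact: L1_cos.
  apply: eq_Rintegral => w _; rewrite mulr_sumr; apply: eq_bigr => k _.
  by rewrite exprMn; ring.
have mZe : L1 P (fun w => Z w * cos ((b + e) * X w + Y w)).
  apply: L1_cos; first by have := IZX 0%N; under eq_fun do rewrite expr0 mulr1.
  by apply: measurable_funD => //; exact: measurable_funM.
have IP n : L1 P (fun w => Z w * \sum_(k < n) (e * X w) ^+ k / k`!%:R * cos (b * X w + Y w + quarter R k)).
  rewrite (_ : (fun w => _) = fun w => \sum_(k < n) (e ^+ k / k`!%:R * (Z w * X w ^+ k * cos (b * X w + Y w + quarter R k)))).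
    by apply: L1_sum => k _; apply: L1Zl; exact: L1_cos.
  apply/funext => w; rewrite mulr_sumr; apply: eq_bigr => k _.
  by rewrite exprMn; ring.
apply/cvgrPdist_le => eps eps0.
have bnd n : `|\sum_(k < n) c k * e ^+ k - Icos P Z (fun w => (b + e) * X w + Y w)| <= K' * (2 * D * `|e|) ^+ n.
  rewrite partial /Icos -RintegralB; [|by []|exact: IP|exact: mZe].
  rewrite (le_trans (Rint_norm_le (L1B (IP n) mZe)))//.
  apply: (@le_trans _ _ (\int[P]_w (`|e| ^+ n / n`!%:R * (a * SS n w)))).
    apply: le_Rintegral => //; [by apply: L1_norm; exact: L1B|by apply: L1Zl; exact: IaS|].
    move=> w _; rewrite distrC -mulrBr.
    rewrite normrM.
    have := taylor_cos n (b * X w + Y w) (e * X w).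
    have -> : b * X w + Y w + e * X w = (b + e) * X w + Y w by ring.
    move=> tc; rewrite (le_trans (ler_wpM2l _ tc))//.
    have -> : `|Z w| * (`|e * X w| ^+ n / n`!%:R) = `|e| ^+ n / n`!%:R * `|Z w * X w ^+ n|.
      by rewrite !normrM exprMn normrX; ring.
    by rewrite ler_wpM2l// divr_ge0// exprn_ge0.
  rewrite RintegralZl//; last exact: IaS.
  apply: (le_trans (ler_wpM2l _ (aSle n))).
    by rewrite divr_ge0// exprn_ge0.
  rewrite le_eqVlt; apply/orP; left; apply/eqP.
  have f0 : n`!%:R != 0 :> R by rewrite gt_eqF// ltr0n fact_gt0.
  rewrite [in RHS]exprMn; move: ((2 * D) ^+ n) (`|e| ^+ n) (n`!%:R : R) f0 => x y f f0.
  by field.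
have q1 : `|2 * D * `|e| | < 1.
  rewrite ger0_norm ?mulr_ge0 ?(ltW D0)// mulrC -ltr_pdivlMr//.
  by rewrite div1r.
have cq : K' * (2 * D * `|e|) ^+ n @[n --> \oo] --> 0.
  by rewrite -[X in _ --> X](mulr0 K'); apply: cvgM; [exact: cvg_cst|exact: cvg_expr].
have /cvgr0_norm_le /(_ _ eps0) := cq.
apply: filterS => n hn; rewrite distrC (le_trans (bnd n))// (le_trans _ hn)//.
exact: ler_norm.
Qed.

End analytic_integrals.

(** * Multivariate gamma vectors *)

Section logarithm.
Context (R : realType).

(* Near s the argument is recovered from the cartesian coordinates as
   l2 s + atan, the continuity of l2 keeping it on that branch. *)
Lemma is_derive_log (l1 l2 u v : R -> R) (s u' v' : R) :
  (\near s, expR (l1 s) * cos (l2 s) = u s /\ expR (l1 s) * sin (l2 s) = v s) ->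
  l2 t @[t --> s] --> l2 s -> is_derive s 1 u u' -> is_derive s 1 v v' ->
  is_derive s 1 l1 ((u s * u' + v s * v') / (u s ^+ 2 + v s ^+ 2)) /\
  is_derive s 1 l2 ((u s * v' - v s * u') / (u s ^+ 2 + v s ^+ 2)).
Proof.
move=> uv cl du dv.
have [us vs] := nbhs_singleton uv.
have mE t : expR (l1 t) * cos (l2 t) = u t /\ expR (l1 t) * sin (l2 t) = v t ->
    u t ^+ 2 + v t ^+ 2 = expR (l1 t) ^+ 2.
  by move=> [<- <-]; rewrite !exprMn -mulrDr cos2Dsin2 mulr1.
have m0 : 0 < u s ^+ 2 + v s ^+ 2 by rewrite mE// exprn_gt0// expR_gt0.
have dm : is_derive s 1 (fun t => u t ^+ 2 + v t ^+ 2) (2 * (u s * u' + v s * v')).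
  by apply: is_derive_eq; rewrite /GRing.scale/= ?expr1; ring.
split.
  have hl := @is_derive1_comp _ _ _ s _ _ (is_derive1_ln m0) dm.
  apply: (@near_eq_is_derive _ _ _ (fun t => 2^-1 * ln (u t ^+ 2 + v t ^+ 2))).
    near=> t; rewrite mE; last by near: t.
    by rewrite -expRM_natl expRK mulrA mulVf ?mul1r.
  apply: (is_derive_eq (is_deriveZ _ hl)); rewrite /GRing.scale/=.
  by field; rewrite gt_eqF.
(* With z = u + iv, numerator and denominator are the imaginary and real parts of z(t) times the
   conjugate of z(s), so g(t) is the tangent of l2 t - l2 s. *)
pose g t := (v t * u s - u t * v s) / (u t * u s + v t * v s).
have dn0 : u s * u s + v s * v s != 0 by rewrite -!expr2 gt_eqF.
have dg : is_derive s 1 g ((u s * v' - v s * u') / (u s ^+ 2 + v s ^+ 2)).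
  have d1 : is_derive s 1 (fun t => v t * u s - u t * v s) (v' * u s - u' * v s).
    by apply: is_derive_eq; rewrite /GRing.scale/=; ring.
  have d2 : is_derive s 1 (fun t => u t * u s + v t * v s) (u' * u s + v' * v s).
    by apply: is_derive_eq; rewrite /GRing.scale/=; ring.
  have d3 := @is_deriveV _ (fun t => u t * u s + v t * v s) s _ _ dn0 d2.
  apply: (is_derive_eq (is_deriveM d1 d3)); rewrite /GRing.scale/=.
  by field; rewrite dn0.
have ha := @is_derive1_comp _ _ _ s _ _ (is_derive1_atan (g s)) dg.
apply: (@near_eq_is_derive _ _ _ (fun t => l2 s + atan (g t))).
  near=> t.
  have [ut vt] : expR (l1 t) * cos (l2 t) = u t /\ expR (l1 t) * sin (l2 t) = v t by near: t.
  have lt : `|l2 s - l2 t| < pi / 2.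
    by near: t; apply: cvgr_dist_lt => //; rewrite divr_gt0// pi_gt0.
  have tn : tan (l2 t - l2 s) = g t.
    rewrite /tan /g sinB cosB -ut -vt -us -vs.
    have c0 : cos (l2 t - l2 s) != 0.
      by rewrite gt_eqF// cos_gt0_pihalf// -ltr_norml distrC.
    have e1 : expR (l1 t) != 0 by rewrite gt_eqF// expR_gt0.
    have e2 : expR (l1 s) != 0 by rewrite gt_eqF// expR_gt0.
    move: c0; rewrite cosB; move: (expR (l1 t)) (expR (l1 s)) e1 e2 => a b a0 b0 c0.
    have -> : a * cos (l2 t) * (b * cos (l2 s)) + a * sin (l2 t) * (b * sin (l2 s)) =
      a * b * (cos (l2 t) * cos (l2 s) + sin (l2 t) * sin (l2 s)) by ring.
    by field; rewrite a0 b0 c0.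
  rewrite -tn tanK; first by rewrite addrC subrK.
  by rewrite in_itv/= -ltr_norml distrC.
apply: (is_derive_eq (is_deriveD (is_derive_cst _ _ _) ha)).
rewrite add0r (_ : g s = 0); first by rewrite expr0n/= addr0 invr1 mul1r.
by rewrite /g [v s * u s]mulrC subrr mul0r.
Unshelve. all: by end_near. Qed.

(** With z = u + iv and w = A + iB = z^(-alpha), these are the real and imaginary parts of z w' +
    alpha z' w = 0. The logarithm has disappeared from the conclusion. *)
Lemma log_power_ode (alpha : R) (l1 l2 u v A B : R -> R) (s u' v' A' B' : R) :
  (\near s, expR (l1 s) * cos (l2 s) = u s /\ expR (l1 s) * sin (l2 s) = v s) ->
  (\near s, A s = expR (- (alpha * l1 s)) * cos (alpha * l2 s) /\
            B s = - (expR (- (alpha * l1 s)) * sin (alpha * l2 s))) ->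
  l2 t @[t --> s] --> l2 s -> is_derive s 1 u u' -> is_derive s 1 v v' ->
  is_derive s 1 A A' -> is_derive s 1 B B' ->
  u s * A' - v s * B' + alpha * (u' * A s - v' * B s) = 0 /\
  u s * B' + v s * A' + alpha * (u' * B s + v' * A s) = 0.
Proof.
move=> uv AB cl du dv dA dB.
have [us vs] := nbhs_singleton uv.
have [As Bs] := nbhs_singleton AB.
have [d1 d2] := is_derive_log uv cl du dv.
have m0 : u s ^+ 2 + v s ^+ 2 != 0.
  by rewrite -us -vs !exprMn -mulrDr cos2Dsin2 mulr1 expf_neq0// gt_eqF// expR_gt0.
set m := u s ^+ 2 + v s ^+ 2 in m0 d1 d2.
set p1 := _ / m in d1; set p2 := _ / m in d2.
have e1 := @is_derive1_comp _ expR (fun t => - (alpha * l1 t)) s _ _ (is_derive_expR _) (is_deriveN (is_deriveZ alpha d1)).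
have e2 := @is_derive1_comp _ cos (fun t => alpha * l2 t) s _ _ (is_derive_cos _) (is_deriveZ alpha d2).
have e3 := @is_derive1_comp _ sin (fun t => alpha * l2 t) s _ _ (is_derive_sin _) (is_deriveZ alpha d2).
have EA : A' = - alpha * p1 * A s + alpha * p2 * B s.
  have [_ <-] := dA.
  have h : is_derive s 1 A (- alpha * p1 * A s + alpha * p2 * B s).
    apply: (@near_eq_is_derive _ _ _ (fun t => expR (- (alpha * l1 t)) * cos (alpha * l2 t))).
      by near=> t; have [] : A t = expR (- (alpha * l1 t)) * cos (alpha * l2 t) /\
            B t = - (expR (- (alpha * l1 t)) * sin (alpha * l2 t)) by near: t.
    by apply: (is_derive_eq (is_deriveM e1 e2)); rewrite As Bs /GRing.scale/=; ring.
  by have [_ ->] := h.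
have EB : B' = - alpha * p1 * B s - alpha * p2 * A s.
  have [_ <-] := dB.
  have h : is_derive s 1 B (- alpha * p1 * B s - alpha * p2 * A s).
    apply: (@near_eq_is_derive _ _ _ (fun t => - (expR (- (alpha * l1 t)) * sin (alpha * l2 t)))).
      by near=> t; have [] : A t = expR (- (alpha * l1 t)) * cos (alpha * l2 t) /\
            B t = - (expR (- (alpha * l1 t)) * sin (alpha * l2 t)) by near: t.
    by apply: (is_derive_eq (is_deriveN (is_deriveM e1 e3))); rewrite As Bs /GRing.scale/=; ring.
  by have [_ ->] := h.
rewrite EA EB /p1 /p2 /m; move: m0; rewrite /m.
move: (u s) (v s) (A s) (B s) => x y a b m0.
by split; field.
Unshelve. all: by end_near. Qed.

(** Identifies the branch of the logarithm on a coordinate axis. As e^(l1) cos(l2) = 1, the cosine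
    never vanishes, so by the intermediate value theorem l2 starts at 0 and stays within ]-pi/2,
    pi/2[, where its tangent -ct determines it. *)
Lemma arg_continuous_unique (l1 l2 : R -> R) (c : R) :
  {within [set t | 0 <= t], continuous l2} -> l2 0 = 0 ->
  (forall t, 0 <= t -> expR (l1 t) * cos (l2 t) = 1 /\ expR (l1 t) * sin (l2 t) = - (c * t)) ->
  forall t, 0 <= t -> l1 t = - ln (cos (atan (c * t))) /\ l2 t = - atan (c * t).
Proof.
move=> cl l0 H.
have cosn t : 0 <= t -> cos (l2 t) != 0.
  by move=> t0; have [h _] := H t t0; apply/eqP => c0; move: h; rewrite c0 mulr0 => /eqP; rewrite eq_sym oner_eq0.
have ph0 : 0 < pi / 2 :> R by rewrite divr_gt0// pi_gt0.
have bnd t : 0 <= t -> `|l2 t| < pi / 2.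
  move=> t0; rewrite ltNge; apply/negP => h.
  have sub : {within `[0, t], continuous l2}.
    by apply: continuous_subspaceW cl => x /=; rewrite in_itv/= => /andP[].
  have [le0|lt0] := leP 0 (l2 t).
    have [c' /[!in_itv]/= /andP[c0 _] E] : exists2 c', c' \in `[0, t] & l2 c' = pi / 2.
      apply: IVT => //; rewrite l0 min_l// max_r// (ltW ph0)/=.
      by rewrite ger0_norm in h.
    by have := cosn c' c0; rewrite E cos_pihalf eqxx.
  have [c' /[!in_itv]/= /andP[c0 _] E] : exists2 c', c' \in `[0, t] & l2 c' = - (pi / 2).
    apply: IVT => //; rewrite l0 min_r ?(ltW lt0)// max_l ?(ltW lt0)//.
    by rewrite oppr_le0 (ltW ph0) andbT lerNr -ltr0_norm.
  by have := cosn c' c0; rewrite E cosN cos_pihalf eqxx.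
move=> t t0; have [h1 h2] := H t t0.
have tn : tan (l2 t) = - (c * t).
  rewrite /tan -h2; have e0 : expR (l1 t) != 0 by rewrite gt_eqF// expR_gt0.
  have cE : cos (l2 t) = (expR (l1 t))^-1 by apply: (mulfI e0); rewrite h1 divff.
  by rewrite cE invrK mulrC.
have l2E : l2 t = - atan (c * t).
  by rewrite -atanN -tn tanK// in_itv/= -ltr_norml; exact: bnd.
split=> //; have c0 := cos_atan_gt0 (c * t).
rewrite -[LHS]expRK -lnV ?posrE//; congr ln.
move: h1; rewrite l2E cosN => h1.
by apply: (mulIf (lt0r_neq0 c0)); rewrite h1 mulVf// gt_eqF.
Qed.

End logarithm.

Lemma within_continuous_comp (R : realType) (V : topologicalType) (A : set R) (B : set V)
    (g : V -> R) (c : R -> V) : continuous c -> (forall t, A t -> B (c t)) ->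
  {within B, continuous g} -> {within A, continuous (g \o c)}.
Proof.
move=> cc AB /subspace_continuousP cg; apply/subspace_continuousP => x Ax.
apply: (cvg_comp c g _ (cg _ (AB _ Ax))) => U /= HU.
change (nbhs x [set t | A t -> U (c t)]).
have : nbhs x [set t | B (c t) -> U (c t)] := cc x _ HU.
by apply: filterS => t h At; exact: h (AB _ At).
Qed.

Section kp_gamma_theory.
Context (R : realType) (d : nat).
Local Open Scope complex_scope.
Variables (alpha : R) (C : 'M[R]_d).
Context d1 (T1 : measurableType d1) (P : probability T1 R) (Gamma : 'I_d -> {RV P >-> R}).
Hypotheses (alpha0 : 0 < alpha) (hGamma : kp_gamma Gamma alpha C).
Local Notation II := (0 +i* 1 : R[i]).
Local Notation Re := (@complex.Re R).
Local Notation Im := (@complex.Im R).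

Lemma charfn_Re (t : 'rV[R]_d) :
  Re (charfn Gamma t) = \int[P]_w cos (\sum_(j < d) t ord0 j * Gamma j w).
Proof. by rewrite /charfn /= unlock. Qed.

Lemma charfn_Im (t : 'rV[R]_d) :
  Im (charfn Gamma t) = \int[P]_w sin (\sum_(j < d) t ord0 j * Gamma j w).
Proof. by rewrite /charfn /= unlock. Qed.

Lemma cexp_opp_scale (z : R[i]) :
  cexp (- (alpha%:C * z)) = (expR (- (alpha * Re z)) * cos (alpha * Im z))
    +i* (- (expR (- (alpha * Re z)) * sin (alpha * Im z))).
Proof.
case: z => x y; rewrite /cexp /= !(mul0r, subr0, addr0, add0r).
by rewrite cosN sinN mulrN.
Qed.

Definition line (lambda : 'I_d -> R) (b t : R) : 'rV[R]_d := \row_j (t * lambda j + b).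

Lemma continuous_line lambda b : continuous (line lambda b).
Proof.
have -> : line lambda b = fun t => t *: (\row_j lambda j) + const_mx b.
  by apply/funext => t; apply/rowP => j; rewrite !mxE.
move=> t; apply: cvgD; last exact: cvg_cst.
by apply: cvgZr_tmp; exact: cvg_id.
Qed.

(** Only column j differs from the identity. Transposition makes it a row, and the expansion over
    the set {j} leaves a 1 by 1 determinant. *)
Lemma gamma_det_single (j : 'I_d) t :
  gamma_det C (line (fun k => (k == j)%:R) 0 t) = 1 - II * (C j j * t)%:C.
Proof.
rewrite gamma_detE -det_tr.
pose A : 'M[R[i]]_d := \matrix_(i, k) ((i == k)%:R - II * (C k i * t)%:C).
have -> : (\matrix_(i, k) ((i == k)%:R -
    II * (C i k * line (fun k => (k == j)%:R) 0 t ord0 k)%:C))^T =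
    \matrix_(i, k) (if i \in [set j]%SET then A i k else (i == k)%:R).
  apply/matrixP => i k; rewrite !mxE finset.in_set1 addr0 (eq_sym k i).
  by case: (i == j); rewrite ?mulr1// !mulr0 subr0.
rewrite det_rows_id.
have c1 : #|[set j]%SET| = 1%N by rewrite cards1.
have : forall i : 'I_#|[set j]%SET|, enum_val i = j.
  by move=> i; have := enum_valP i; rewrite finset.in_set1 => /eqP.
move: (@enum_val _ _) => f; move: f; rewrite c1 => f fj.
by rewrite det_mx11 !mxE !fj eqxx.
Qed.

(** The hypothesis speaks of t >= 0 only. The cosine transform extends to all t by evenness, which
    is why moments are extracted from it alone. *)
Lemma marginal_charfn (j : 'I_d) t :
  \int[P]_w cos (t * Gamma j w) = gamma_re alpha (C j j) 0 t.
Proof.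
have E0 (s : R) : 0 <= s -> \int[P]_w cos (s * Gamma j w) = gamma_re alpha (C j j) 0 s.
  move=> s0; have [L [L0 _ cI LD] LC] := hGamma.
  pose ell := line (fun k => (k == j)%:R) 0.
  have orth u : 0 <= u -> @orthant R d (ell u).
    by move=> u0 k; rewrite mxE addr0 mulr_ge0.
  have cl : {within [set u | 0 <= u], continuous (fun u => Im (L (ell u)))}.
    exact: (within_continuous_comp (@continuous_line _ 0) orth cI).
  have ell0 : ell 0 = 0 by apply/rowP => k; rewrite !mxE mul0r addr0.
  have H u : 0 <= u -> expR (Re (L (ell u))) * cos (Im (L (ell u))) = 1 /\
      expR (Re (L (ell u))) * sin (Im (L (ell u))) = - (C j j * u).
    move=> u0; have := LD _ (orth u u0); rewrite gamma_det_single.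
    move=> E; split.
      by have := congr1 Re E; rewrite /= => ->; ring.
    by have := congr1 Im E; rewrite /= => ->; ring.
  have [|h1 h2] := arg_continuous_unique cl _ H s0; first by rewrite ell0 L0.
  have := congr1 Re (LC _ (orth s s0)); rewrite charfn_Re cexp_opp_scale /= h1 h2.
  have -> : (fun w => cos (\sum_(k < d) ell s ord0 k * Gamma k w)) = fun w => cos (s * Gamma j w).
    apply/funext => w; rewrite (bigD1 j)//= big1 ?addr0.
      by rewrite mxE eqxx mulr1 addr0.
    by move=> k kj; rewrite mxE (negbTE kj) mulr0 addr0 mul0r.
  move=> ->; rewrite /gamma_re /gamma_wave /rising big_ord0 expr0 !mul1r addr0.
  by rewrite /quarter mul0r addr0 mulrN opprK mulrN cosN.
have [t0|/ltW t0] := leP 0 t; first exact: E0.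
have -> : (fun w => cos (t * Gamma j w)) = fun w => cos (- t * Gamma j w).
  by apply/funext => w; rewrite mulNr cosN.
rewrite E0 ?oppr_ge0// /gamma_re /gamma_wave mulrN atanN cosN /quarter mul0r !addr0.
by rewrite mulrN cosN.
Qed.

Lemma gamma_moment_growth (j0 : 'I_d) : moment_growth P (fun w => \sum_j `|Gamma j w|).
Proof.
(* One rate for all coordinates; the summand 1 ensures 1 <= A. *)
pose A := 1 + \sum_j (2 * `|C j j| * (alpha + 1)).
have pos j : 0 <= 2 * `|C j j| * (alpha + 1).
  by rewrite !mulr_ge0// addr_ge0// ltW.
apply: (@moment_growth_sum _ _ _ P d (fun j => Gamma j) A j0).
- by rewrite lerDl sumr_ge0.
- by move=> j; exact: measurable_funPT.
- move=> j n.
  have [I le1] := gamma_even_moment alpha0 n (measurable_funPT (Gamma j)) (marginal_charfn j).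
  split=> //; rewrite (le_trans le1)// ler_wpM2r// lerXn2r ?nnegrE//.
    by rewrite addr_ge0// sumr_ge0.
  by rewrite /A (bigD1 j)//= addrCA lerDl addr_ge0// sumr_ge0.
Qed.

Variable lambda : 'I_d -> R.

Definition gsum (w : T1) := \sum_(j < d) lambda j * Gamma j w.
Definition gtot (w : T1) := \sum_(j < d) Gamma j w.

Lemma measurable_gsum : measurable_fun setT gsum.
Proof. by apply: measurable_sum => j; exact: measurable_funM. Qed.

Lemma measurable_gtot : measurable_fun setT gtot.
Proof. by apply: measurable_sum => j; exact: measurable_funPT. Qed.

Let th (s b : R) w := s * gsum w + b * gtot w.

(* the real and imaginary parts of det * i E[gsum e^(i th)] + alpha det' E[e^(i th)] *)
Definition ode_re (s b : R) :=
  - (Re (det_at C lambda b).[s%:C] * Isin P gsum (th s b))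
  - Im (det_at C lambda b).[s%:C] * Icos P gsum (th s b)
  + alpha * (Re (det_at C lambda b)^`().[s%:C] * Icos P (cst 1) (th s b)
           - Im (det_at C lambda b)^`().[s%:C] * Isin P (cst 1) (th s b)).
Definition ode_im (s b : R) :=
  Re (det_at C lambda b).[s%:C] * Icos P gsum (th s b)
  - Im (det_at C lambda b).[s%:C] * Isin P gsum (th s b)
  + alpha * (Re (det_at C lambda b)^`().[s%:C] * Isin P (cst 1) (th s b)
           + Im (det_at C lambda b)^`().[s%:C] * Icos P (cst 1) (th s b)).

Variable j0 : 'I_d.

Let gabs w := \sum_j `|Gamma j w|.
(** One constant for both weights: it bounds [gsum] by la [gabs], and the summand 1 lets la (1 +
    [gabs]) bound the weight 1 too. *)
Let la := 1 + \sum_j `|lambda j|.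

Let la0 : 0 <= la. Proof. by rewrite addr_ge0// sumr_ge0. Qed.

Let gsum_le w : `|gsum w| <= la * gabs w.
Proof.
rewrite (le_trans (ler_norm_sum _ _ _))// mulr_sumr ler_sum// => j _.
rewrite normrM ler_wpM2r// /la (bigD1 j)//= addrCA lerDl addr_ge0// sumr_ge0//.
Qed.

Let gabs_ge0 w : 0 <= gabs w. Proof. exact: sumr_ge0. Qed.

Lemma L1_gsum : L1 P gsum.
Proof.
have [K [D [_ _ /(_ 1%N)[h _]]]] := gamma_moment_growth j0.
apply: L1_le measurable_gsum gsum_le _.
by apply: L1Zl; move: h; under eq_fun do rewrite expr1.
Qed.

Let I1 : L1 P (cst 1). Proof. exact: finite_measure_integrable_cst. Qed.

(** Strict inequalities keep the line in the orthant for all parameters near s. Continuity of the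
    logarithm within the orthant thus becomes continuity in the parameter, and the formula for the
    characteristic function can be differentiated at s. *)
Lemma ode_orthant s b : (forall j, 0 < s * lambda j + b) -> ode_re s b = 0 /\ ode_im s b = 0.
Proof.
move=> sb; have [L [L0 cR cI LD] LC] := hGamma.
pose ell := line lambda b.
have near_orth : \near s, @orthant R d (ell s).
  have : \forall t \near s, forall j : 'I_d, 0 < t * lambda j + b.
    refine (@filter_forall R 'I_d (fun j t => 0 < t * lambda j + b) (nbhs s) _ _) => j.
    apply: (@cvgr_gt _ _ (nbhs s) _ _ (s * lambda j + b)) => //.
    by apply: cvgD; [apply: cvgM; [exact: cvg_id|exact: cvg_cst]|exact: cvg_cst].
  by apply: filterS => t h j; rewrite mxE ltW.
have orth_s : @orthant R d (ell s) by exact: nbhs_singleton near_orth.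
have cl : Im (L (ell t)) @[t --> s] --> Im (L (ell s)).
  move/subspace_continuousP : cI => /(_ _ orth_s) cI U HU.
  have /= := @continuous_line lambda b s _ (cI U HU).
  by have := near_orth; apply: filterS2 => t h1 h2; exact: h2 h1.
have thE t w : \sum_(j < d) ell t ord0 j * Gamma j w = th t b w.
  rewrite /th /gsum /gtot !mulr_sumr -big_split; apply: eq_bigr => j _.
  by rewrite mxE /=; ring.
have Q := @log_power_ode R alpha (fun t => Re (L (ell t))) (fun t => Im (L (ell t)))
  (fun t => Re (det_at C lambda b).[t%:C]) (fun t => Im (det_at C lambda b).[t%:C])
  (fun t => Icos P (cst 1) (th t b)) (fun t => Isin P (cst 1) (th t b)) s
  (Re (det_at C lambda b)^`().[s%:C]) (Im (det_at C lambda b)^`().[s%:C])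
  (- Isin P gsum (th s b)) (Icos P gsum (th s b)).
have I1g : L1 P (fun w => cst 1 w * gsum w) by under eq_fun do rewrite mul1r; exact: L1_gsum.
have mb : measurable_fun setT (fun w => b * gtot w).
  by apply: measurable_funM => //; exact: measurable_gtot.
have g1 : (fun w => cst 1 w * gsum w) = gsum by apply/funext => w; rewrite mul1r.
have [|||||||q1 q2] := Q.
- apply: filterS near_orth => t ht; have := LD _ ht.
  rewrite -det_atE => E; split; first by have := congr1 Re E.
  by have := congr1 Im E.
- apply: filterS near_orth => t ht; have := LC _ ht; rewrite cexp_opp_scale => E.
  split.
    have := congr1 Re E; rewrite charfn_Re /= => <-.
    by apply: eq_Rintegral => w _; rewrite mul1r thE.
  have := congr1 Im E; rewrite charfn_Im /= => <-.
  by apply: eq_Rintegral => w _; rewrite mul1r thE.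
- exact: cl.
- exact: is_derive_horner_Re.
- exact: is_derive_horner_Im.
- have := @is_derive_Icos R _ _ P (cst 1) gsum (fun w => b * gtot w) s I1 I1g measurable_gsum mb.
  by rewrite g1.
- have := @is_derive_Isin R _ _ P (cst 1) gsum (fun w => b * gtot w) s I1 I1g measurable_gsum mb.
  by rewrite g1.
by rewrite /ode_re /ode_im; split; [rewrite -[RHS]q1|rewrite -[RHS]q2]; ring.
Qed.

(* The determinant is polynomial in b and the integrals are analytic in b, so
   the identity continues from large b to b = 0, where s * lambda may leave the
   orthant. *)
Lemma ode_line s : ode_re s 0 = 0 /\ ode_im s 0 = 0.
Proof.
have [K [D [K0 D0 SP]]] := gamma_moment_growth j0.
have rho0 : 0 < (2 * D)^-1 by rewrite invr_gt0 mulr_gt0.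
have mg (c : R) : measurable_fun setT (fun w => s * gsum w + c).
  by apply: measurable_funD => //; apply: measurable_funM => //; exact: measurable_gsum.
have gtot_le w : `|gtot w| <= gabs w by exact: ler_norm_sum.
(* The extra phase c makes the cosine case cover the sines, at c = -pi/2. *)
have aI (Z : T1 -> R) (c : R) : measurable_fun setT Z ->
    (forall w, `|Z w| <= la * (1 + gabs w)) ->
    uanalytic (2 * D)^-1 (fun b => Icos P Z (fun w => b * gtot w + (s * gsum w + c))).
  by move=> mZ ZS; apply: (uanalytic_Icos gabs_ge0 K0 D0 SP measurable_gtot (mg c) mZ gtot_le ZS).
have aC (Z : T1 -> R) : measurable_fun setT Z -> (forall w, `|Z w| <= la * (1 + gabs w)) ->
    uanalytic (2 * D)^-1 (fun b => Icos P Z (th s b)).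
  move=> mZ ZS; have := aI _ 0 mZ ZS; congr (uanalytic _ _); apply/funext => b.
  by apply: eq_Rintegral => w _; rewrite /th addr0 addrC.
have aS (Z : T1 -> R) : measurable_fun setT Z -> (forall w, `|Z w| <= la * (1 + gabs w)) ->
    uanalytic (2 * D)^-1 (fun b => Isin P Z (th s b)).
  move=> mZ ZS; have := aI _ (- (pi / 2)) mZ ZS; congr (uanalytic _ _); apply/funext => b.
  apply: eq_Rintegral => w _; rewrite addrA [b * _ + _]addrC -/(th s b w).
  by rewrite cosB cos_pihalf sin_pihalf mulr0 mulr1 add0r.
have Zg w : `|gsum w| <= la * (1 + gabs w).
  by rewrite (le_trans (gsum_le w))// ler_wpM2l// lerDr.
have Z1 w : `|(cst 1 : T1 -> R) w| <= la * (1 + gabs w).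
  by rewrite /= normr1 mulr_ege1// lerDl// sumr_ge0.
have m1 : measurable_fun setT (cst 1 : T1 -> R) by [].
pose q := (det2 C lambda).[s%:C%:P]; pose q' := (det2 C lambda)^`().[s%:C%:P].
have b0P b : 1 + \sum_j `|s * lambda j| <= b -> forall j, 0 < s * lambda j + b.
  move=> hb j; rewrite -ltrBlDl sub0r (lt_le_trans _ hb)//.
  rewrite (le_lt_trans (ler_norm _))// normrN (bigD1 j)//= addrCA ltrDl.
  by rewrite ltr_pwDl// sumr_ge0.
split.
- apply: (@uanalytic_eq0 _ _ rho0 (fun b => ode_re s b) (1 + \sum_j `|s * lambda j|));
    last by move=> b /b0P/ode_orthant[].
  have -> : (fun b => ode_re s b) = fun b : R =>
      (- map_poly Re q).[b] * Isin P gsum (th s b)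
      + (- map_poly Im q).[b] * Icos P gsum (th s b)
      + alpha * ((map_poly Re q').[b] * Icos P (cst 1) (th s b)
        + (- map_poly Im q').[b] * Isin P (cst 1) (th s b)).
    apply/funext => b; rewrite /ode_re det_at_horner deriv_det_at_horner.
    by rewrite !horner_Re !horner_Im !hornerN !mulNr.
  apply: (uanalyticD rho0); last apply: uanalyticZ; apply: (uanalyticD rho0);
    apply: (uanalytic_poly rho0).
  + exact: aS measurable_gsum Zg.
  + exact: aC measurable_gsum Zg.
  + exact: aC m1 Z1.
  + exact: aS m1 Z1.
- apply: (@uanalytic_eq0 _ _ rho0 (fun b => ode_im s b) (1 + \sum_j `|s * lambda j|));
    last by move=> b /b0P/ode_orthant[].
  have -> : (fun b => ode_im s b) = fun b : R =>
      (map_poly Re q).[b] * Icos P gsum (th s b)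
      + (- map_poly Im q).[b] * Isin P gsum (th s b)
      + alpha * ((map_poly Re q').[b] * Isin P (cst 1) (th s b)
        + (map_poly Im q').[b] * Icos P (cst 1) (th s b)).
    apply/funext => b; rewrite /ode_im det_at_horner deriv_det_at_horner.
    by rewrite !horner_Re !horner_Im !hornerN !mulNr.
  apply: (uanalyticD rho0); last apply: uanalyticZ; apply: (uanalyticD rho0);
    apply: (uanalytic_poly rho0).
  + exact: aC measurable_gsum Zg.
  + exact: aS measurable_gsum Zg.
  + exact: aS m1 Z1.
  + exact: aC m1 Z1.
Qed.

End kp_gamma_theory.

(** * Stein characterization *)

Section complex_expectation.
Context (R : realType) d (T : measurableType d) (P : probability T R).
Local Open Scope complex_scope.
Local Notation II := (0 +i* 1 : R[i]).

Definition cis (x : R) : R[i] := cos x +i* sin x.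

Lemma cis_quarter j : cis (quarter R j) = II ^+ j.
Proof.
elim: j => [|j IH]; first by rewrite /cis /quarter mul0r cos0 sin0 expr0.
rewrite exprS -IH /cis /quarter -natr1 mulrDl mul1r.
rewrite cosD sinD cos_pihalf sin_pihalf.
by apply/eqP; rewrite eq_complex /=; apply/andP; split; apply/eqP; ring.
Qed.

Definition Ecis (W A : T -> R) : R[i] := Icos P W A +i* Isin P W A.

Lemma Ecis_shift (W A : T -> R) c : L1 P W -> measurable_fun setT A ->
  Ecis W (fun w => A w + c) = cis c * Ecis W A.
Proof.
move=> IW mA; have Ic := L1_cos IW mA; have Is := L1_sin IW mA.
apply/eqP; rewrite eq_complex /=; apply/andP; split; apply/eqP.
  rewrite /Icos /Isin -!RintegralZl// -RintegralB//; [|exact: L1Zl..].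
  by apply: eq_Rintegral => w _; rewrite cosD; ring.
rewrite /Icos /Isin -!RintegralZl// -RintegralD//; [|exact: L1Zl..].
by apply: eq_Rintegral => w _; rewrite sinD; ring.
Qed.

Lemma Ecis_affine (W A : T -> R) a c : L1 P W -> measurable_fun setT A ->
  Ecis (fun w => a * W w + c) A = a%:C * Ecis W A + c%:C * Ecis (cst 1) A.
Proof.
move=> IW mA; have I1 : L1 P (cst 1) by exact: finite_measure_integrable_cst.
have Ic := L1_cos IW mA; have Is := L1_sin IW mA.
have Ic1 := L1_cos I1 mA; have Is1 := L1_sin I1 mA.
apply/eqP; rewrite eq_complex /= !mul0r !subr0 !addr0; apply/andP; split; apply/eqP.
  rewrite /Icos -!RintegralZl// -RintegralD//; [|exact: L1Zl..].
  by apply: eq_Rintegral => w _ /=; ring.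
rewrite /Isin -!RintegralZl// -RintegralD//; [|exact: L1Zl..].
by apply: eq_Rintegral => w _ /=; ring.
Qed.

End complex_expectation.

Lemma rcoef0 (R : realType) d (C : 'M[R]_d) lambda : rcoef C lambda 0 = 1.
Proof.
(* The cardinal of the empty set equals 0 only propositionally, so the empty determinant is
   evaluated for any n with a proof that n = 0. *)
have det1 n (A : 'M[R]_n) : n = 0%N -> \det A = 1.
  by move=> n0; move: A; rewrite n0 => A; rewrite det_mx00.
rewrite /rcoef (big_pred1 finset.set0); last by move=> S; rewrite cards_eq0.
rewrite big1 ?mulr1 => [|i]; last by rewrite finset.in_set0.
by rewrite /principal_minor det1// cards0.
Qed.

Section stein_symbol.
Context (R : realType) (d : nat) (C : 'M[R]_d) (lambda : 'I_d -> R) (alpha kappa : R).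
Local Open Scope complex_scope.
Local Notation II := (0 +i* 1 : R[i]).
Let p (t : R) := (det_at C lambda 0).[t%:C].
Let p' (t : R) := (det_at C lambda 0)^`().[t%:C].
Let r := rcoef C lambda.

Definition char_ode d0 (T : measurableType d0) (P : probability T R) (V : T -> R) :=
  forall t : R, p t * Ecis P V (fun w => t * V w) +
    alpha%:C * (kappa%:C * p t - II * p' t) * Ecis P (cst 1) (fun w => t * V w) = 0.

(** Since r_0 = 1, the case j = 0 is the coefficient of f itself in the theorem, and the whole
    identity becomes a single sum. *)
Definition stein_weight T (V : T -> R) (j : nat) (w : T) : R :=
  (-1) ^+ j * (r j * (V w + alpha * kappa) - alpha * j.+1%:R * r j.+1).

Context d0 (T : measurableType d0) (P : probability T R) (V : T -> R).
Hypothesis IV : L1 P V.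

Let mV : measurable_fun setT V. Proof. exact: L1_measurable IV. Qed.
Let I1 : L1 P (cst 1). Proof. exact: finite_measure_integrable_cst. Qed.

Lemma stein_weightE j : stein_weight V j =
  fun w => ((-1) ^+ j * r j) * V w + (-1) ^+ j * (r j * (alpha * kappa) - alpha * j.+1%:R * r j.+1).
Proof. by apply/funext => w; rewrite /stein_weight; ring. Qed.

Lemma L1_stein_weight j : L1 P (stein_weight V j).
Proof.
rewrite stein_weightE; apply: L1D; first exact: L1Zl.
exact: finite_measure_integrable_cst.
Qed.

(** On e^(itx) the j-th derivative gives (it)^j, which the sign turns into (-it)^j. The r_j then sum
    to p(t) and the (j + 1) r_(j+1) to i p'(t). *)
Lemma stein_symbol t :
  \sum_(j < d.+1) (t ^+ j)%:C * Ecis P (stein_weight V j) (fun w => t * V w + quarter R j) =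
  p t * Ecis P V (fun w => t * V w) +
    alpha%:C * (kappa%:C * p t - II * p' t) * Ecis P (cst 1) (fun w => t * V w).
Proof.
have mt : measurable_fun setT (fun w => t * V w) by exact: measurable_funM.
set E1 := Ecis P V _; set E0 := Ecis P (cst 1) _.
rewrite /p /p' det_at0_horner deriv_det_at0_horner.
have -> : forall x y : R[i], x * E1 + alpha%:C * (kappa%:C * x - II * y) * E0 =
  x * (E1 + alpha%:C * kappa%:C * E0) + y * (- (II * alpha%:C * E0)).
  by move=> *; ring.
rewrite !mulr_suml -big_split; apply: eq_bigr => j _ /=.
rewrite Ecis_shift//; last exact: L1_stein_weight.
rewrite cis_quarter stein_weightE Ecis_affine// -/E1 -/E0.
rewrite !(rmorphXn, rmorphM, rmorphB, rmorphN1, rmorphN, rmorph1) /=.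
have I2 : II * II = -1 by apply: complexP => /=; ring.
rewrite exprS (exprNn II) -mulrnAr -(mulr_natr (rcoef C lambda j.+1)%:C).
have -> : (j.+1%:R : R)%:C = j.+1%:R by rewrite rmorph_nat.
move: (j.+1%:R : R[i]) ((-1) ^+ j) (II ^+ j) (t%:C ^+ j) => m e i x.
rewrite -/r; move: (r j)%:C (r j.+1)%:C => r0 r1.
rewrite -[X in _ = _ + X]mulrA.
(* The imaginary unit is an indeterminate for [ring], so the product [II * II] is displayed in order
   to be replaced by -1. *)
transitivity (e * i * r0 * x * (E1 + alpha%:C * kappa%:C * E0) + (II * II) * (e * i * r1 * m * x * (alpha%:C * E0))).
  by rewrite I2; ring.
by ring.
Qed.

End stein_symbol.

Section stein_equation.
Context (R : realType) (d : nat) (C : 'M[R]_d) (lambda : 'I_d -> R) (alpha kappa : R).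
Local Open Scope complex_scope.
Context d0 (T : measurableType d0) (P : probability T R) (V : T -> R).
Hypothesis IV : L1 P V.
Local Notation weight := (stein_weight C lambda alpha kappa V).

Let mV : measurable_fun setT V. Proof. exact: L1_measurable IV. Qed.

Definition stein_equation := forall f, schwartz f ->
  \sum_(j < d.+1) \int[P]_w (weight j w * (f^`(j)%classic) (V w)) = 0.

(** The phases 0 and -pi/2 of the test waves give the real and the imaginary part of the
    equation. *)
Lemma stein_char_ode : stein_equation <-> char_ode C lambda alpha kappa P V.
Proof.
split=> [H t|H f].
  have S := charfn_of_stein mV (L1_stein_weight _ _ _ _ IV) H t.
  rewrite -stein_symbol//; apply: complexP.
    rewrite Re_sum -[RHS](S 0); apply: eq_bigr => j _.
    rewrite /= mul0r subr0; congr (_ * _); apply: eq_Rintegral => w _.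
    by rewrite addr0.
  rewrite Im_sum -[RHS](S (- (pi / 2))); apply: eq_bigr => j _.
  rewrite /= mul0r addr0; congr (_ * _); apply: eq_Rintegral => w _.
  by rewrite addrAC cosB cos_pihalf sin_pihalf mulr0 mulr1 add0r.
have E t := stein_symbol C lambda alpha kappa IV t.
apply: stein_of_charfn => //; first exact: L1_stein_weight.
  move=> t; have := congr1 (@complex.Re R) (E t); rewrite H Re_sum /= => h; rewrite -[RHS]h.
  by apply: eq_bigr => j _; rewrite mul0r subr0.
move=> t; have := congr1 (@complex.Im R) (E t); rewrite H Im_sum /= => h; rewrite -[RHS]h.
by apply: eq_bigr => j _; rewrite mul0r addr0.
Qed.

End stein_equation.

(* |w|^2 |p|^(2 alpha) has zero derivative along solutions. *)
Lemma ode_zero (R : realType) (alpha kappa : R) (p q p' q' u v u' v' : R -> R) :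
  (forall s : R, is_derive s 1 p (p' s)) -> (forall s : R, is_derive s 1 q (q' s)) ->
  (forall s : R, is_derive s 1 u (u' s)) -> (forall s : R, is_derive s 1 v (v' s)) ->
  (forall s, 0 < p s ^+ 2 + q s ^+ 2) ->
  (forall s, p s * u' s - q s * v' s + alpha * ((p' s - kappa * q s) * u s -
     (q' s + kappa * p s) * v s) = 0) ->
  (forall s, p s * v' s + q s * u' s + alpha * ((p' s - kappa * q s) * v s +
     (q' s + kappa * p s) * u s) = 0) ->
  u 0 = 0 -> v 0 = 0 -> forall s, u s = 0 /\ v s = 0.
Proof.
move=> dp dq du dv M0 E1 E2 u0 v0.
pose M s := p s ^+ 2 + q s ^+ 2.
pose N s := u s ^+ 2 + v s ^+ 2.
pose g s := N s * expR (alpha * ln (M s)).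
have dM (s : R) : is_derive s 1 M (2 * (p s * p' s + q s * q' s)).
  by have := dp s; have := dq s => ? ?; apply: is_derive_eq; rewrite /GRing.scale/= ?expr1; ring.
have dN (s : R) : is_derive s 1 N (2 * (u s * u' s + v s * v' s)).
  by have := du s; have := dv s => ? ?; apply: is_derive_eq; rewrite /GRing.scale/= ?expr1; ring.
have dg (s : R) : is_derive s 1 g 0.
  have h := @is_derive1_comp _ _ _ s _ _ (is_derive1_ln (M0 s)) (dM s).
  have h1 := @is_derive1_comp _ expR (fun s => alpha * ln (M s)) s _ _ (is_derive_expR _) (is_deriveZ alpha h).
  have := dN s => h2; have h3 := is_deriveM h2 h1.
  rewrite /g; apply: (is_derive_eq h3); rewrite /GRing.scale/=.
  have Mn : M s != 0 by rewrite gt_eqF// M0.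
  have : 2 * (u s * u' s + v s * v' s) * M s + alpha * N s * (2 * (p s * p' s + q s * q' s)) = 0.
    (* Twice the real part of the equation multiplied by the conjugate of (p + iq)(u + iv). The term
       in kappa becomes purely imaginary and drops out. *)
    transitivity (2 * (0 * (p s * u s - q s * v s) + 0 * (p s * v s + q s * u s))); last by ring.
    by rewrite -{1}(E1 s) -(E2 s) /M /N; ring.
  move=> /eqP; rewrite addr_eq0 => /eqP h4.
  apply: (mulfI Mn); rewrite mulr0 -/(M s).
  rewrite [LHS](_ : _ = expR (alpha * ln (M s)) * (2 * (u s * u' s + v s * v' s) * M s +
    alpha * N s * (2 * (p s * p' s + q s * q' s)))); last by field.
  by rewrite h4 addNr mulr0.
move=> s; have : N s = 0.
  have := is_derive_0_is_cst s 0 dg; rewrite /g /N u0 v0 !expr0n /= addr0 mul0r.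
  by move=> /eqP; rewrite mulf_eq0 [expR _ == 0]gt_eqF ?expR_gt0// orbF => /eqP.
move=> /eqP; rewrite /N paddr_eq0 ?sqr_ge0// !sqrf_eq0 => /andP[/eqP ? /eqP ?].
by [].
Qed.

Section char_ode_unique.
Context (R : realType) (d : nat) (C : 'M[R]_d) (lambda : 'I_d -> R) (alpha kappa : R).
Hypothesis hC : symposdef C.
Local Open Scope complex_scope.
Local Notation Re := (@complex.Re R).
Local Notation Im := (@complex.Im R).
Context d1 (T1 : measurableType d1) (P1 : probability T1 R) (V1 : {RV P1 >-> R}).
Context d2 (T2 : measurableType d2) (P2 : probability T2 R) (V2 : {RV P2 >-> R}).

Let is_derive_Icos1 d0 (T : measurableType d0) (P : probability T R) (V : T -> R) (t : R) :
  L1 P V -> is_derive t 1 (fun t => Icos P (cst 1) (fun w => t * V w))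
    (- Isin P V (fun w => t * V w)).
Proof.
move=> IV; have I1 : L1 P (cst 1) by exact: finite_measure_integrable_cst.
have g1 : (fun w => cst 1 w * V w) = V by apply/funext => w; rewrite mul1r.
have e (s : R) : (fun w => s * V w + (cst 0 : T -> R) w) = fun w => s * V w.
  by apply/funext => w; rewrite addr0.
have := @is_derive_Icos R _ _ P (cst 1) V (cst 0) t I1; rewrite g1.
move=> /(_ IV (L1_measurable IV) (measurable_cst _)); rewrite e.
by congr (is_derive _ _ _ _); apply/funext => s; rewrite e.
Qed.

Let is_derive_Isin1 d0 (T : measurableType d0) (P : probability T R) (V : T -> R) (t : R) :
  L1 P V -> is_derive t 1 (fun t => Isin P (cst 1) (fun w => t * V w))
    (Icos P V (fun w => t * V w)).
Proof.
move=> IV; have I1 : L1 P (cst 1) by exact: finite_measure_integrable_cst.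
have g1 : (fun w => cst 1 w * V w) = V by apply/funext => w; rewrite mul1r.
have e (s : R) : (fun w => s * V w + (cst 0 : T -> R) w) = fun w => s * V w.
  by apply/funext => w; rewrite addr0.
have := @is_derive_Isin R _ _ P (cst 1) V (cst 0) t I1; rewrite g1.
move=> /(_ IV (L1_measurable IV) (measurable_cst _)); rewrite e.
by congr (is_derive _ _ _ _); apply/funext => s; rewrite e.
Qed.

Lemma char_ode_unique : L1 P1 V1 -> L1 P2 V2 ->
  char_ode C lambda alpha kappa P1 V1 -> char_ode C lambda alpha kappa P2 V2 ->
  same_law V1 V2.
Proof.
move=> IV1 IV2 O1 O2.
pose u t := Icos P1 (cst 1) (fun w => t * V1 w) - Icos P2 (cst 1) (fun w => t * V2 w).
pose v t := Isin P1 (cst 1) (fun w => t * V1 w) - Isin P2 (cst 1) (fun w => t * V2 w).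
pose u' t := - Isin P1 V1 (fun w => t * V1 w) - (- Isin P2 V2 (fun w => t * V2 w)).
pose v' t := Icos P1 V1 (fun w => t * V1 w) - Icos P2 V2 (fun w => t * V2 w).
have du (t : R) : is_derive t 1 u (u' t) by apply: is_deriveB; exact: is_derive_Icos1.
have dv (t : R) : is_derive t 1 v (v' t) by apply: is_deriveB; exact: is_derive_Isin1.
pose D := det_at C lambda 0.
have D0 (s : R) : 0 < Re D.[s%:C] ^+ 2 + Im D.[s%:C] ^+ 2.
  rewrite lt_def addr_ge0 ?sqr_ge0// andbT paddr_eq0 ?sqr_ge0// !sqrf_eq0.
  have := gamma_det_neq0 (\row_j (s * lambda j + 0)) hC; rewrite -det_atE.
  by rewrite eq_complex.
have v0 : v 0 = 0.
  rewrite /v /Isin -[RHS](subrr (0 : R)); congr (_ - _).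
    by under eq_Rintegral do rewrite mul0r sin0 mulr0; rewrite Rintegral_cst// mul0r.
  by under eq_Rintegral do rewrite mul0r sin0 mulr0; rewrite Rintegral_cst// mul0r.
have u0 : u 0 = 0.
  have c1 d0 (T : measurableType d0) (P : probability T R) (V : T -> R) :
      Icos P (cst 1) (fun w => 0 * V w) = 1.
    have -> : Icos P (cst 1) (fun w => 0 * V w) = \int[P]_w (cst 1 w).
      by apply: eq_Rintegral => w _; rewrite mul0r cos0 mulr1.
    by rewrite Rintegral_cst//= mul1r; have := probability_setT P => /= ->.
  by rewrite /u !c1 subrr.
(* The derivative of E e^(itV) is i E[V e^(itV)], so the equation is used after multiplication by i:
   the first identity comes from the imaginary parts, the second from the real ones. *)
have E s : (Re D.[s%:C] * u' s - Im D.[s%:C] * v' s + alpha *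
    ((Re D^`().[s%:C] - kappa * Im D.[s%:C]) * u s -
     (Im D^`().[s%:C] + kappa * Re D.[s%:C]) * v s) = 0) *
  (Re D.[s%:C] * v' s + Im D.[s%:C] * u' s + alpha *
    ((Re D^`().[s%:C] - kappa * Im D.[s%:C]) * v s +
     (Im D^`().[s%:C] + kappa * Re D.[s%:C]) * u s) = 0).
  rewrite /u /v /u' /v'; have := O2 s; have := O1 s; rewrite -/D /Ecis.
  move: (Icos P1 V1 _) (Isin P1 V1 _) (Icos P2 V2 _) (Isin P2 V2 _).
  move: (Icos P1 _ _) (Isin P1 _ _) (Icos P2 _ _) (Isin P2 _ _).
  move: D.[_] D^`().[_] => z z'; clear; case: z z' => pr pi [qr qi].
  move=> c1 s1 c2 s2 a1 b1 a2 b2 h1 h2.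
  have := congr1 Im h2; have := congr1 Re h2; have := congr1 Im h1; have := congr1 Re h1.
  rewrite /= !(mul0r, mulr0, mul1r, subr0, addr0, add0r, sub0r, opprK) => r1 i1 r2 i2.
  split.
    by rewrite -[RHS](subrr (0 : R)) -{1}i2 -i1; ring.
  by rewrite -[RHS](subrr (0 : R)) -{1}r1 -r2; ring.
have H := @ode_zero R alpha kappa (fun s => Re D.[s%:C]) (fun s => Im D.[s%:C])
  (fun s => Re D^`().[s%:C]) (fun s => Im D^`().[s%:C]) u v u' v'
  (fun s => is_derive_horner_Re D s) (fun s => is_derive_horner_Im D s) du dv D0
  (fun s => (E s).1) (fun s => (E s).2) u0 v0.
by apply: charfn_unique => t; apply/eqP; rewrite -subr_eq0; apply/eqP; have [] := H t.
Qed.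

End char_ode_unique.

Section gamma_char_ode.
Context (R : realType) (d : nat) (C : 'M[R]_d) (lambda k : 'I_d -> R) (alpha : R).
Local Open Scope complex_scope.
Local Notation II := (0 +i* 1 : R[i]).
Context d1 (T1 : measurableType d1) (P : probability T1 R) (Gamma : 'I_d -> {RV P >-> R}).
Hypotheses (alpha0 : 0 < alpha) (hGamma : kp_gamma Gamma alpha C).
Let kappa := \sum_(j < d) lambda j * k j.
Variable j0 : 'I_d.
Local Notation G := (gsum Gamma lambda).

Let gamma_combE : gamma_comb Gamma alpha lambda k = fun w => 1 * G w + - (alpha * kappa).
Proof.
apply/funext => w; rewrite /gamma_comb /gsum mul1r -mulrN /kappa -sumrN mulr_sumr -big_split.
by apply: eq_bigr => i _ /=; ring.
Qed.

Let IG : L1 P G. Proof. exact: (L1_gsum alpha0 hGamma). Qed.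

Lemma L1_gamma_comb : L1 P (gamma_comb Gamma alpha lambda k).
Proof.
rewrite gamma_combE; apply: L1D; first exact: L1Zl.
exact: finite_measure_integrable_cst.
Qed.

(** Centering by m = -alpha kappa multiplies both expectations by e^(itm), and the constant m in the
    weight cancels the term alpha kappa p. What remains is [ode_line] times -i e^(itm). *)
Lemma gamma_comb_char_ode : char_ode C lambda alpha kappa P (gamma_comb Gamma alpha lambda k).
Proof.
move=> t; rewrite gamma_combE; set m := - (alpha * kappa).
have mG := L1_measurable IG.
have I1 : L1 P (cst 1) by exact: finite_measure_integrable_cst.
have mt : measurable_fun setT (fun w => t * G w) by exact: measurable_funM.
have -> : (fun w => t * (1 * G w + m)) = fun w => t * G w + t * m.
  by apply/funext => w; rewrite mul1r mulrDr.
have mtm : measurable_fun setT (fun w => t * G w + t * m) by exact: measurable_funD.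
rewrite Ecis_affine// !Ecis_shift//.
have [] := ode_line alpha0 hGamma lambda j0 t; rewrite /ode_re /ode_im.
have -> : (fun w => t * G w + 0 * gtot Gamma w) = fun w => t * G w.
  by apply/funext => w; rewrite mul0r addr0.
set D := det_at C lambda 0; rewrite /Ecis.
have -> : m%:C = - (alpha%:C * kappa%:C) by rewrite /m rmorphN rmorphM.
move: (Icos P G _) (Isin P G _) (Icos P (cst 1) _) (Isin P (cst 1) _) (cis _) => a b c s e h1 h2.
have h : II * D.[t%:C] * (a +i* b) + alpha%:C * D^`().[t%:C] * (c +i* s) = 0.
  move: h1 h2; move: D.[_] D^`().[_] => z z'; clear; case: z z' => pr pi [qr qi] h1 h2.
  by apply: complexP; [rewrite -[RHS]h1|rewrite -[RHS]h2] => /=; ring.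
have I2 : II * II = -1 by apply: complexP => /=; ring.
transitivity (e * (- II) * (II * D.[t%:C] * (a +i* b) + alpha%:C * D^`().[t%:C] * (c +i* s)));
  last by rewrite h mulr0.
have -> : (1%:C : R[i]) = 1 by rewrite rmorph1.
move: (a +i* b) (c +i* s) D.[_] D^`().[_] (alpha%:C) (kappa%:C) => g1 g0 z z' a' k'.
transitivity (e * z * g1 - II * (e * a' * z' * g0)); first by ring.
transitivity (- (II * II) * (e * z * g1) - II * (e * a' * z' * g0)); last by ring.
by rewrite I2; ring.
Qed.

End gamma_char_ode.

Section same_law_theory.
Context (R : realType) d1 (T1 : measurableType d1) d2 (T2 : measurableType d2).
Context (P1 : probability T1 R) (P2 : probability T2 R).
Context (V1 : {RV P1 >-> R}) (V2 : {RV P2 >-> R}).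

Lemma same_law_Rint (h : R -> R) : same_law V1 V2 -> measurable_fun setT h ->
  L1 P1 (h \o V1) -> L1 P2 (h \o V2) -> \int[P1]_w h (V1 w) = \int[P2]_w h (V2 w).
Proof.
move=> V12 mh I1 I2; rewrite /Rintegral; congr fine.
have mh' : measurable_fun setT (EFin \o h) by exact/measurable_EFinP.
rewrite -[LHS](integral_distribution (X := V1) mh' I1).
rewrite -[RHS](integral_distribution (X := V2) mh' I2).
by apply: eq_measure_integral => A mA _; exact: V12.
Qed.

Lemma same_law_char_ode d (C : 'M[R]_d) lambda alpha kappa : same_law V1 V2 ->
  L1 P1 V1 -> L1 P2 V2 ->
  char_ode C lambda alpha kappa P2 V2 -> char_ode C lambda alpha kappa P1 V1.
Proof.
move=> V12 I1 I2 O t.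
have [mV1 mV2] := (L1_measurable I1, L1_measurable I2).
have mt : measurable_fun setT (fun x : R => t * x) by exact: measurable_funM.
have E h : measurable_fun setT h -> L1 P1 (h \o V1) -> L1 P2 (h \o V2) ->
    Ecis P1 (h \o V1) (fun w => t * V1 w) = Ecis P2 (h \o V2) (fun w => t * V2 w).
  move=> mh J1 J2; apply: complexP => /=.
    apply: (same_law_Rint (h := fun x => h x * cos (t * x))) => //.
    - by apply: measurable_funM => //; apply: measurableT_comp mt; exact: measurable_cos.
    - by apply: L1_cos => //; exact: measurableT_comp mV1.
    - by apply: L1_cos => //; exact: measurableT_comp mV2.
  apply: (same_law_Rint (h := fun x => h x * sin (t * x))) => //.
  - by apply: measurable_funM => //; apply: measurableT_comp mt; exact: measurable_sin.
  - by apply: L1_sin => //; exact: measurableT_comp mV1.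
  - by apply: L1_sin => //; exact: measurableT_comp mV2.
have -> : Ecis P1 V1 (fun w => t * V1 w) = Ecis P2 V2 (fun w => t * V2 w) by exact: (E id).
have -> : Ecis P1 (cst 1) (fun w => t * V1 w) = Ecis P2 (cst 1) (fun w => t * V2 w).
  by apply: (E (cst 1)) => //; exact: finite_measure_integrable_cst.
exact: O.
Qed.

End same_law_theory.

(** Integrability matters here: the real integral takes the value 0 also when the extended one is
    infinite. *)
Lemma expectation_eq0 (R : realType) d (T : measurableType d) (P : probability T R)
  (g : T -> R) : L1 P g -> ('E_P[g] = 0)%E <-> \int[P]_w g w = 0.
Proof.
move=> Ig; rewrite unlock /Rintegral -(fineK (integrable_fin_num measurableT Ig)) /=.
by split=> [[->]|->].
Qed.

Theorem theorem2p3 (R : realType) (d : nat) (hd : (1 <= d)%N)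
    (lambda k : 'I_d -> R) (alpha : R) (halpha : 0 < alpha)
    (C : 'M[R]_d) (hC : symposdef C)
    (d1 : measure_display) (T1 : measurableType d1) (P : probability T1 R)
    (Gamma : 'I_d -> {RV P >-> R}) (hGamma : kp_gamma Gamma alpha C)
    (d2 : measure_display) (T2 : measurableType d2) (Q : probability T2 R)
    (Y : {RV Q >-> R}) (hY : ('E_Q[fun w => `|Y w|%R] < +oo)%E) :
  let F : {RV P >-> R} := gamma_comb Gamma alpha lambda k in
  let kappa := \sum_(j < d) lambda j * k j in
  let r := rcoef C lambda in
  same_law Y F <->
  forall f : R -> R, schwartz f ->
    ('E_Q[fun w => ((Y w + alpha * (kappa - r 1%N)) * f (Y w)
        + \sum_(1 <= j < d.+1)
            (-1) ^+ j * (r j * (Y w + alpha * kappa)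
                         - alpha * j.+1%:R * r j.+1)
            * (f^`(j)%classic) (Y w))%R] = 0)%E.
Proof.
move=> F kappa r.
have j0 : 'I_d := Ordinal hd.
have IF : L1 P F by exact: (L1_gamma_comb lambda k halpha hGamma j0).
have OF : char_ode C lambda alpha kappa P F by exact: (gamma_comb_char_ode lambda k halpha hGamma j0).
have IY : L1 Q Y.
  apply/integrableP; split; first exact/measurable_EFinP/measurable_funPT.
  by move: hY; rewrite unlock.
have steinP : stein_equation C lambda alpha kappa Q Y <-> forall f : R -> R, schwartz f ->
    ('E_Q[fun w => ((Y w + alpha * (kappa - r 1%N)) * f (Y w)
        + \sum_(1 <= j < d.+1)
            (-1) ^+ j * (r j * (Y w + alpha * kappa)
                         - alpha * j.+1%:R * r j.+1)
            * (f^`(j)%classic) (Y w))%R] = 0)%E.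
  have IW f j : schwartz f ->
      L1 Q (fun w => stein_weight C lambda alpha kappa Y j w * (f^`(j)%classic) (Y w)).
    move=> fS; have [M fM] := decays_bounded (schwartz_decays j fS).
    apply: (@L1_bM _ _ _ _ _ _ M) => //; first exact: L1_stein_weight.
    apply: measurableT_comp (measurable_funPT Y).
    by apply: continuous_measurable_fun; exact: schwartz_continuous.
  have E f : (fun w => ((Y w + alpha * (kappa - r 1%N)) * f (Y w)
        + \sum_(1 <= j < d.+1)
            (-1) ^+ j * (r j * (Y w + alpha * kappa)
                         - alpha * j.+1%:R * r j.+1)
            * (f^`(j)%classic) (Y w))) = fun w =>
      \sum_(j < d.+1) stein_weight C lambda alpha kappa Y j w * (f^`(j)%classic) (Y w).
    apply/funext => w; rewrite -(big_mkord xpredT (fun j =>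
      stein_weight C lambda alpha kappa Y j w * (f^`(j)%classic) (Y w))).
    (* The term j = 0 is split off; r_0 = 1 turns it into the separate first term of the
       identity. *)
    rewrite big_ltn//; congr (_ + _).
    by rewrite /stein_weight rcoef0 derive1n0 /r; ring.
  split=> H f fS; have := H f fS.
    by rewrite E => h; apply/expectation_eq0; [apply: L1_sum => j _; exact: IW
      | rewrite Rint_sum// => j _; exact: IW].
  by rewrite E expectation_eq0; [rewrite Rint_sum// => j _; exact: IW
    | apply: L1_sum => j _; exact: IW].
split=> [YF|H].
  by apply/steinP/stein_char_ode => //; exact: (same_law_char_ode YF).
by apply: (char_ode_unique hC) OF => //; apply/stein_char_ode => //; exact/steinP.
Qed.
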